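(* Let $L>0$, $T>0$ and let $\{\omega_n\}_{n\in\mathbb{N}}$ be constants chosen such that the limit $d:=\lim_{n\to\infty}\frac{n}{\omega_n^2}>0$ exists. Define $$e_n^{\pm}(x,t)=\exp(\pm i\omega_n x-\omega_n^2t),\qquad E_n^{\pm}(y,t)=\mathbf{T}[e_n^{\pm}(x,t)]=e^{-\omega_n^2t}\,\mathbf{T}[e^{\pm i\omega_n x}],\qquad n\in\mathbb{N},$$ where $\mathbf{T}$ acts with respect to the variable $x$. Then the functions $E_n^{\pm}$ are solutions of the equation $\mathbf{C}u=u_t$, i.e. $(\mathbf{C}-\partial_t)E_n^{\pm}=0$, and they form a complete system of solutions for the equation $\mathbf{C}u=u_t$ on any compact contained in $[0,L]\times(0,T]$.
   Context: Coefficients. The functions $p,p',q,w,w'$ are real valued and continuous on $[0,L]$, $p'$ and $w'$ are absolutely continuous, and $p>0$, $w>0$ on $[0,L]$. The differential expression is $\mathbf{C}u=\frac{1}{w(y)}\left(\frac{\partial}{\partial y}\left(p(y)\frac{\partial u}{\partial y}\right)-q(y)u\right)$. Put $\rho(y)=[p(y)w(y)]^{1/4}$, $l(y)=\int_0^y (w(s)/p(s))^{1/2}\,ds$ and $b=l(L)$. Let $f$ be a non-vanishing (in general complex-valued) solution on $[0,L]$ of $(pf')'-qf=0$ with $f(0)=1/\rho(0)$. Transmutation operator. It is known that there is a unique continuous linear operator $\mathbf{T}:C[-b,b]\to C[0,L]$ such that, for every $h\in C^2[-b,b]$, the function $u=\mathbf{T}h$ satisfies $\mathbf{C}\mathbf{T}h=\mathbf{T}h''$,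 $u(0)=\frac{h(0)}{\rho(0)}$ and $u'(0)=h(0)f'(0)+h'(0)\frac{1}{\rho(0)}\sqrt{\frac{w(0)}{p(0)}}$; in particular $\mathbf{T}[1]=f$. It has the form $\mathbf{T}h(y)=\frac{h(l(y))}{\rho(y)}+\int_{-l(y)}^{l(y)}K(y,t)h(t)\,dt$ for a complex-valued kernel $K$. Completeness. That the system $\{E_n^{\pm}\}_{n\in\mathbb{N}}$ is a complete system of solutions for $\mathbf{C}u=u_t$ on any compact contained in $[0,L]\times(0,T]$ means: for any solution $u\in C^{2,1}([0,L]\times(0,T])$ of $\mathbf{C}u=u_t$, any compact set $Q\subset[0,L]\times(0,T]$ (which may touch $y=0$ and $y=L$) and any $\varepsilon>0$ there exist an integer $N=N(\varepsilon,Q)$ and constants $a_0^{\pm},\dots,a_N^{\pm}$ such that $\max_{(y,t)\in Q}\left|u(y,t)-\sum_{n=0}^N \left(a_n^+E_n^+(y,t)+a_n^-E_n^-(y,t)\right)\right|<\varepsilon$. Here $C^{2,1}$ means twice continuously differentiable in $y$ and once in $t$, and the index $n$ runs over $0,1,2,\dots$.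
   Formalization: The constants ω_n are assumed pairwise distinct; without this the completeness claim fails, e.g. when the ω_n² repeat so often that the sum of 1/ω_n² over the distinct values converges. *)

(* Defs.v *)
(* Stdlib reals with Coquelicot.  Functions on an interval are total functions
   on R of which only the values on the interval matter; complex numbers are
   Coquelicot's C, seen as a real normed space when differentiating. *)
From Stdlib Require Import Reals List.
From Coquelicot Require Import Coquelicot.
Open Scope R_scope.

Definition Icc (a b : R) : R -> Prop := fun x => a <= x <= b.
Definition Ioc (a b : R) : R -> Prop := fun x => a < x <= b.

(* Derivative relative to a set D: Coquelicot's [is_derive] with the filter
   restricted to D, hence one-sided at an end point of an interval. *)
Definition is_derive_in {V : NormedModule R_AbsRing}
  (D : R -> Prop) (f : R -> V) (x : R) (l : V) : Prop :=
  filterdiff f (within D (locally x)) (fun y : R => scal y l).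

Definition derivative_on {V : NormedModule R_AbsRing}
  (D : R -> Prop) (f f' : R -> V) : Prop :=
  forall x, D x -> is_derive_in D f x (f' x).

(* The intervals are (a 0, b 0), ..., (a n, b n). *)
Definition abs_continuous_on (c d : R) (f : R -> R) : Prop :=
  forall eps, 0 < eps -> exists delta, 0 < delta /\
    forall (n : nat) (a b : nat -> R),
      (forall i, (i <= n)%nat -> c <= a i /\ a i <= b i /\ b i <= d) ->
      (forall i j, (i <= n)%nat -> (j <= n)%nat -> i <> j ->
         b i <= a j \/ b j <= a i) ->
      sum_n (fun i => b i - a i) n < delta ->
      sum_n (fun i => Rabs (f (b i) - f (a i))) n < eps.

Definition compact_set {X : UniformSpace} (Q : X -> Prop) : Prop :=
  forall (I : Type) (U : I -> X -> Prop),
    (forall i, open (U i)) ->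
    (forall z, Q z -> exists i, U i z) ->
    exists s : list I, forall z, Q z -> exists i, In i s /\ U i z.

Definition Cexp (z : C) : C := (exp (Re z) * cos (Im z), exp (Re z) * sin (Im z)).

Record admissible_coefficients (L : R) (p p' q w w' : R -> R) : Prop := {
  coeff_p_cont : continuous_on (Icc 0 L) p;
  coeff_p'_cont : continuous_on (Icc 0 L) p';
  coeff_q_cont : continuous_on (Icc 0 L) q;
  coeff_w_cont : continuous_on (Icc 0 L) w;
  coeff_w'_cont : continuous_on (Icc 0 L) w';
  coeff_p_deriv : derivative_on (Icc 0 L) p p';
  coeff_w_deriv : derivative_on (Icc 0 L) w w';
  coeff_p'_ac : abs_continuous_on 0 L p';
  coeff_w'_ac : abs_continuous_on 0 L w';
  coeff_p_pos : forall y, 0 <= y <= L -> 0 < p y;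
  coeff_w_pos : forall y, 0 <= y <= L -> 0 < w y
}.

(* (p u')' = v on [0,L]. *)
Definition is_pdiv (L : R) (p : R -> R) (u v : R -> C) : Prop :=
  exists u' : R -> C,
    derivative_on (V := C_R_NormedModule) (Icc 0 L) u u' /\
    derivative_on (V := C_R_NormedModule) (Icc 0 L)
      (fun y => (RtoC (p y) * u' y)%C) v.

(* C u = g on [0,L], where C u = ((p u')' - q u) / w. *)
Definition is_Cop (L : R) (p q w : R -> R) (u g : R -> C) : Prop :=
  exists v : R -> C, is_pdiv L p u v /\
    forall y, 0 <= y <= L ->
      g y = (RtoC (/ w y) * (v y - RtoC (q y) * u y))%C.

Definition rho (p w : R -> R) (y : R) : R := Rpower (p y * w y) (1 / 4).
Definition lfun (p w : R -> R) (y : R) : R := RInt (fun s => sqrt (w s / p s)) 0 y.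

Record particular_solution (L : R) (p q w : R -> R) (f f' : R -> C) : Prop := {
  part_deriv : derivative_on (V := C_R_NormedModule) (Icc 0 L) f f';
  part_eq : is_pdiv L p f (fun y => (RtoC (q y) * f y)%C);
  part_nonzero : forall y, 0 <= y <= L -> f y <> RtoC 0;
  part_init : f 0 = RtoC (1 / rho p w 0)
}.

(* T is a continuous linear operator C[-b,b] -> C[0,L] for the sup norms.
   [clo_cts], taken at functions agreeing on [-b,b], shows that T h on [0,L]
   depends only on h on [-b,b]. *)
Record continuous_linear_operator (b L : R) (T : (R -> C) -> R -> C) : Prop := {
  clo_maps : forall h : R -> C, continuous_on (Icc (- b) b) h ->
    continuous_on (Icc 0 L) (T h);
  clo_add : forall h g : R -> C,
    continuous_on (Icc (- b) b) h -> continuous_on (Icc (- b) b) g ->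
    forall y, 0 <= y <= L -> T (fun x => (h x + g x)%C) y = (T h y + T g y)%C;
  clo_scal : forall (c : C) (h : R -> C), continuous_on (Icc (- b) b) h ->
    forall y, 0 <= y <= L -> T (fun x => (c * h x)%C) y = (c * T h y)%C;
  clo_cts : forall h : R -> C, continuous_on (Icc (- b) b) h ->
    forall eps, 0 < eps -> exists delta, 0 < delta /\
      forall g : R -> C, continuous_on (Icc (- b) b) g ->
        (forall x, - b <= x <= b -> Cmod (g x - h x)%C < delta) ->
        forall y, 0 <= y <= L -> Cmod (T g y - T h y)%C < eps
}.

(* f0' is the number f'(0); h ranges over C^2[-b,b], with derivatives h', h''. *)
Record transmutation_operator (L : R) (p q w : R -> R) (f0' : C)
  (T : (R -> C) -> R -> C) : Prop := {
  trans_clo : continuous_linear_operator (lfun p w L) L T;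
  trans_spec : forall h h' h'' : R -> C,
    let J := Icc (- lfun p w L) (lfun p w L) in
    derivative_on (V := C_R_NormedModule) J h h' ->
    derivative_on (V := C_R_NormedModule) J h' h'' ->
    continuous_on J h'' ->
    is_Cop L p q w (T h) (T h'') /\
    T h 0 = (h 0 / RtoC (rho p w 0))%C /\
    is_derive_in (V := C_R_NormedModule) (Icc 0 L) (T h) 0
      (h 0 * f0' + h' 0 * RtoC (1 / rho p w 0 * sqrt (w 0 / p 0)))%C
}.

Definition strip (L tmax : R) : R * R -> Prop :=
  fun z => Icc 0 L (fst z) /\ Ioc 0 tmax (snd z).

(* u, of class C^{2,1} on [0,L] x (0,tmax], with time derivative ut. *)
Definition is_C21 (L tmax : R) (u ut : R -> R -> C) : Prop :=
  exists uy uyy : R -> R -> C,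
    (forall t, Ioc 0 tmax t ->
       derivative_on (V := C_R_NormedModule) (Icc 0 L)
         (fun y => u y t) (fun y => uy y t)) /\
    (forall t, Ioc 0 tmax t ->
       derivative_on (V := C_R_NormedModule) (Icc 0 L)
         (fun y => uy y t) (fun y => uyy y t)) /\
    (forall y, Icc 0 L y ->
       derivative_on (V := C_R_NormedModule) (Ioc 0 tmax) (u y) (ut y)) /\
    continuous_on (strip L tmax) (fun z => u (fst z) (snd z)) /\
    continuous_on (strip L tmax) (fun z => uy (fst z) (snd z)) /\
    continuous_on (strip L tmax) (fun z => uyy (fst z) (snd z)) /\
    continuous_on (strip L tmax) (fun z => ut (fst z) (snd z)).

(* u is a C^{2,1} solution of C u = u_t on [0,L] x (0,tmax]. *)
Definition parabolic_solution (L tmax : R) (p q w : R -> R) (u : R -> R -> C) : Prop :=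
  exists ut : R -> R -> C, is_C21 L tmax u ut /\
    forall t, Ioc 0 tmax t ->
      is_Cop L p q w (fun y => u y t) (fun y => ut y t).

(* The bound on the maximum over Q is written pointwise; both functions are
   continuous on the compact set Q, so the maximum is attained. *)
Definition complete_system (L tmax : R) (p q w : R -> R)
  (Ep Em : nat -> R -> R -> C) : Prop :=
  forall u : R -> R -> C, parabolic_solution L tmax p q w u ->
  forall Q : R * R -> Prop, compact_set Q -> (forall z, Q z -> strip L tmax z) ->
  forall eps, 0 < eps ->
  exists (N : nat) (ap am : nat -> C),
    forall y t, Q (y, t) ->
      Cmod (u y t - sum_n (fun n => ap n * Ep n y t + am n * Em n y t) N)%C < eps.

(* e_n^{+-} with the sign s = 1 or s = -1: exp (s i omega x - omega^2 t). *)
Definition exp_solution (s : R) (omega : C) (x t : R) : C :=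
  Cexp (RtoC s * Ci * omega * RtoC x - omega ^ 2 * RtoC t)%C.

(* E_n^{+-} = T[e_n^{+-}], T acting in the variable x. *)
Definition transmuted_exp (T : (R -> C) -> R -> C) (s : R) (omega : C) (y t : R) : C :=
  T (fun x => exp_solution s omega x t) y.

(* Main.v *)
Require Import Defs.
From Stdlib Require Import Reals Factorial List Lra Lia FunctionalExtensionality Classical.
From Coquelicot Require Import Coquelicot.
Open Scope R_scope.

(** Put X_n^{+-} = T[e^{+-i omega_n x}].  The transmutation property makes X_n^{+-}
   solutions of C X = - omega_n^2 X with value 1 / rho(0) and slope
   f'(0) +- i omega_n c at y = 0, for a constant c > 0
   ([transmuted_mode]), so that
   E_n^{+-} = e^{-omega_n^2 t} X_n^{+-} solves C u = u_t ([mode_parabolic]).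

   Completeness rests on the Cauchy problem in the direction of y.  Let u be a
   solution, and suppose that a combination V of the E_n^{+-} has almost the same
   values and slopes as u on the line y = 0.  This lateral Cauchy problem is
   ill-posed, so u - V need not be small.  It becomes stable after averaging in
   time: the operator A_a, the mean over [t-a,t], commutes with C, and since
   C v = v_t the function C A_a v is a difference quotient, at most 2/a times the
   supremum of v, while solving C v = g from the Cauchy data at y = 0 gains two
   integrations in y ([cauchy_problem_bound], where the non-vanishing solution f
   is used).  For the composition of n averages over lengths a_0, ..., a_(n-1)
   this bounds the averaged solution by

     const . (size of the Cauchy data) . sum_k K^k (2/a_0) ... (2/a_(k-1)) L^(2k) / (2k)!

   plus the supremum of v times the n-th term of the same series
   ([avgs_majorant]).  With a_k of the order of k^(-3/2) the a_k have a finite,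
   arbitrarily small sum and the series converges; letting n tend to infinity,
   the dependence on the supremum of v disappears ([avgs_stability]).  Averages
   over a short total length change u little, and they multiply each E_n^{+-} by
   a constant ([combination_avgs]).  So u is approximated by the average of V,
   which is a combination of the E_n^{+-} ([modes_complete]).

   It remains to approximate two continuous functions of t, the value and the
   slope of u at y = 0, by combinations of e^{-omega_n^2 t}: the data of E_n^+
   and E_n^- span both ([match_cauchy_data]).  This is a Muntz theorem
   ([muntz]): starting from e^{-q t}, applying the inner functions
   (z - conj mu) / (z + mu) on the Laplace side for mu = omega_n^2 does not
   increase the norm in L^2(0,S) ([blaschke_energy]) while the coefficient of
   e^{-q t} is multiplied by |q + mu| / |q - mu|, and the product of these
   factors diverges because n / omega_n^2 has a positive limit.  Hence all
   e^{-q t} with q > 0 are limits, and with them, by Bernstein polynomials in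
   e^{-t}, all continuous functions ([expclosure_continuous]). *)

(** * Derivatives relative to an interval *)

(** The definition quantifies over the limit points of the filter; for a point x
   of D the only one is x itself. *)
Lemma is_derive_in_iff {V : NormedModule R_AbsRing} (D : R -> Prop) (f : R -> V) (x : R) (l : V) :
  D x ->
  (is_derive_in D f x l <->
   forall eps, 0 < eps -> exists delta, 0 < delta /\ forall y, D y -> Rabs (y - x) < delta ->
     norm (minus (minus (f y) (f x)) (scal (y - x) l)) <= eps * Rabs (y - x)).
Proof.
  intros Dx; split.
  - intros [_ H] eps Heps.
    assert (Hlim : is_filter_lim (within D (locally x)) x).
    { intros P HP. unfold within. now apply filter_imp with (2 := HP). }
    destruct (H x Hlim (mkposreal eps Heps)) as [d Hd].
    exists d; split; [apply cond_pos|]. intros y Dy Hy. exact (Hd y Hy Dy).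
  - intros H. split; [exact (is_linear_scal_l (K := R_AbsRing) l)|].
    intros x' Hx' eps.
    assert (Exx : x' = x).
    { destruct (Req_dec x' x) as [e|n]; [exact e|exfalso].
      assert (Hp : 0 < Rabs (x - x')) by (apply Rabs_pos_lt; lra).
      assert (Hl : locally x' (fun z => Rabs (z - x') < Rabs (x - x'))).
      { exists (mkposreal _ Hp). intros y Hy. exact Hy. }
      apply Hx' in Hl. destruct Hl as [d Hd].
      specialize (Hd x (ball_center x d) Dx). lra. }
    subst x'. destruct (H eps (cond_pos eps)) as [d [Hd Hd']].
    exists (mkposreal d Hd). intros y Hy Dy. exact (Hd' y Dy Hy).
Qed.

Notation dOn D f f' := (derivative_on (V := R_NormedModule) D f f').
Notation cdOn D f f' := (derivative_on (V := C_R_NormedModule) D f f').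

(** This reduces complex-valued functions to their real and imaginary parts, and
   makes the calculus of two-sided real derivatives available. *)
Lemma is_derive_in_C (D : R -> Prop) (f : R -> C) (x : R) (l : C) : D x ->
  (is_derive_in (V := C_R_NormedModule) D f x l <->
   is_derive_in (V := R_NormedModule) D (fun y => Re (f y)) x (Re l) /\
   is_derive_in (V := R_NormedModule) D (fun y => Im (f y)) x (Im l)).
Proof.
  intros Dx. rewrite !is_derive_in_iff by exact Dx.
  assert (N : forall z : C, Rabs (Re z) <= norm (z : C_R_NormedModule) /\
     Rabs (Im z) <= norm (z : C_R_NormedModule) /\
     norm (z : C_R_NormedModule) <= 2 * Rmax (Rabs (Re z)) (Rabs (Im z))).
  { intros [u v]. destruct (norm_prod (K := R_AbsRing) (U := R_NormedModule) (V := R_NormedModule) u v) as [H1 H2].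
    split; [|split].
    - apply Rle_trans with (2 := H1). apply Rmax_l.
    - apply Rle_trans with (2 := H1). apply Rmax_r.
    - apply Rle_trans with (1 := H2). apply Rmult_le_compat_r.
      + apply Rle_trans with (2 := Rmax_l _ _). apply Rabs_pos.
      + apply Rsqr_incr_0_var; [rewrite Rsqr_sqrt; unfold Rsqr; lra|lra]. }
  split.
  - intros H; split; intros eps He; destruct (H eps He) as [d [Hd Hd']];
      exists d; split; trivial; intros y Dy Hy; specialize (Hd' y Dy Hy);
      apply Rle_trans with (2 := Hd').
    + exact (proj1 (N (minus (minus (f y) (f x)) (scal (y - x) l) : C_R_NormedModule))).
    + exact (proj1 (proj2 (N (minus (minus (f y) (f x)) (scal (y - x) l) : C_R_NormedModule)))).
  - intros [H1 H2] eps He.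
    destruct (H1 (eps/2) ltac:(lra)) as [d1 [Hd1 Hd1']].
    destruct (H2 (eps/2) ltac:(lra)) as [d2 [Hd2 Hd2']].
    exists (Rmin d1 d2); split; [now apply Rmin_pos|].
    intros y Dy Hy.
    specialize (Hd1' y Dy (Rlt_le_trans _ _ _ Hy (Rmin_l _ _))).
    specialize (Hd2' y Dy (Rlt_le_trans _ _ _ Hy (Rmin_r _ _))).
    apply Rle_trans with (1 := proj2 (proj2 (N _))).
    change (Rabs (Re (minus (minus (f y) (f x)) (scal (y - x) l : C_R_NormedModule)))
      <= eps/2 * Rabs (y-x)) in Hd1'.
    change (Rabs (Im (minus (minus (f y) (f x)) (scal (y - x) l : C_R_NormedModule)))
      <= eps/2 * Rabs (y-x)) in Hd2'.
    assert (Rmax (Rabs (Re (minus (minus (f y) (f x)) (scal (y - x) l : C_R_NormedModule))))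
       (Rabs (Im (minus (minus (f y) (f x)) (scal (y - x) l : C_R_NormedModule)))) <= eps/2 * Rabs (y-x)).
    { now apply Rmax_lub. }
    apply Rle_trans with (2 * (eps/2 * Rabs (y - x))); [apply Rmult_le_compat_l; [lra|assumption]|lra].
Qed.

Lemma derivative_on_C D f f' :
  cdOn D f f' <-> dOn D (fun y => Re (f y)) (fun y => Re (f' y)) /\
                  dOn D (fun y => Im (f y)) (fun y => Im (f' y)).
Proof.
  split.
  - intros H; split; intros x Dx; now apply (is_derive_in_C D f x (f' x) Dx), H.
  - intros [H1 H2] x Dx. apply is_derive_in_C; auto.
Qed.

Lemma is_derive_is_derive_in D f x l :
  D x -> is_derive (V := R_NormedModule) f x l -> is_derive_in (V := R_NormedModule) D f x l.
Proof.
  intros Dx [_ H]. apply is_derive_in_iff; trivial. intros eps He.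
  destruct (H x (fun P HP => HP) (mkposreal eps He)) as [d Hd].
  exists d; split; [apply cond_pos|]. intros y _ Hy. exact (Hd y Hy).
Qed.

Lemma is_derive_in_ext D (f g : R -> R) x l : D x ->
  (forall y, D y -> f y = g y) -> is_derive_in (V := R_NormedModule) D f x l ->
  is_derive_in (V := R_NormedModule) D g x l.
Proof.
  intros Dx E. rewrite !is_derive_in_iff by exact Dx.
  intros H eps He. destruct (H eps He) as [d [Hd Hd']]. exists d; split; trivial.
  intros y Dy Hy. rewrite <- !E by trivial. now apply Hd'.
Qed.

Lemma is_derive_in_subset (D D' : R -> Prop) (f : R -> R) x l : D x ->
  (forall y, D y -> D' y) -> is_derive_in (V := R_NormedModule) D' f x l ->
  is_derive_in (V := R_NormedModule) D f x l.
Proof.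
  intros Dx E H. assert (D'x := E x Dx). revert H. rewrite !is_derive_in_iff by trivial.
  intros H eps He. destruct (H eps He) as [d [Hd Hd']]. exists d; split; trivial.
  intros y Dy Hy. apply Hd'; auto.
Qed.

Definition clamp (a b x : R) : R := Rmax a (Rmin b x).

Lemma clamp_in a b x : a <= b -> a <= clamp a b x <= b.
Proof. intros; unfold clamp, Rmax, Rmin; repeat destruct Rle_dec; lra. Qed.

Lemma clamp_id a b x : a <= x <= b -> clamp a b x = x.
Proof. intros; unfold clamp, Rmax, Rmin; repeat destruct Rle_dec; lra. Qed.

Lemma clamp_lipschitz a b x y : Rabs (clamp a b y - clamp a b x) <= Rabs (y - x).
Proof.
  unfold clamp, Rmax, Rmin; repeat destruct Rle_dec; unfold Rabs;
    repeat destruct Rcase_abs; lra.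
Qed.

(** The extension by affine functions turns one-sided derivatives at the end
   points into two-sided ones. *)
Definition affine_ext (a b : R) (f f' : R -> R) (x : R) : R :=
  f (clamp a b x) + f' (clamp a b x) * (x - clamp a b x).

Lemma affine_ext_id a b f f' x : a <= x <= b -> affine_ext a b f f' x = f x.
Proof. intros H. unfold affine_ext. rewrite clamp_id by trivial. ring. Qed.

Lemma affine_ext_derive a b f f' : dOn (Icc a b) f f' ->
  forall x, a <= x <= b -> is_derive (affine_ext a b f f') x (f' x).
Proof.
  intros H x Hx. split; [exact (is_linear_scal_l (K := R_AbsRing) _)|].
  intros x' Hx' eps. apply (is_filter_lim_locally_unique (K := R_AbsRing) (V := R_NormedModule)) in Hx'. subst x'.
  destruct (proj1 (is_derive_in_iff (Icc a b) f x (f' x) Hx) (H x Hx) eps (cond_pos eps)) as [d [Hd Hd']].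
  assert (Hd2 : 0 < Rmin d (Rmin (if Rle_lt_dec x a then 1 else x - a) (if Rle_lt_dec b x then 1 else b - x))).
  { repeat apply Rmin_pos; trivial; destruct Rle_lt_dec; lra. }
  exists (mkposreal _ Hd2). intros y Hy. change (Rabs (y - x) < Rmin d (Rmin (if Rle_lt_dec x a then 1 else x - a) (if Rle_lt_dec b x then 1 else b - x))) in Hy.
  assert (Hyd := Rlt_le_trans _ _ _ Hy (Rmin_l _ _)).
  assert (Hy2 := Rlt_le_trans _ _ _ Hy (Rmin_r _ _)).
  assert (Hya := Rlt_le_trans _ _ _ Hy2 (Rmin_l _ _)).
  assert (Hyb := Rlt_le_trans _ _ _ Hy2 (Rmin_r _ _)).
  change (Rabs ((affine_ext a b f f' y - affine_ext a b f f' x) - (y - x) * f' x) <= eps * Rabs (y - x)).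
  rewrite (affine_ext_id a b f f' x) by trivial.
  destruct (Rle_dec a y) as [ay|ay]; [destruct (Rle_dec y b) as [yb|yb]|].
  - rewrite affine_ext_id by lra. now apply Hd'.
  - assert (x = b).
    { destruct (Rle_lt_dec b x); [lra|]. apply Rabs_def2 in Hyb. lra. }
    subst x. unfold affine_ext.
    replace (clamp a b y) with b by (unfold clamp, Rmax, Rmin; repeat destruct Rle_dec; lra).
    replace (_ - _ - _) with 0 by ring. rewrite Rabs_R0.
    apply Rmult_le_pos; [left; apply cond_pos|apply Rabs_pos].
  - assert (x = a).
    { destruct (Rle_lt_dec x a); [lra|]. apply Rabs_def2 in Hya. lra. }
    subst x. unfold affine_ext.
    replace (clamp a b y) with a by (unfold clamp, Rmax, Rmin; repeat destruct Rle_dec; lra).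
    replace (_ - _ - _) with 0 by ring. rewrite Rabs_R0.
    apply Rmult_le_pos; [left; apply cond_pos|apply Rabs_pos].
Qed.

(** Hence a derivative on an interval may be computed as if it were two-sided. *)
Lemma derivative_on_of_ext a b f f' F :
  (forall x, a <= x <= b -> F x = f x) ->
  (forall x, a <= x <= b -> is_derive F x (f' x)) -> dOn (Icc a b) f f'.
Proof.
  intros E H x Hx. apply is_derive_in_ext with F; trivial.
  apply is_derive_is_derive_in; auto.
Qed.

Lemma derivative_on_plus a b f f' g g' :
  dOn (Icc a b) f f' -> dOn (Icc a b) g g' ->
  dOn (Icc a b) (fun x => f x + g x) (fun x => f' x + g' x).
Proof.
  intros Hf Hg.
  apply derivative_on_of_ext with (fun x => affine_ext a b f f' x + affine_ext a b g g' x).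
  - intros x Hx. now rewrite !affine_ext_id.
  - intros x Hx. apply (is_derive_plus (K := R_AbsRing) (V := R_NormedModule)); now apply affine_ext_derive.
Qed.

Lemma derivative_on_mult a b f f' g g' :
  dOn (Icc a b) f f' -> dOn (Icc a b) g g' ->
  dOn (Icc a b) (fun x => f x * g x) (fun x => f' x * g x + f x * g' x).
Proof.
  intros Hf Hg.
  apply derivative_on_of_ext with (fun x => affine_ext a b f f' x * affine_ext a b g g' x).
  - intros x Hx. now rewrite !affine_ext_id.
  - intros x Hx. rewrite <- (affine_ext_id a b g g' x) at 1 by trivial.
    rewrite <- (affine_ext_id a b f f' x) at 1 by trivial.
    apply Derive.is_derive_mult; now apply affine_ext_derive.
Qed.

Lemma derivative_on_inv a b f f' :
  (forall x, a <= x <= b -> f x <> 0) -> dOn (Icc a b) f f' ->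
  dOn (Icc a b) (fun x => / f x) (fun x => - f' x / f x ^ 2).
Proof.
  intros H0 Hf.
  apply derivative_on_of_ext with (fun x => / affine_ext a b f f' x).
  - intros x Hx. now rewrite !affine_ext_id.
  - intros x Hx. rewrite <- (affine_ext_id a b f f' x) at 1 by trivial.
    apply is_derive_inv; [now apply affine_ext_derive|]. rewrite affine_ext_id; auto.
Qed.

Lemma derivative_on_const a b c : dOn (Icc a b) (fun _ => c) (fun _ => 0).
Proof.
  intros x Hx. apply is_derive_is_derive_in; trivial. exact (is_derive_const (K := R_AbsRing) (V := R_NormedModule) c x).
Qed.

Lemma derivative_on_ext (D : R -> Prop) (f g f' g' : R -> R) :
  (forall x, D x -> f x = g x) -> (forall x, D x -> f' x = g' x) ->
  dOn D f f' -> dOn D g g'.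
Proof.
  intros E E' H x Dx. rewrite <- E' by trivial. apply is_derive_in_ext with f; auto.
Qed.

Lemma derivative_on_scal a b c f f' :
  dOn (Icc a b) f f' -> dOn (Icc a b) (fun x => c * f x) (fun x => c * f' x).
Proof.
  intros H. apply derivative_on_ext with (3 := derivative_on_mult a b _ _ _ _ (derivative_on_const a b c) H);
    intros; simpl; ring.
Qed.

Lemma derivative_on_minus a b f f' g g' :
  dOn (Icc a b) f f' -> dOn (Icc a b) g g' ->
  dOn (Icc a b) (fun x => f x - g x) (fun x => f' x - g' x).
Proof.
  intros Hf Hg.
  apply derivative_on_ext with (3 := derivative_on_plus a b _ _ _ _ Hf (derivative_on_scal a b (-1) _ _ Hg));
    intros; simpl; ring.
Qed.

Lemma is_derive_in_unique a b (f : R -> R) x l l' : a < b -> Icc a b x ->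
  is_derive_in (V := R_NormedModule) (Icc a b) f x l ->
  is_derive_in (V := R_NormedModule) (Icc a b) f x l' -> l = l'.
Proof.
  intros ab Hx Hf Hg. rewrite is_derive_in_iff in Hf, Hg by exact Hx.
  destruct (Req_dec l l') as [e|n]; trivial. exfalso.
  assert (P : 0 < Rabs (l - l')) by (apply Rabs_pos_lt; lra).
  destruct (Hf (Rabs (l - l') / 4) ltac:(lra)) as [d [Hd Hd']].
  destruct (Hg (Rabs (l - l') / 4) ltac:(lra)) as [d2 [Hd2 Hd2']].
  set (h := Rmin (d / 2) (d2 / 2)).
  assert (Hh : 0 < h /\ h < d /\ h < d2) by (unfold h, Rmin; destruct Rle_dec; lra).
  assert (exists y, Icc a b y /\ Rabs (y - x) <= h /\ 0 < Rabs (y - x)) as [y [Dy [Hy Py]]].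
  { unfold Icc in *. destruct (Rle_lt_dec b x).
    - exists (x - Rmin h (b - a)). unfold Rmin, Rabs; destruct Rle_dec; repeat destruct Rcase_abs; lra.
    - exists (x + Rmin h (b - x)). unfold Rmin, Rabs; destruct Rle_dec; repeat destruct Rcase_abs; lra. }
  specialize (Hd' y Dy ltac:(lra)). specialize (Hd2' y Dy ltac:(lra)).
  change (Rabs ((f y - f x) - (y - x) * l) <= Rabs (l - l') / 4 * Rabs (y - x)) in Hd'.
  change (Rabs ((f y - f x) - (y - x) * l') <= Rabs (l - l') / 4 * Rabs (y - x)) in Hd2'.
  assert (E : Rabs (l - l') * Rabs (y - x) <= Rabs (l - l') / 2 * Rabs (y - x)).
  { rewrite <- Rabs_mult.
    replace ((l - l') * (y - x)) with (((f y - f x) - (y - x) * l') + - ((f y - f x) - (y - x) * l)) by ring.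
    apply Rle_trans with (1 := Rabs_triang _ _). rewrite Rabs_Ropp. lra. }
  nra.
Qed.

Lemma derivative_on_unique a b (f f' g' : R -> R) : a < b ->
  dOn (Icc a b) f f' -> dOn (Icc a b) f g' -> forall x, a <= x <= b -> f' x = g' x.
Proof.
  intros ab Hf Hg x Hx. now apply (is_derive_in_unique a b f x); auto.
Qed.

Lemma derivative_on_continuous a b f f' : dOn (Icc a b) f f' ->
  forall x, a <= x <= b -> continuous (affine_ext a b f f') x.
Proof.
  intros H x Hx. apply (ex_derive_continuous (K := R_AbsRing) (V := R_NormedModule)).
  eexists. now apply affine_ext_derive.
Qed.

Lemma derivative_on_bound a b f f' (G G' : R -> R) : a <= b ->
  dOn (Icc a b) f f' ->
  (forall x, a <= x <= b -> is_derive G x (G' x)) ->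
  (forall x, a <= x <= b -> Rabs (f' x) <= G' x) ->
  forall x, a <= x <= b -> Rabs (f x - f a) <= G x - G a.
Proof.
  intros ab Hf HG Hb x Hx.
  assert (K : forall s, Rabs s <= 1 -> s * (f x - f a) <= G x - G a).
  { intros s Hs.
    assert (HD : forall y, a <= y <= x ->
      is_derive (fun y => G y - s * affine_ext a b f f' y) y (G' y - s * f' y)).
    { intros y Hy. apply (is_derive_minus (K := R_AbsRing) (V := R_NormedModule)).
      - apply HG; lra.
      - apply (is_derive_scal (affine_ext a b f f')). apply affine_ext_derive; trivial; lra. }
    destruct (MVT_gen (fun y => G y - s * affine_ext a b f f' y) a x (fun y => G' y - s * f' y))
      as [c [Hc E]].
    - intros y Hy. rewrite Rmin_left, Rmax_right in Hy by lra. apply HD; lra.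
    - intros y Hy. rewrite Rmin_left, Rmax_right in Hy by lra.
      apply continuity_pt_filterlim.
      apply (ex_derive_continuous (K := R_AbsRing) (V := R_NormedModule)
        (fun y => G y - s * affine_ext a b f f' y)).
      exists (G' y - s * f' y). apply HD; lra.
    - rewrite Rmin_left, Rmax_right in Hc by lra.
      rewrite !affine_ext_id in E by lra.
      assert (s * f' c <= G' c).
      { apply Rle_trans with (Rabs (s * f' c)); [apply Rle_abs|]. rewrite Rabs_mult.
        assert (Q := Hb c ltac:(lra)). assert (Q2 := Rabs_pos (f' c)). nra. }
      assert (0 <= (G' c - s * f' c) * (x - a)) by (apply Rmult_le_pos; lra).
      lra. }
  apply Rabs_le. split.
  - assert (Q := K (-1)). rewrite Rabs_left in Q by lra. specialize (Q ltac:(lra)). lra.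
  - assert (Q := K 1). rewrite Rabs_pos_eq in Q by lra. specialize (Q ltac:(lra)). lra.
Qed.

(** * The Cauchy problem in the space variable *)

Lemma derivative_on_bounded a b f f' : a <= b -> dOn (Icc a b) f f' ->
  exists B, forall x, a <= x <= b -> Rabs (f x) <= B.
Proof.
  intros ab H.
  destruct (continuity_ab_maj (fun x => Rabs (affine_ext a b f f' x)) a b ab) as [M [HM _]].
  - intros c Hc. apply continuity_pt_filterlim.
    apply continuous_Rabs_comp. exact (derivative_on_continuous a b f f' H c Hc).
  - exists (Rabs (affine_ext a b f f' M)). intros x Hx. specialize (HM x Hx). simpl in HM.
    now rewrite affine_ext_id in HM at 1.
Qed.

(** The Cauchy problem at y = 0 for (p v')' = q v + w g is solved explicitly
   with the help of the non-vanishing solution f: if W = p (v' f - v f') then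
   W' = w f g and (v / f)' = W / (p f^2), so that two integrations of g bound v. *)
Lemma cauchy_problem_bound (L : R) (p p' q w w' : R -> R) (f f' : R -> C) :
  0 < L ->
  admissible_coefficients L p p' q w w' ->
  particular_solution L p q w f f' ->
  exists K, 0 < K /\
    forall (v v' g H H' H'' : R -> R) (e : R),
      dOn (Icc 0 L) v v' ->
      dOn (Icc 0 L) (fun y => p y * v' y) (fun y => w y * g y + q y * v y) ->
      Rabs (v 0) <= e -> Rabs (v' 0) <= e ->
      (forall y, is_derive H y (H' y)) -> (forall y, is_derive H' y (H'' y)) ->
      H 0 = 0 -> H' 0 = 0 ->
      (forall y, 0 <= y <= L -> Rabs (g y) <= H'' y) ->
      forall y, 0 <= y <= L -> Rabs (v y) <= K * (e + H y).
Proof.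
  intros HL Hc Hf.
  destruct (part_eq _ _ _ _ _ _ Hf) as [f1 [Hf1 Hf2]].
  apply derivative_on_C in Hf1. destruct Hf1 as [Ha Hb].
  apply derivative_on_C in Hf2. destruct Hf2 as [Pa Pb].
  set (fa := fun y => Re (f y)) in *. set (fb := fun y => Im (f y)) in *.
  set (ga := fun y => Re (f1 y)) in *. set (gb := fun y => Im (f1 y)) in *.
  apply derivative_on_ext with (g := fun y => p y * ga y) (g' := fun y => q y * fa y) in Pa;
    [|intros; unfold ga, Re, Im, Cmult, RtoC; simpl; ring|intros; unfold fa, Re, Im, Cmult, RtoC; simpl; ring].
  apply derivative_on_ext with (g := fun y => p y * gb y) (g' := fun y => q y * fb y) in Pb;
    [|intros; unfold gb, Re, Im, Cmult, RtoC; simpl; ring|intros; unfold fb, Re, Im, Cmult, RtoC; simpl; ring].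
  assert (D0 : forall y, 0 <= y <= L -> fa y * fa y + fb y * fb y <> 0).
  { intros y Hy E. apply (part_nonzero _ _ _ _ _ _ Hf y Hy).
    assert (fa y = 0) by nra. assert (fb y = 0) by nra.
    unfold fa, fb in *. destruct (f y); simpl in *; subst; reflexivity. }
  assert (P0 : forall y, 0 <= y <= L -> p y <> 0).
  { intros y Hy E. assert (Q := coeff_p_pos _ _ _ _ _ _ Hc y Hy). lra. }
  assert (Hp := coeff_p_deriv _ _ _ _ _ _ Hc).
  assert (Hw := coeff_w_deriv _ _ _ _ _ _ Hc).
  assert (HD := derivative_on_plus _ _ _ _ _ _ (derivative_on_mult _ _ _ _ _ _ Ha Ha)
                  (derivative_on_mult _ _ _ _ _ _ Hb Hb)).
  assert (HI := derivative_on_inv _ _ _ _ D0 HD).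
  assert (HIp := derivative_on_inv _ _ _ _ P0 Hp).
  assert (Hra := derivative_on_mult _ _ _ _ _ _ Ha HI).
  assert (Hrb := derivative_on_mult _ _ _ _ _ _ Hb HI).
  (* the coefficients of z' = (v / f)' as a combination of Re W and Im W *)
  assert (HA := derivative_on_mult _ _ _ _ _ _ HIp
    (derivative_on_minus _ _ _ _ _ _ (derivative_on_mult _ _ _ _ _ _ Hra Hra)
       (derivative_on_mult _ _ _ _ _ _ Hrb Hrb))).
  assert (HB := derivative_on_mult _ _ _ _ _ _ HIp
    (derivative_on_scal _ _ 2 _ _ (derivative_on_mult _ _ _ _ _ _ Hra Hrb))).
  assert (L0 : 0 <= L) by lra.
  destruct (derivative_on_bounded _ _ _ _ L0 Hp) as [B1 K1].
  destruct (derivative_on_bounded _ _ _ _ L0 Hw) as [B2 K2].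
  destruct (derivative_on_bounded _ _ _ _ L0 Ha) as [B3 K3].
  destruct (derivative_on_bounded _ _ _ _ L0 Hb) as [B4 K4].
  destruct (derivative_on_bounded _ _ _ _ L0 Pa) as [B5 K5].
  destruct (derivative_on_bounded _ _ _ _ L0 Pb) as [B6 K6].
  destruct (derivative_on_bounded _ _ _ _ L0 Hra) as [B7 K7].
  destruct (derivative_on_bounded _ _ _ _ L0 Hrb) as [B8 K8].
  destruct (derivative_on_bounded _ _ _ _ L0 HA) as [B9 K9].
  destruct (derivative_on_bounded _ _ _ _ L0 HB) as [B10 K10].
  set (B := 1 + Rabs B1 + Rabs B2 + Rabs B3 + Rabs B4 + Rabs B5 + Rabs B6 + Rabs B7 + Rabs B8
     + Rabs B9 + Rabs B10).
  assert (HB' : 1 <= B /\ B1 <= B /\ B2 <= B /\ B3 <= B /\ B4 <= B /\ B5 <= B /\ B6 <= B /\ B7 <= B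
     /\ B8 <= B /\ B9 <= B /\ B10 <= B).
  { unfold B. assert (X1 := Rabs_pos B1). assert (X2 := Rabs_pos B2). assert (X3 := Rabs_pos B3).
    assert (X4 := Rabs_pos B4). assert (X5 := Rabs_pos B5). assert (X6 := Rabs_pos B6).
    assert (X7 := Rabs_pos B7). assert (X8 := Rabs_pos B8). assert (X9 := Rabs_pos B9).
    assert (X10 := Rabs_pos B10).
    assert (Y1 := Rle_abs B1). assert (Y2 := Rle_abs B2). assert (Y3 := Rle_abs B3).
    assert (Y4 := Rle_abs B4). assert (Y5 := Rle_abs B5). assert (Y6 := Rle_abs B6).
    assert (Y7 := Rle_abs B7). assert (Y8 := Rle_abs B8). assert (Y9 := Rle_abs B9).
    assert (Y10 := Rle_abs B10). lra. }
  clearbody B.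
  assert (J : forall (h : R -> R) Bi, (forall x, 0 <= x <= L -> Rabs (h x) <= Bi) -> Bi <= B ->
     forall x, 0 <= x <= L -> Rabs (h x) <= B).
  { intros h Bi Q1 Q2 x Hx. apply Rle_trans with Bi; auto. }
  assert (H1 : 1 <= B) by tauto.
  assert (K1' := J _ _ K1 ltac:(tauto)); clear K1; rename K1' into K1. assert (K2' := J _ _ K2 ltac:(tauto)); clear K2; rename K2' into K2. assert (K3' := J _ _ K3 ltac:(tauto)); clear K3; rename K3' into K3. assert (K4' := J _ _ K4 ltac:(tauto)); clear K4; rename K4' into K4.
  assert (K5' := J _ _ K5 ltac:(tauto)); clear K5; rename K5' into K5. assert (K6' := J _ _ K6 ltac:(tauto)); clear K6; rename K6' into K6. assert (K7' := J _ _ K7 ltac:(tauto)); clear K7; rename K7' into K7. assert (K8' := J _ _ K8 ltac:(tauto)); clear K8; rename K8' into K8.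
  assert (K9' := J _ _ K9 ltac:(tauto)); clear K9; rename K9' into K9. assert (K10' := J _ _ K10 ltac:(tauto)); clear K10; rename K10' into K10.
  clear HB' J B1 B2 B3 B4 B5 B6 B7 B8 B9 B10.
  assert (M : forall x y X Y, Rabs x <= X -> Rabs y <= Y -> Rabs (x * y) <= X * Y).
  { intros x y X Y Hx Hy. rewrite Rabs_mult. apply Rmult_le_compat; trivial; apply Rabs_pos. }
  assert (S : forall x y X Y, Rabs x <= X -> Rabs y <= Y -> Rabs (x + y) <= X + Y).
  { intros x y X Y Hx Hy. apply Rle_trans with (1 := Rabs_triang _ _); lra. }
  assert (S' : forall x y X Y, Rabs x <= X -> Rabs y <= Y -> Rabs (x - y) <= X + Y).
  { intros x y X Y Hx Hy. apply S; trivial. now rewrite Rabs_Ropp. }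
  exists (2 * B * (B + 4 * B * B * B * L + 2 * B * B * B)). split.
  { repeat (apply Rmult_lt_0_compat; [lra|]).
    assert (0 <= 4 * B * B * B * L) by (repeat apply Rmult_le_pos; lra).
    assert (0 <= 2 * B * B * B) by (repeat apply Rmult_le_pos; lra). lra. }
  intros v v' g H H' H'' e Hv HPv e0 e1 DH DH' H0 H'0 Hg.
  assert (e_pos : 0 <= e) by (apply Rle_trans with (2 := e0); apply Rabs_pos).
  assert (in0 : 0 <= 0 <= L) by lra.
  (* W = p (v' f - v f') *)
  assert (WW : forall h h1 : R -> R, dOn (Icc 0 L) h h1 ->
     dOn (Icc 0 L) (fun y => p y * h1 y) (fun y => q y * h y) ->
     (forall x, 0 <= x <= L -> Rabs (h x) <= B) ->
     (forall x, 0 <= x <= L -> Rabs (p x * h1 x) <= B) ->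
     forall y, 0 <= y <= L -> Rabs (p y * v' y * h y - v y * (p y * h1 y)) <= 2*B*B*e + B*B* H' y).
  { intros h h1 Dh Ph Bh Bh1 y Hy.
    assert (DW := derivative_on_minus _ _ _ _ _ _ (derivative_on_mult _ _ _ _ _ _ HPv Dh)
        (derivative_on_mult _ _ _ _ _ _ Hv Ph)).
    assert (Z := derivative_on_bound 0 L _ _ (fun y => B*B* H' y) (fun y => B*B* H'' y) L0 DW).
    simpl in Z. rewrite H'0 in Z.
    assert (Z' : Rabs (p y * v' y * h y - v y * (p y * h1 y) - (p 0 * v' 0 * h 0 - v 0 * (p 0 * h1 0)))
        <= B * B * H' y - B * B * 0).
    { apply Z; trivial.
      - intros x Hx. apply is_derive_scal. apply DH'.
      - intros x Hx. match goal with |- Rabs ?t <= _ =>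
          replace t with ((w x * h x) * g x) by ring end.
        apply M; auto. }
    assert (Z0 : Rabs (p 0 * v' 0 * h 0 - v 0 * (p 0 * h1 0)) <= B * e * B + e * B).
    { apply S'; repeat apply M; auto. }
    replace (p y * v' y * h y - v y * (p y * h1 y)) with
      ((p y * v' y * h y - v y * (p y * h1 y) - (p 0 * v' 0 * h 0 - v 0 * (p 0 * h1 0))) +
      (p 0 * v' 0 * h 0 - v 0 * (p 0 * h1 0))) by ring.
    apply Rle_trans with (1 := S _ _ _ _ Z' Z0).
    assert (0 <= (B - 1) * (B * e)) by (apply Rmult_le_pos; [lra|apply Rmult_le_pos; lra]). lra. }
  assert (Wa := WW _ _ Ha Pa K3 K5). assert (Wb := WW _ _ Hb Pb K4 K6). clear WW.
  (* z = v / f *)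
  assert (ZZ : forall z z1 : R -> R, dOn (Icc 0 L) z z1 ->
     (forall x, 0 <= x <= L -> Rabs (z1 x) <= 2 * B * (2*B*B*e + B*B* H' x)) ->
     Rabs (z 0) <= e * B ->
     forall y, 0 <= y <= L -> Rabs (z y) <= e * B + 2*B*(2*B*B*e*y + B*B*H y)).
  { intros z z1 Dz Bz Z0 y Hy.
    assert (Z := derivative_on_bound 0 L z z1 (fun y => 2*B*(2*B*B*e*y + B*B*H y))
      (fun y => 2*B*(2*B*B*e + B*B*H' y)) L0 Dz).
    assert (Z' : Rabs (z y - z 0) <= 2*B*(2*B*B*e*y + B*B*H y) - 2*B*(2*B*B*e*0 + B*B*H 0)).
    { apply Z; trivial. intros x Hx. apply is_derive_scal.
      apply (is_derive_plus (K := R_AbsRing) (V := R_NormedModule)).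
      - auto_derive; trivial. ring.
      - apply is_derive_scal, DH. }
    rewrite H0 in Z'. replace (z y) with ((z y - z 0) + z 0) by ring.
    apply Rle_trans with (1 := S _ _ _ _ Z' Z0). lra. }
  intros y Hy.
  assert (Za : Rabs (v y * (fa y * / (fa y * fa y + fb y * fb y))) <= e * B + 2*B*(2*B*B*e*y + B*B*H y)).
  { refine (ZZ _ _ (derivative_on_mult _ _ _ _ _ _ Hv Hra) _ _ y Hy).
    - intros x Hx. match goal with |- Rabs ?t <= _ => replace t with
       (/ p x * (fa x * / (fa x * fa x + fb x * fb x) * (fa x * / (fa x * fa x + fb x * fb x))
                 - fb x * / (fa x * fa x + fb x * fb x) * (fb x * / (fa x * fa x + fb x * fb x)))
         * (p x * v' x * fa x - v x * (p x * ga x)) +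
        / p x * (2 * (fa x * / (fa x * fa x + fb x * fb x) * (fb x * / (fa x * fa x + fb x * fb x))))
         * (p x * v' x * fb x - v x * (p x * gb x)))
        by (field; auto) end.
      replace (2 * B * (2 * B * B * e + B * B * H' x)) with
       (B * (2 * B * B * e + B * B * H' x) + B * (2 * B * B * e + B * B * H' x)) by ring.
      apply S; apply M; auto.
    - apply M; auto. }
  assert (Zb : Rabs (v y * (fb y * / (fa y * fa y + fb y * fb y))) <= e * B + 2*B*(2*B*B*e*y + B*B*H y)).
  { refine (ZZ _ _ (derivative_on_mult _ _ _ _ _ _ Hv Hrb) _ _ y Hy).
    - intros x Hx. match goal with |- Rabs ?t <= _ => replace t with
       (/ p x * (2 * (fa x * / (fa x * fa x + fb x * fb x) * (fb x * / (fa x * fa x + fb x * fb x))))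
         * (p x * v' x * fa x - v x * (p x * ga x)) -
        / p x * (fa x * / (fa x * fa x + fb x * fb x) * (fa x * / (fa x * fa x + fb x * fb x))
                 - fb x * / (fa x * fa x + fb x * fb x) * (fb x * / (fa x * fa x + fb x * fb x)))
         * (p x * v' x * fb x - v x * (p x * gb x)))
        by (field; auto) end.
      replace (2 * B * (2 * B * B * e + B * B * H' x)) with
       (B * (2 * B * B * e + B * B * H' x) + B * (2 * B * B * e + B * B * H' x)) by ring.
      apply S'; apply M; auto.
    - apply M; auto. }
  set (X := e * B + 2*B*(2*B*B*e*y + B*B*H y)) in *.
  assert (Hv' : Rabs (v y) <= X * B + X * B).
  { replace (v y) with (v y * (fa y * / (fa y * fa y + fb y * fb y)) * fa y +
      v y * (fb y * / (fa y * fa y + fb y * fb y)) * fb y) by (field; auto).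
    apply S; apply M; auto. }
  apply Rle_trans with (1 := Hv').
  assert (Hpos : 0 <= H y).
  { assert (Z := derivative_on_bound 0 L (fun _ => 0) (fun _ => 0) H H' L0 (derivative_on_const 0 L 0)).
    assert (Z' := derivative_on_bound 0 L (fun _ => 0) (fun _ => 0) H' H'' L0 (derivative_on_const 0 L 0)).
    rewrite H0 in Z. rewrite H'0 in Z'.
    assert (Q : forall x, 0 <= x <= L -> 0 <= H' x).
    { intros x Hx. apply Rle_trans with (Rabs (0 - 0)); [apply Rabs_pos|].
      replace (H' x) with (H' x - 0) by ring. apply Z'; trivial.
      intros t Ht. rewrite Rabs_R0. apply Rle_trans with (2 := Hg t Ht). apply Rabs_pos. }
    apply Rle_trans with (Rabs (0 - 0)); [apply Rabs_pos|].
    replace (H y) with (H y - 0) by ring. apply Z; trivial.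
    intros t Ht. rewrite Rabs_R0. auto. }
  unfold X.
  assert (0 <= B * B * B * B) by (repeat apply Rmult_le_pos; lra).
  assert (0 <= B * B * B * B * e) by (repeat apply Rmult_le_pos; lra).
  assert (0 <= B * B * B * B * e * (L - y)) by (repeat apply Rmult_le_pos; lra).
  assert (0 <= B * B * B * B * (L * H y)) by (repeat apply Rmult_le_pos; lra).
  assert (0 <= B * B * H y) by (repeat apply Rmult_le_pos; lra).
  lra.
Qed.

(** * Averaging in time *)

Definition continuous2 (v : R -> R -> R) : Prop := forall y t, continuity_2d_pt v y t.

Lemma continuous2_lipschitz v (g h : R -> R) : continuous2 v ->
  (forall x y, Rabs (g x - g y) <= Rabs (x - y)) -> (forall x y, Rabs (h x - h y) <= Rabs (x - y)) ->
  continuous2 (fun y t => v (g y) (h t)).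
Proof.
  intros Hv Hg Hh y t eps. destruct (Hv (g y) (h t) eps) as [d Hd].
  exists d. intros y' t' H1 H2. apply Hd.
  - apply Rle_lt_trans with (1 := Hg _ _); trivial.
  - apply Rle_lt_trans with (1 := Hh _ _); trivial.
Qed.

Lemma continuous2_shift v t : continuous2 v -> continuous2 (fun y r => v y (t - r)).
Proof.
  intros Hv. apply (continuous2_lipschitz v (fun y => y) (fun r => t - r)); trivial.
  - intros; lra.
  - intros x y. replace (t - x - (t - y)) with (- (x - y)) by ring. rewrite Rabs_Ropp; lra.
Qed.

Lemma continuous2_clamp a b v : continuous2 v -> continuous2 (fun y t => v (clamp a b y) t).
Proof.
  intros Hv. apply (continuous2_lipschitz v (clamp a b) (fun t => t)); trivial.
  - intros; apply clamp_lipschitz.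
  - intros; lra.
Qed.

Lemma continuous2_slice v y t : continuous2 v -> continuous (v y) t.
Proof.
  intros Hv. apply continuity_pt_filterlim. intros eps Heps.
  destruct (Hv y t (mkposreal eps Heps)) as [d Hd].
  exists d; split; [apply cond_pos|]. intros s [_ Hs]. apply Hd; trivial.
  rewrite Rminus_diag, Rabs_R0. apply cond_pos.
Qed.

Lemma continuous2_slice_shift v y t r : continuous2 v -> continuous (fun r => v y (t - r)) r.
Proof. intros Hv. exact (continuous2_slice _ y r (continuous2_shift v t Hv)). Qed.

Lemma ex_RInt_slice v y a b : continuous2 v -> ex_RInt (v y) a b.
Proof.
  intros Hv. apply (ex_RInt_continuous (V := R_CompleteNormedModule)).
  intros; now apply continuous2_slice.
Qed.

Lemma ex_RInt_shift v y t a b : continuous2 v -> ex_RInt (fun r => v y (t - r)) a b.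
Proof. intros Hv. exact (ex_RInt_slice _ y a b (continuous2_shift v t Hv)). Qed.

(** The mean value theorem and the uniform continuity of f' control the
   difference quotients uniformly in the parameter s, also at the end points. *)
Lemma derivative_on_RInt L c d (f f' : R -> R -> R) :
  c <= d ->
  (forall s, c <= s <= d -> dOn (Icc 0 L) (fun y => f y s) (fun y => f' y s)) ->
  continuous2 (fun y s => f (clamp 0 L y) s) ->
  continuous2 (fun y s => f' (clamp 0 L y) s) ->
  dOn (Icc 0 L) (fun y => RInt (f y) c d) (fun y => RInt (f' y) c d).
Proof.
  intros cd Hd Hf Hf' y0 Hy0. apply is_derive_in_iff; trivial. intros eps Heps.
  assert (He : 0 < eps / (d - c + 1)) by (apply Rdiv_lt_0_compat; lra).
  destruct (uniform_continuity_2d (fun y s => f' (clamp 0 L y) s) 0 L c d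
     (fun x y _ _ => Hf' x y) (mkposreal _ He)) as [de Hde].
  exists de; split; [apply cond_pos|]. intros y Hy Hyd.
  assert (I : forall z, Icc 0 L z -> ex_RInt (f z) c d).
  { intros z Hz. apply (ex_RInt_ext (fun s => f (clamp 0 L z) s)).
    - intros; now rewrite clamp_id.
    - exact (ex_RInt_slice _ z c d Hf). }
  assert (I' : forall z, Icc 0 L z -> ex_RInt (f' z) c d).
  { intros z Hz. apply (ex_RInt_ext (fun s => f' (clamp 0 L z) s)).
    - intros; now rewrite clamp_id.
    - exact (ex_RInt_slice _ z c d Hf'). }
  change (Rabs ((RInt (f y) c d - RInt (f y0) c d) - (y - y0) * RInt (f' y0) c d) <= eps * Rabs (y - y0)).
  assert (J : ex_RInt (fun s => (f y s - f y0 s) - (y - y0) * f' y0 s) c d).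
  { apply (ex_RInt_minus (V := R_NormedModule)).
    - apply (ex_RInt_minus (V := R_NormedModule)); auto.
    - apply (ex_RInt_scal (V := R_NormedModule)); auto. }
  replace ((RInt (f y) c d - RInt (f y0) c d) - (y - y0) * RInt (f' y0) c d)
    with (RInt (fun s => (f y s - f y0 s) - (y - y0) * f' y0 s) c d).
  2:{ rewrite (RInt_minus (V := R_CompleteNormedModule) (fun s => f y s - f y0 s) (fun s => (y - y0) * f' y0 s)).
      - rewrite (RInt_minus (V := R_CompleteNormedModule) (f y) (f y0)) by auto.
        rewrite (RInt_scal (V := R_CompleteNormedModule) (f' y0)) by auto. reflexivity.
      - apply (ex_RInt_minus (V := R_NormedModule)); auto.
      - apply (ex_RInt_scal (V := R_NormedModule)); auto. }
  apply Rle_trans with ((d - c) * (eps / (d - c + 1) * Rabs (y - y0))).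
  - apply abs_RInt_le_const; trivial. intros s Hs.
    destruct (MVT_gen (affine_ext 0 L (fun y => f y s) (fun y => f' y s)) y0 y (fun y => f' y s))
      as [c0 [Hc0 E]].
    + intros x Hx. apply (affine_ext_derive 0 L (fun y => f y s) (fun y => f' y s)); [auto|].
      unfold Icc, Rmin, Rmax in *; destruct Rle_dec; lra.
    + intros x Hx. apply continuity_pt_filterlim. apply (derivative_on_continuous 0 L (fun y => f y s) (fun y => f' y s)); [auto|].
      unfold Icc, Rmin, Rmax in *; destruct Rle_dec; lra.
    + assert (Hc : Icc 0 L c0) by (unfold Icc, Rmin, Rmax in *; destruct Rle_dec; lra).
      rewrite !affine_ext_id in E by trivial. rewrite E.
      replace (f' c0 s * (y - y0) - (y - y0) * f' y0 s) with ((f' c0 s - f' y0 s) * (y - y0)) by ring.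
      rewrite Rabs_mult. apply Rmult_le_compat_r; [apply Rabs_pos|].
      specialize (Hde y0 s c0 s Hy0 Hs Hc Hs).
      rewrite !clamp_id in Hde by trivial. left. apply Hde.
      * apply Rle_lt_trans with (2 := Hyd). unfold Rmin, Rmax in Hc0; destruct Rle_dec;
        unfold Rabs; repeat destruct Rcase_abs; lra.
      * rewrite Rminus_diag, Rabs_R0. apply cond_pos.
  - rewrite <- Rmult_assoc. apply Rmult_le_compat_r; [apply Rabs_pos|].
    replace ((d - c) * (eps / (d - c + 1))) with (eps * ((d - c) / (d - c + 1))) by (field; lra).
    assert ((d - c) / (d - c + 1) <= 1).
    { apply Rmult_le_reg_r with (d - c + 1); [lra|]. unfold Rdiv. rewrite Rmult_assoc, Rinv_l by lra. lra. }
    assert (eps * ((d - c) / (d - c + 1)) <= eps * 1) by (apply Rmult_le_compat_l; lra). lra.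
Qed.

(** Only past times enter, so that a solution on [tau,T] is averaged to one on
   [tau+a,T], up to the final time. *)
Definition avg (a : R) (v : R -> R -> R) (y t : R) : R := / a * RInt (fun r => v y (t - r)) 0 a.

Definition diffq (a : R) (v : R -> R -> R) (y t : R) : R := / a * (v y t - v y (t - a)).

Lemma avg_close a v y t c eps : 0 < a -> continuous2 v ->
  (forall s, t - a <= s <= t -> Rabs (v y s - c) <= eps) -> Rabs (avg a v y t - c) <= eps.
Proof.
  intros Ha Hv Hc. unfold avg.
  replace (/ a * RInt (fun r => v y (t - r)) 0 a - c) with (/ a * RInt (fun r => v y (t - r) - c) 0 a).
  - rewrite Rabs_mult, (Rabs_pos_eq (/ a)) by (left; now apply Rinv_0_lt_compat).
    apply Rmult_le_reg_l with a; trivial. rewrite <- Rmult_assoc, Rinv_r, Rmult_1_l by lra.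
    replace a with (a - 0) at 2 by ring.
    apply abs_RInt_le_const; [lra| |].
    + apply (ex_RInt_minus (V := R_NormedModule)); [now apply ex_RInt_shift|apply ex_RInt_const].
    + intros r Hr. apply Hc. lra.
  - rewrite (RInt_minus (V := R_CompleteNormedModule) (fun r => v y (t - r)) (fun _ => c)).
    + rewrite RInt_const. unfold minus, plus, opp, scal; simpl; unfold mult; simpl. field. lra.
    + now apply ex_RInt_shift.
    + apply ex_RInt_const.
Qed.

Lemma avg_bound a v y t M : 0 < a -> continuous2 v ->
  (forall s, t - a <= s <= t -> Rabs (v y s) <= M) -> Rabs (avg a v y t) <= M.
Proof.
  intros Ha Hv Hc. replace (avg a v y t) with (avg a v y t - 0) by ring.
  apply avg_close; trivial. intros s Hs. rewrite Rminus_0_r. auto.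
Qed.

Lemma avg_minus a v u y t : continuous2 v -> continuous2 u ->
  avg a (fun y t => v y t - u y t) y t = avg a v y t - avg a u y t.
Proof.
  intros Hv Hu. unfold avg.
  rewrite (RInt_minus (V := R_CompleteNormedModule) (fun r => v y (t - r)) (fun r => u y (t - r)))
    by now apply ex_RInt_shift.
  unfold minus, plus, opp; simpl. ring.
Qed.

Lemma avg_continuous2 a v : 0 < a -> continuous2 v -> continuous2 (avg a v).
Proof.
  intros Ha Hv y t eps.
  destruct (uniform_continuity_2d v (y - 1) (y + 1) (t - a - 1) (t + 1) (fun x y _ _ => Hv x y)
     (mkposreal (eps / 2) ltac:(destruct eps; simpl; lra))) as [d Hd].
  exists (mkposreal (Rmin d 1) (Rmin_pos _ _ (cond_pos d) Rlt_0_1)). simpl. intros y' t' Hy Ht.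
  assert (Hy1 := Rlt_le_trans _ _ _ Hy (Rmin_r _ _)). assert (Ht1 := Rlt_le_trans _ _ _ Ht (Rmin_r _ _)).
  assert (Hyd := Rlt_le_trans _ _ _ Hy (Rmin_l _ _)). assert (Htd := Rlt_le_trans _ _ _ Ht (Rmin_l _ _)).
  apply Rabs_def2 in Hy1. apply Rabs_def2 in Ht1.
  set (u := fun (_ : R) (s : R) => v y' (s + (t' - t)) - v y s).
  assert (Hu : continuous2 u).
  { intros z s. apply continuity_2d_pt_minus.
    - apply (continuous2_lipschitz v (fun _ => y') (fun s => s + (t' - t))); trivial.
      + intros. rewrite Rminus_diag, Rabs_R0. apply Rabs_pos.
      + intros x x'. right. f_equal. ring.
    - apply (continuous2_lipschitz v (fun _ => y) (fun s => s)); trivial.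
      + intros. rewrite Rminus_diag, Rabs_R0. apply Rabs_pos.
      + intros x x'. lra. }
  replace (avg a v y' t' - avg a v y t) with (avg a u 0 t).
  - apply Rle_lt_trans with (eps / 2); [|destruct eps; simpl; lra].
    apply avg_bound; trivial. intros s Hs. unfold u. left.
    apply Rlt_le_trans with (2 := Rle_refl _). apply Hd; try lra.
    replace (s + (t' - t) - s) with (t' - t) by ring. trivial.
  - unfold avg. rewrite <- Rmult_minus_distr_l. f_equal.
    rewrite <- (RInt_minus (V := R_CompleteNormedModule)) by now apply ex_RInt_shift.
    apply RInt_ext. intros r _. unfold u, minus, plus, opp; simpl.
    replace (t - r + (t' - t)) with (t' - r) by ring. reflexivity.
Qed.

Lemma diffq_continuous2 a v : continuous2 v -> continuous2 (diffq a v).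
Proof.
  intros Hv y t. apply continuity_2d_pt_mult; [apply continuity_2d_pt_const|].
  apply continuity_2d_pt_minus; [apply Hv|].
  apply (continuous2_lipschitz v (fun y => y) (fun t => t - a)); trivial.
  - intros; lra.
  - intros x x'. right. f_equal. ring.
Qed.

Lemma avg_derive a v y t : continuous2 v -> is_derive (avg a v y) t (diffq a v y t).
Proof.
  intros Hv.
  set (P := fun t => RInt (v y) 0 t).
  assert (HP : forall t, is_derive P t (v y t)).
  { intros s. apply (is_derive_RInt (V := R_NormedModule) (v y) P 0 s).
    - apply filter_forall. intros x. apply (RInt_correct (V := R_CompleteNormedModule)).
      now apply ex_RInt_slice.
    - now apply continuous2_slice. }
  apply (is_derive_ext (fun t => / a * (P t - P (t - a)))).
  - intros s. unfold avg. f_equal. symmetry.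
    apply (is_RInt_unique (V := R_CompleteNormedModule)).
    replace (P s - P (s - a)) with (minus ((fun r => - P (s - r)) a) ((fun r => - P (s - r)) 0)).
    2:{ change (- P (s - a) + - - P (s - 0) = P s - P (s - a)). rewrite Rminus_0_r. ring. }
    apply (is_RInt_derive (V := R_CompleteNormedModule) (fun r => - P (s - r))).
    + intros r _. replace (v y (s - r)) with (- (-1 * v y (s - r))) by ring.
      apply (is_derive_opp (K := R_AbsRing) (V := R_NormedModule) (fun r => P (s - r))).
      apply (is_derive_comp (K := R_AbsRing) (V := R_NormedModule) P (fun r => s - r)); [apply HP|].
      assert (D1 : is_derive (fun r : R => s - r) r (-1)) by (auto_derive; [trivial|ring]). exact D1.
    + intros r _. now apply continuous2_slice_shift.
  - apply (is_derive_scal (fun t => P t - P (t - a))).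
    apply (is_derive_minus (K := R_AbsRing) (V := R_NormedModule) P (fun t => P (t - a))); [apply HP|].
    replace (v y (t - a)) with (scal 1 (v y (t - a))) by apply (scal_one (K := R_AbsRing) (V := R_NormedModule)).
    apply (is_derive_comp (K := R_AbsRing) (V := R_NormedModule) P (fun t => t - a)); [apply HP|].
    auto_derive; trivial.
Qed.

(** The equation C v = v_t on [0,L] x [tau,T].  The functions are continuous on
   the whole plane, which costs nothing since they can be extended by constants;
   the time derivative is used in integrated form, the only one that such an
   extension does not spoil at the ends of [tau,T]. *)
Record real_solution (L : R) (p q w : R -> R) (tau T : R) (v vy vt : R -> R -> R) : Prop := {
  rs_y : forall t, tau <= t <= T -> dOn (Icc 0 L) (fun y => v y t) (fun y => vy y t);
  rs_p : forall t, tau <= t <= T ->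
    dOn (Icc 0 L) (fun y => p y * vy y t) (fun y => w y * vt y t + q y * v y t);
  rs_t : forall y s t, 0 <= y <= L -> tau <= s -> s <= t -> t <= T ->
    is_RInt (vt y) s t (v y t - v y s);
  rs_cv : continuous2 v;
  rs_cvy : continuous2 vy;
  rs_cvt : continuous2 vt
}.

Lemma continuous2_of_derivative L h h' : 0 <= L -> dOn (Icc 0 L) h h' ->
  continuous2 (fun y _ => h (clamp 0 L y)).
Proof.
  intros HL Hh y t.
  apply continuity_2d_pt_ext with (fun y _ => affine_ext 0 L h h' (clamp 0 L y)).
  - intros x _. apply affine_ext_id. now apply clamp_in.
  - apply (continuity_1d_2d_pt_comp (affine_ext 0 L h h') (fun y _ => clamp 0 L y)).
    + apply continuity_pt_filterlim. apply derivative_on_continuous; trivial. now apply clamp_in.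
    + intros eps. exists eps. intros u _ Hu _.
      apply Rle_lt_trans with (1 := clamp_lipschitz 0 L y u). trivial.
Qed.

Lemma continuous2_of_continuous_on L h : 0 <= L -> continuous_on (U := R_UniformSpace) (Icc 0 L) h ->
  continuous2 (fun y _ => h (clamp 0 L y)).
Proof.
  intros HL Hh y t eps.
  assert (Z := Hh (clamp 0 L y) (clamp_in 0 L y HL) (fun z => Rabs (z - h (clamp 0 L y)) < eps)).
  destruct Z as [d Hd].
  - exists eps. intros z Hz. exact Hz.
  - exists d. intros u _ Hu _. apply (Hd (clamp 0 L u)).
    + apply Rle_lt_trans with (1 := clamp_lipschitz 0 L y u). trivial.
    + now apply clamp_in.
Qed.

(** The coefficients do not depend on t, and the average of v_t over [t-a,t] is
   the difference quotient of v: a time derivative has become bounded. *)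
Lemma avg_real_solution L p p' q w w' a tau T v vy vt : 0 < L -> 0 < a ->
  admissible_coefficients L p p' q w w' ->
  real_solution L p q w tau T v vy vt ->
  real_solution L p q w (tau + a) T (avg a v) (avg a vy) (diffq a v).
Proof.
  intros HL Ha Hc [Hy Hp Ht Cv Cvy Cvt].
  assert (L0 : 0 <= L) by lra.
  constructor.
  - intros t Htt. unfold avg. apply derivative_on_scal.
    apply (derivative_on_RInt L 0 a (fun y r => v y (t - r)) (fun y r => vy y (t - r))).
    + lra.
    + intros s Hs. apply Hy. lra.
    + apply (continuous2_clamp 0 L (fun y r => v y (t - r))). now apply continuous2_shift.
    + apply (continuous2_clamp 0 L (fun y r => vy y (t - r))). now apply continuous2_shift.
  - intros t Htt.
    assert (Z := derivative_on_RInt L 0 a (fun y r => p y * vy y (t - r))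
      (fun y r => w y * vt y (t - r) + q y * v y (t - r))).
    apply derivative_on_ext with (3 := derivative_on_scal 0 L (/ a) _ _ (Z ltac:(lra) ltac:(intros s Hs; apply Hp; lra)
       ltac:(intros y s; apply continuity_2d_pt_mult;
         [apply continuous2_of_derivative with (1 := L0) (2 := coeff_p_deriv _ _ _ _ _ _ Hc)
         |apply (continuous2_clamp 0 L (fun y r => vy y (t - r))); now apply continuous2_shift])
       ltac:(intros y s; apply continuity_2d_pt_plus; apply continuity_2d_pt_mult;
         [apply continuous2_of_derivative with (1 := L0) (2 := coeff_w_deriv _ _ _ _ _ _ Hc)
         |apply (continuous2_clamp 0 L (fun y r => vt y (t - r))); now apply continuous2_shift
         |apply continuous2_of_continuous_on; [exact L0|exact (coeff_q_cont _ _ _ _ _ _ Hc)]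
         |apply (continuous2_clamp 0 L (fun y r => v y (t - r))); now apply continuous2_shift]))).
    + intros y Hyy. simpl.
      rewrite (RInt_scal (V := R_CompleteNormedModule) (fun r => vy y (t - r))) by now apply ex_RInt_shift.
      unfold avg, scal; simpl; unfold mult; simpl. ring.
    + intros y Hyy. simpl.
      rewrite (RInt_plus (V := R_CompleteNormedModule) (fun r => w y * vt y (t - r)) (fun r => q y * v y (t - r)));
        [|apply (ex_RInt_scal (V := R_NormedModule) (fun r => vt y (t - r))); now apply ex_RInt_shift
         |apply (ex_RInt_scal (V := R_NormedModule) (fun r => v y (t - r))); now apply ex_RInt_shift].
      rewrite (RInt_scal (V := R_CompleteNormedModule) (fun r => vt y (t - r))) by now apply ex_RInt_shift.
      rewrite (RInt_scal (V := R_CompleteNormedModule) (fun r => v y (t - r))) by now apply ex_RInt_shift.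
      replace (RInt (fun r => vt y (t - r)) 0 a) with (v y t - v y (t - a)).
      { unfold avg, diffq, scal, plus; simpl; unfold mult; simpl. ring. }
      symmetry. apply (is_RInt_unique (V := R_CompleteNormedModule)).
      assert (J := Ht y (t - a) t Hyy ltac:(lra) ltac:(lra) ltac:(lra)).
      apply is_RInt_swap in J.
      assert (J2 := is_RInt_comp_lin (V := R_NormedModule) (vt y) (-1) t 0 a (opp (v y t - v y (t - a)))).
      replace (-1 * 0 + t) with t in J2 by ring. replace (-1 * a + t) with (t - a) in J2 by ring.
      specialize (J2 J).
      apply is_RInt_opp in J2. rewrite opp_opp in J2.
      apply is_RInt_ext with (2 := J2). intros x _.
      unfold opp, scal; simpl; unfold mult; simpl. replace (-1 * x + t) with (t - x) by ring. ring.
  - intros y s t Hyy Hs Hst HtT.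
    apply (is_RInt_derive (V := R_CompleteNormedModule) (avg a v y)).
    + intros x _. now apply avg_derive.
    + intros x _. apply continuous2_slice. now apply diffq_continuous2.
  - now apply avg_continuous2.
  - now apply avg_continuous2.
  - now apply diffq_continuous2.
Qed.

(** * Stability of averaged solutions *)

Fixpoint avgs (l : list R) (v : R -> R -> R) : R -> R -> R :=
  match l with nil => v | a :: l' => avg a (avgs l' v) end.

Definition lsum (l : list R) : R := fold_right Rplus 0 l.

Lemma avgs_continuous2 l v : List.Forall (fun a => 0 < a) l -> continuous2 v -> continuous2 (avgs l v).
Proof.
  intros Hl Hv. induction Hl as [|a l Ha Hl IH]; simpl; trivial. now apply avg_continuous2.
Qed.

Lemma lsum_pos l : List.Forall (fun a => 0 < a) l -> 0 <= lsum l.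
Proof. intros Hl. induction Hl; simpl; lra. Qed.

Lemma avgs_close l v y t c eps : List.Forall (fun a => 0 < a) l -> continuous2 v ->
  (forall s, t - lsum l <= s <= t -> Rabs (v y s - c) <= eps) -> Rabs (avgs l v y t - c) <= eps.
Proof.
  intros Hl Hv. revert t. induction Hl as [|a l Ha Hl IH]; simpl; intros t H.
  - apply H. lra.
  - apply avg_close; trivial; [now apply avgs_continuous2|].
    intros s Hs. apply IH. intros r Hr. apply H. lra.
Qed.

Lemma avgs_minus l v u y t : List.Forall (fun a => 0 < a) l -> continuous2 v -> continuous2 u ->
  avgs l (fun y t => v y t - u y t) y t = avgs l v y t - avgs l u y t.
Proof.
  intros Hl Hv Hu. revert t. induction Hl as [|a l Ha Hl IH]; simpl; intros t; trivial.
  rewrite <- avg_minus by now apply avgs_continuous2.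
  unfold avg. f_equal. apply RInt_ext. intros r _. apply IH.
Qed.

(** [facpoly m c] is the polynomial with coefficients c_j on y^(m+2j) / (m+2j)!,
   so that integrating twice is the shift of m by 2. *)
Fixpoint facpoly (m : nat) (c : list R) (y : R) : R :=
  match c with nil => 0 | c0 :: c' => c0 * (y ^ m / INR (fact m)) + facpoly (S (S m)) c' y end.

Lemma is_derive_facpow m y :
  is_derive (fun y => y ^ S m / INR (fact (S m))) y (y ^ m / INR (fact m)).
Proof.
  auto_derive; trivial.
  replace (fact m + m * fact m)%nat with (S m * fact m)%nat by ring.
  rewrite mult_INR. change (match m with 0%nat => 1 | S _ => INR m + 1 end) with (INR (S m)).
  simpl pred. assert (INR (S m) <> 0) by (apply not_0_INR; discriminate).
  assert (F := INR_fact_neq_0 m). field. split; trivial.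
Qed.

Lemma is_derive_facpoly m c y : is_derive (facpoly (S m) c) y (facpoly m c y).
Proof.
  revert m. induction c as [|c0 c IH]; intros m; simpl facpoly.
  - apply (is_derive_const (K := R_AbsRing) (V := R_NormedModule)).
  - apply (is_derive_plus (K := R_AbsRing) (V := R_NormedModule)
      (fun y => c0 * (y ^ S m / INR (fact (S m)))) (facpoly (S (S (S m))) c)).
    + apply (is_derive_scal (fun y => y ^ S m / INR (fact (S m)))). apply is_derive_facpow.
    + apply IH.
Qed.

Lemma facpoly_0 m c : facpoly (S m) c 0 = 0.
Proof.
  revert m; induction c as [|c0 c IH]; intros m; trivial. simpl facpoly. rewrite IH.
  simpl pow. unfold Rdiv. ring.
Qed.

Lemma facpoly_scal m k c y : facpoly m (map (Rmult k) c) y = k * facpoly m c y.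
Proof.
  revert m; induction c as [|c0 c IH]; intros m; simpl; [ring|]. rewrite IH. ring.
Qed.

Fixpoint majorant (K e M : R) (l : list R) : list R :=
  match l with
  | nil => M :: nil
  | a :: l' => K * e :: map (Rmult (K * (2 / a))) (majorant K e M l')
  end.

(** Each average trades one time derivative for a factor 2 / a, and each
   time derivative is, by the equation, two integrations in y away. *)
Lemma avgs_majorant (L T : R) (p p' q w w' : R -> R) (f f' : R -> C) :
  0 < L ->
  admissible_coefficients L p p' q w w' ->
  particular_solution L p q w f f' ->
  exists K, 0 < K /\
  forall l, List.Forall (fun a => 0 < a) l ->
  forall v vy vt tau e M, real_solution L p q w tau T v vy vt ->
    (forall t, tau <= t <= T -> Rabs (v 0 t) <= e /\ Rabs (vy 0 t) <= e) ->
    (forall y t, 0 <= y <= L -> tau <= t <= T -> Rabs (v y t) <= M) ->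
    (exists vt', real_solution L p q w (tau + lsum l) T (avgs l v) (avgs l vy) vt') /\
    (forall t, tau + lsum l <= t <= T -> Rabs (avgs l v 0 t) <= e /\ Rabs (avgs l vy 0 t) <= e) /\
    (forall y t, 0 <= y <= L -> tau + lsum l <= t <= T ->
       Rabs (avgs l v y t) <= facpoly 0 (majorant K e M l) y).
Proof.
  intros HL Hc Hf.
  destruct (cauchy_problem_bound L p p' q w w' f f' HL Hc Hf) as [K [HK Hb]].
  exists K; split; trivial.
  intros l Hl v vy vt tau e M Hv He HM.
  induction Hl as [|a l Ha Hl IH].
  - simpl. rewrite Rplus_0_r. split; [now exists vt|split; trivial].
    intros y t Hy Ht. replace (_ + 0) with M by field. auto.
  - destruct IH as [[vt' Hs] [He' HM']].
    assert (Cv := rs_cv _ _ _ _ _ _ _ _ _ Hs). assert (Cvy := rs_cvy _ _ _ _ _ _ _ _ _ Hs).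
    simpl avgs. simpl lsum.
    assert (Hs' := avg_real_solution L p p' q w w' a _ T _ _ _ HL Ha Hc Hs).
    assert (Hl0 := lsum_pos l Hl).
    replace (tau + lsum l + a) with (tau + (a + lsum l)) in Hs' by ring.
    assert (Hed : forall t, tau + (a + lsum l) <= t <= T ->
      Rabs (avg a (avgs l v) 0 t) <= e /\ Rabs (avg a (avgs l vy) 0 t) <= e).
    { intros t Ht. split; apply avg_bound; trivial; intros s Hst; apply He'; lra. }
    split; [now exists (diffq a (avgs l v))|split; trivial].
    intros y t Hy Ht.
    simpl majorant. simpl facpoly. rewrite facpoly_scal.
    set (c := majorant K e M l) in *.
    replace (K * e * (1 / 1) + K * (2 / a) * facpoly 2 c y)
      with (K * (e + 2 / a * facpoly 2 c y)) by (field; lra).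
    destruct (Hed t Ht) as [E0 E1].
    refine (Hb (fun y => avg a (avgs l v) y t) (fun y => avg a (avgs l vy) y t)
      (fun y => diffq a (avgs l v) y t) (fun y => 2 / a * facpoly 2 c y)
      (fun y => 2 / a * facpoly 1 c y) (fun y => 2 / a * facpoly 0 c y) e _ _ E0 E1 _ _ _ _ _ y Hy).
    + exact (rs_y _ _ _ _ _ _ _ _ _ Hs' t Ht).
    + exact (rs_p _ _ _ _ _ _ _ _ _ Hs' t Ht).
    + intros z. apply is_derive_scal. apply is_derive_facpoly.
    + intros z. apply is_derive_scal. apply is_derive_facpoly.
    + rewrite facpoly_0; ring.
    + rewrite facpoly_0; ring.
    + intros z Hz. unfold diffq. rewrite Rabs_mult, Rabs_pos_eq
        by (left; now apply Rinv_0_lt_compat).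
      assert (Q1 := HM' z t Hz ltac:(lra)). assert (Q2 := HM' z (t - a) Hz ltac:(lra)).
      assert (Q3 : Rabs (avgs l v z t - avgs l v z (t - a)) <= 2 * facpoly 0 c z).
      { apply Rle_trans with (1 := Rabs_triang _ _). rewrite Rabs_Ropp. lra. }
      apply Rle_trans with (/ a * (2 * facpoly 0 c z)).
      * apply Rmult_le_compat_l; trivial. left; now apply Rinv_0_lt_compat.
      * right. unfold Rdiv. ring.
Qed.

(** The steps: their sum stays below s while 1 / a_k = O(k^(3/2)) is beaten by
   the k^2 that two integrations gain. *)
Definition step (s : R) (k : nat) : R := s * (/ sqrt (INR (S k)) - / sqrt (INR (S (S k)))).

Definition steps (s : R) (k n : nat) : list R := map (step s) (seq k n).

Lemma sqrt_INR_pos k : 0 < sqrt (INR (S k)).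
Proof. apply sqrt_lt_R0. apply lt_0_INR. lia. Qed.

Lemma sqrt_INR_incr k : sqrt (INR (S k)) < sqrt (INR (S (S k))).
Proof. apply sqrt_lt_1_alt. split; [apply pos_INR|apply lt_INR; lia]. Qed.

Lemma step_pos s k : 0 < s -> 0 < step s k.
Proof.
  intros Hs. apply Rmult_lt_0_compat; trivial. apply Rlt_Rminus, Rinv_lt_contravar.
  - apply Rmult_lt_0_compat; apply sqrt_INR_pos.
  - apply sqrt_INR_incr.
Qed.

Lemma steps_pos s k n : 0 < s -> List.Forall (fun a => 0 < a) (steps s k n).
Proof.
  intros Hs. apply List.Forall_forall. intros x Hx. apply in_map_iff in Hx.
  destruct Hx as [i [<- _]]. now apply step_pos.
Qed.

Lemma steps_sum s k n : lsum (steps s k n) = s * (/ sqrt (INR (S k)) - / sqrt (INR (S (k + n)))).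
Proof.
  revert k; induction n as [|n IH]; intros k.
  - simpl lsum. rewrite Nat.add_0_r. ring.
  - change (step s k + lsum (steps s (S k) n) = s * (/ sqrt (INR (S k)) - / sqrt (INR (S (k + S n))))).
    rewrite IH. rewrite Nat.add_succ_r. unfold step. simpl Nat.add. ring.
Qed.

Lemma steps_sum_le s n : 0 < s -> lsum (steps s 0 n) <= s.
Proof.
  intros Hs. rewrite steps_sum. simpl (INR 1). rewrite sqrt_1, Rinv_1.
  assert (0 < / sqrt (INR (S (0 + n)))) by apply Rinv_0_lt_compat, sqrt_INR_pos. nra.
Qed.

Lemma inv_step s k : 0 < s -> / step s k <= 2 * (INR (S (S k)) * sqrt (INR (S (S k)))) / s.
Proof.
  intros Hs. unfold step.
  assert (P1 := sqrt_INR_pos k). assert (P2 := sqrt_INR_pos (S k)). assert (P3 := sqrt_INR_incr k).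
  assert (S1 : sqrt (INR (S k)) * sqrt (INR (S k)) = INR (S k)) by apply sqrt_sqrt, pos_INR.
  assert (S2 : sqrt (INR (S (S k))) * sqrt (INR (S (S k))) = INR (S (S k))) by apply sqrt_sqrt, pos_INR.
  assert (S3 : INR (S (S k)) = INR (S k) + 1) by apply S_INR.
  set (x := sqrt (INR (S k))) in *. set (z := sqrt (INR (S (S k)))) in *.
  assert (D : (z - x) * (z + x) = 1) by (rewrite <- S1, <- S2 in S3; lra).
  rewrite <- S2. clear S1 S2 S3.
  replace (/ (s * (/ x - / z))) with (x * z * (z + x) / s).
  - apply Rmult_le_compat_r; [left; now apply Rinv_0_lt_compat|].
    assert (x * z * (z + x) <= z * z * (z + z)).
    { apply Rmult_le_compat; try nra. }
    lra.
  - replace (/ x - / z) with ((z - x) / (x * z)) by (field; lra).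
    replace (z - x) with (/ (z + x))
      by (apply Rmult_eq_reg_r with (z + x); [rewrite D, Rinv_l|]; lra).
    field. repeat split; lra.
Qed.

(** Unfolded, this is K^k (2/a_0) ... (2/a_(k-1)) y^(2k) / (2k)!, where a_j is
   the j-th step. *)
Fixpoint gain (K s y : R) (k : nat) : R :=
  match k with
  | O => 1
  | S j => gain K s y j * (K * (2 / step s j)) * (y * y) / (INR (S (2 * j)) * INR (S (S (2 * j))))
  end.

Lemma gain_pos K s y k : 0 < K -> 0 < s -> 0 < y -> 0 < gain K s y k.
Proof.
  intros HK Hs Hy. induction k as [|k IH]; [simpl; lra|].
  cbn [gain]. assert (0 < step s k) by now apply step_pos.
  apply Rdiv_lt_0_compat.
  - repeat apply Rmult_lt_0_compat; trivial; try lra. now apply Rinv_0_lt_compat.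
  - apply Rmult_lt_0_compat; apply lt_0_INR; lia.
Qed.

Lemma gain_ratio K s L k : 0 < K -> 0 < s -> 0 < L ->
  Rabs (gain K s L (S k) / gain K s L k) <= 8 * K * L * L / s * / sqrt (INR (S (S k))).
Proof.
  intros HK Hs HL. assert (P := gain_pos K s L k HK Hs HL).
  assert (P' := gain_pos K s L (S k) HK Hs HL).
  rewrite Rabs_pos_eq by (left; now apply Rdiv_lt_0_compat).
  cbn [gain]. assert (Ps : 0 < step s k) by now apply step_pos.
  assert (I1 : 0 < INR (S (2 * k))) by (apply lt_0_INR; lia).
  assert (I2 : 0 < INR (S (S (2 * k)))) by (apply lt_0_INR; lia).
  assert (I0 : 0 < INR (S (S k))) by (apply lt_0_INR; lia).
  replace (gain K s L k * (K * (2 / step s k)) * (L * L) / (INR (S (2 * k)) * INR (S (S (2 * k)))) / gain K s L k)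
   with (2 * K * (L * L) * (/ step s k * / (INR (S (2 * k)) * INR (S (S (2 * k)))))) by (field; lra).
  replace (8 * K * L * L / s * / sqrt (INR (S (S k)))) with
    (2 * K * (L * L) * (4 / s * / sqrt (INR (S (S k))))) by (field; split; [apply Rgt_not_eq, sqrt_INR_pos|lra]).
  apply Rmult_le_compat_l; [repeat apply Rmult_le_pos; lra|].
  apply Rle_trans with (2 * (INR (S (S k)) * sqrt (INR (S (S k)))) / s * / (INR (S (2 * k)) * INR (S (S (2 * k))))).
  - apply Rmult_le_compat_r; [left; apply Rinv_0_lt_compat; now apply Rmult_lt_0_compat|]. now apply inv_step.
  - (* (k+2) / 2 <= 2k+1 and k+2 <= 2k+2 *)
    assert (Q : INR (S (S k)) * INR (S (S k)) <= 2 * (INR (S (2 * k)) * INR (S (S (2 * k))))).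
    { rewrite !S_INR, mult_INR. simpl (INR 2). assert (X := pos_INR k). nra. }
    assert (P2 := sqrt_INR_pos (S k)).
    assert (S2 : sqrt (INR (S (S k))) * sqrt (INR (S (S k))) = INR (S (S k))) by apply sqrt_sqrt, pos_INR.
    set (z := sqrt (INR (S (S k)))) in *. set (D := INR (S (2 * k)) * INR (S (S (2 * k)))) in *.
    assert (HD : 0 < D) by (now apply Rmult_lt_0_compat).
    apply Rmult_le_reg_l with (s * z * D); [repeat apply Rmult_lt_0_compat; trivial|].
    replace (s * z * D * (2 * (INR (S (S k)) * z) / s * / D)) with (2 * INR (S (S k)) * (z * z)) by (field; lra).
    replace (s * z * D * (4 / s * / z)) with (4 * D) by (field; lra).
    rewrite S2. lra.
Qed.

(** The ratio of consecutive gains is O(k^(3/2) / k^2). *)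
Lemma gain_summable K s L : 0 < K -> 0 < s -> 0 < L -> ex_series (gain K s L).
Proof.
  intros HK Hs HL.
  apply (ex_series_ext (fun k => Rabs (gain K s L k))).
  { intros k. apply Rabs_pos_eq. left. now apply gain_pos. }
  apply ex_series_DAlembert with 0; [lra| |].
  - intros k. apply Rgt_not_eq. now apply gain_pos.
  - apply (is_lim_seq_le_le (fun _ => 0) _ (fun k => 8 * K * L * L / s * / sqrt (INR (S (S k))))).
    + intros k; split; [apply Rabs_pos|now apply gain_ratio].
    + apply is_lim_seq_const.
    + replace (Finite 0) with (Rbar_mult (8 * K * L * L / s) 0) by (simpl; f_equal; ring).
      apply is_lim_seq_scal_l.
      replace (Finite 0) with (Rbar_inv p_infty) by reflexivity.
      apply is_lim_seq_inv; [|discriminate].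
      apply (is_lim_seq_incr_1 (fun k => sqrt (INR (S k)))), (is_lim_seq_incr_1 (fun k => sqrt (INR k))).
      apply filterlim_comp with (2 := filterlim_sqrt_p). apply is_lim_seq_INR.
Qed.

Lemma gain_series_pos K s L k : 0 < K -> 0 < s -> 0 < L ->
  0 <= Series (fun j => gain K s L (k + j)).
Proof.
  intros HK Hs HL.
  rewrite <- (Rmult_0_l (Series (fun j => gain K s L (k + j)))), <- Series_scal_l.
  apply Series_le.
  - intros j. assert (P := gain_pos K s L (k + j) HK Hs HL). lra.
  - apply (ex_series_incr_n (gain K s L)). now apply gain_summable.
Qed.

(** Multiplying the majorant that is left after k steps by the gain of these
   steps makes the estimate an induction on the number n of remaining steps. *)
Lemma facpoly_majorant_steps K e M s L n : 0 < K -> 0 < s -> 0 < L -> 0 <= e -> 0 <= M ->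
  forall k y, 0 <= y <= L ->
  gain K s L k * (INR (fact (2 * k)) * / L ^ (2 * k)) * facpoly (2 * k) (majorant K e M (steps s k n)) y
  <= K * e * (Series (fun j => gain K s L (k + j))) + M * gain K s L (k + n).
Proof.
  intros HK Hs HL He HM. 
  assert (F : forall k y, 0 <= y <= L -> 
     INR (fact (2 * k)) * / L ^ (2 * k) * (y ^ (2 * k) / INR (fact (2 * k))) <= 1).
  { intros k y Hy. assert (H := INR_fact_neq_0 (2 * k)). assert (HLk : 0 < L ^ (2 * k)) by now apply pow_lt.
    replace (_ * _) with (y ^ (2 * k) / L ^ (2 * k)) by (field; split; [trivial|lra]).
    apply Rmult_le_reg_r with (L ^ (2 * k)); trivial. unfold Rdiv. rewrite Rmult_assoc, Rinv_l by lra.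
    rewrite Rmult_1_r, Rmult_1_l. now apply pow_incr. }
  induction n as [|n IH]; intros k y Hy.
  - change (steps s k 0) with (@nil R). cbn [majorant facpoly]. rewrite Nat.add_0_r, Rplus_0_r.
    assert (G := gain_pos K s L k HK Hs HL).
    assert (SP := gain_series_pos K s L k HK Hs HL).
    assert (0 <= K * e * Series (fun j => gain K s L (k + j))) by (apply Rmult_le_pos; trivial; apply Rmult_le_pos; lra).
    specialize (F k y Hy).
    replace (gain K s L k * (INR (fact (2 * k)) * / L ^ (2 * k)) * (M * (y ^ (2 * k) / INR (fact (2 * k)))))
     with (M * gain K s L k * (INR (fact (2 * k)) * / L ^ (2 * k) * (y ^ (2 * k) / INR (fact (2 * k))))) by ring.
    assert (0 <= M * gain K s L k) by (apply Rmult_le_pos; lra).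
    apply Rle_trans with (M * gain K s L k * 1); [apply Rmult_le_compat_l; trivial|lra].
  - change (steps s k (S n)) with (step s k :: steps s (S k) n). cbn [majorant facpoly].
    rewrite facpoly_scal.
    assert (G := gain_pos K s L k HK Hs HL).
    rewrite (Series_incr_1 (fun j => gain K s L (k + j)))
      by (apply (ex_series_incr_n (gain K s L)); now apply gain_summable).
    rewrite Nat.add_0_r.
    rewrite (Series_ext (fun j => gain K s L (k + S j)) (fun j => gain K s L (S k + j)))
      by (intros j; f_equal; lia).
    replace (k + S n)%nat with (S k + n)%nat by lia.
    specialize (IH (S k) y Hy). replace (2 * S k)%nat with (S (S (2 * k))) in IH by lia.
    specialize (F k y Hy).
    set (P := facpoly (S (S (2 * k))) (majorant K e M (steps s (S k) n)) y) in *.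
    assert (Q : gain K s L (S k) * (INR (fact (S (S (2 * k)))) * / L ^ S (S (2 * k)))
       = gain K s L k * (INR (fact (2 * k)) * / L ^ (2 * k)) * (K * (2 / step s k))).
    { cbn [gain]. rewrite (fact_simpl (S (2 * k))), (fact_simpl (2 * k)), !mult_INR.
      change (L ^ S (S (2 * k))) with (L * (L * L ^ (2 * k))).
      assert (0 < L ^ (2 * k)) by now apply pow_lt.
      assert (0 < step s k) by now apply step_pos.
      assert (I1 : 0 < INR (S (2 * k))) by (apply lt_0_INR; lia).
      assert (I2 : 0 < INR (S (S (2 * k)))) by (apply lt_0_INR; lia).
      field. repeat split; lra. }
    rewrite Q in IH.
    assert (0 <= K * e * gain K s L k) by (repeat apply Rmult_le_pos; lra).
    assert (K * e * gain K s L k * (INR (fact (2 * k)) * / L ^ (2 * k) * (y ^ (2 * k) / INR (fact (2 * k))))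
      <= K * e * gain K s L k * 1) by (apply Rmult_le_compat_l; trivial).
    lra.
Qed.

Lemma continuous2_bounded v L c d : 0 <= L -> continuous2 v ->
  exists M, forall y t, 0 <= y <= L -> c <= t <= d -> Rabs (v y t) <= M.
Proof.
  intros HL Cv.
  destruct (Rle_lt_dec c d) as [cd|cd]; [|exists 0; intros; lra].
  destruct (uniform_continuity_2d v 0 L c d (fun x y _ _ => Cv x y) (mkposreal 1 Rlt_0_1)) as [h Hh].
  simpl in Hh. assert (h0 := cond_pos h).
  destruct (INR_archimed h (L + (d - c)) h0) as [n Hn].
  assert (Pn : 0 < INR n).
  { destruct n; [simpl in Hn; lra|]. apply lt_0_INR. lia. }
  exists (Rabs (v 0 c) + INR n). intros y t Hy Ht.
  (* walk from (0,c) to (y,t) in n steps on which v varies by less than 1 *)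
  assert (RI : 0 < / INR n) by now apply Rinv_0_lt_compat.
  assert (Hs : forall x, 0 <= x <= L + (d - c) -> Rabs (x * / INR n) < h).
  { intros x Hx. rewrite Rabs_pos_eq by (apply Rmult_le_pos; lra).
    apply Rmult_lt_reg_r with (INR n); trivial. rewrite Rmult_assoc, Rinv_l; lra. }
  assert (W : forall j, (j <= n)%nat ->
    Rabs (v (y * (INR j / INR n)) (c + (t - c) * (INR j / INR n))) <= Rabs (v 0 c) + INR j).
  { assert (RJ : forall j, (j <= n)%nat -> 0 <= INR j / INR n <= 1).
    { intros j Hj. split; [apply Rle_div_r; trivial; assert (Z := pos_INR j); lra|].
      apply Rle_div_l; trivial. rewrite Rmult_1_l. now apply le_INR. }
    induction j as [|j IHj]; intros Hj.
    - simpl. replace (0 / INR n) with 0 by (field; lra). rewrite !Rmult_0_r, !Rplus_0_r. lra.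
    - specialize (IHj ltac:(lia)). assert (R1 := RJ j ltac:(lia)). assert (R2 := RJ (S j) Hj).
      assert (RS : INR (S j) / INR n = INR j / INR n + / INR n) by (rewrite S_INR; field; lra).
      assert (Z : Rabs (v (y * (INR (S j) / INR n)) (c + (t - c) * (INR (S j) / INR n))
        - v (y * (INR j / INR n)) (c + (t - c) * (INR j / INR n))) < 1).
      { apply Hh; try nra.
        - rewrite RS. replace (_ - _) with (y * / INR n) by ring. apply Hs. lra.
        - rewrite RS. replace (_ - _) with ((t - c) * / INR n) by ring. apply Hs. lra. }
      rewrite (S_INR j) in *.
      match type of Z with Rabs (?a - ?b) < 1 =>
        assert (Q := Rabs_triang (a - b) b); replace (a - b + b) with a in Q by ring end.
      lra. }
  specialize (W n (le_n n)). replace (INR n / INR n) with 1 in W by (field; lra).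
  rewrite !Rmult_1_r in W. replace (c + (t - c)) with t in W by ring. exact W.
Qed.

(** The size of v only enters the majorant through its last term, a multiple of
   the n-th gain: it decides how many averages are needed, but not the bound. *)
Lemma avgs_stability (L T s : R) (p p' q w w' : R -> R) (f f' : R -> C) :
  0 < L -> 0 < s ->
  admissible_coefficients L p p' q w w' ->
  particular_solution L p q w f f' ->
  exists K, 0 < K /\
  forall v vy vt tau e, real_solution L p q w tau T v vy vt ->
    0 < e ->
    (forall t, tau <= t <= T -> Rabs (v 0 t) <= e /\ Rabs (vy 0 t) <= e) ->
    exists N, forall n, (N <= n)%nat ->
    forall y t, 0 <= y <= L -> tau + s <= t <= T -> Rabs (avgs (steps s 0 n) v y t) <= K * e.
Proof.
  intros HL Hs Hc Hf.
  destruct (avgs_majorant L T p p' q w w' f f' HL Hc Hf) as [K [HK Hm]].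
  assert (Hser := gain_summable K s L HK Hs HL).
  assert (SP : 0 <= Series (gain K s L)) by exact (gain_series_pos K s L 0 HK Hs HL).
  exists (K * Series (gain K s L) + 1). split.
  { assert (0 <= K * Series (gain K s L)) by (apply Rmult_le_pos; lra). lra. }
  intros v vy vt tau e Hv He Hd.
  assert (exists M, 0 < M /\ forall y t, 0 <= y <= L -> tau <= t <= T -> Rabs (v y t) <= M) as [M [M0 HM]].
  { destruct (continuous2_bounded v L tau T) as [M HM]; [lra|exact (rs_cv _ _ _ _ _ _ _ _ _ Hv)|].
    exists (1 + Rabs M). split; [assert (Z := Rabs_pos M); lra|].
    intros y t Hy Ht. apply Rle_trans with (1 := HM y t Hy Ht). assert (Z := Rle_abs M). lra. }
  assert (Hlim := ex_series_lim_0 _ Hser).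
  apply is_lim_seq_spec in Hlim.
  assert (HeM : 0 < e / M) by now apply Rdiv_lt_0_compat.
  destruct (Hlim (mkposreal _ HeM)) as [N HN].
  exists N. intros n Hn y t Hy Ht.
  destruct (Hm (steps s 0 n) (steps_pos s 0 n Hs) v vy vt tau e M Hv Hd HM) as [_ [_ B]].
  assert (Hle := steps_sum_le s n Hs).
  apply Rle_trans with (1 := B y t Hy ltac:(lra)).
  assert (Z := facpoly_majorant_steps K e M s L n HK Hs HL ltac:(lra) ltac:(lra) 0 y Hy).
  simpl Nat.mul in Z. simpl (gain _ _ _ 0) in Z. simpl (INR (fact 0)) in Z. simpl (L ^ 0) in Z.
  rewrite Rinv_1, !Rmult_1_l in Z. simpl Nat.add in Z.
  apply Rle_trans with (1 := Z).
  specialize (HN n Hn). simpl in HN. rewrite Rminus_0_r in HN.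
  rewrite Rabs_pos_eq in HN by (left; now apply gain_pos).
  apply Rlt_div_r in HN; trivial.
  change (fun j => gain K s L j) with (gain K s L).
  lra.
Qed.

(** * Exponential sums and Blaschke factors *)

Lemma C_ext (a b : C) : Re a = Re b -> Im a = Im b -> a = b.
Proof. destruct a, b; simpl; intros; now subst. Qed.

Lemma Cexp_plus a b : Cexp (a + b) = (Cexp a * Cexp b)%C.
Proof.
  unfold Cexp. destruct a as [a1 a2], b as [b1 b2]. apply C_ext; simpl;
  rewrite exp_plus, ?cos_plus, ?sin_plus; ring.
Qed.

Lemma Cexp_0 : Cexp 0 = 1%C.
Proof. unfold Cexp; simpl. rewrite exp_0, cos_0, sin_0. apply C_ext; simpl; ring. Qed.

Lemma Cmod_Cexp z : Cmod (Cexp z) = exp (Re z).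
Proof.
  unfold Cmod, Cexp. simpl.
  replace (_ + _) with (exp (Re z) * exp (Re z) * (Rsqr (sin (Im z)) + Rsqr (cos (Im z))))
    by (unfold Rsqr; ring).
  rewrite sin2_cos2, Rmult_1_r. apply sqrt_square. left. apply exp_pos.
Qed.

Definition is_Cderive (f : R -> C) (x : R) (l : C) : Prop :=
  is_derive (fun y => Re (f y)) x (Re l) /\ is_derive (fun y => Im (f y)) x (Im l).

Lemma is_Cderive_plus f g x l m : is_Cderive f x l -> is_Cderive g x m ->
  is_Cderive (fun y => (f y + g y)%C) x (l + m)%C.
Proof.
  intros [H1 H2] [H3 H4]; split.
  - apply (is_derive_plus (K := R_AbsRing) (V := R_NormedModule) (fun y => Re (f y)) (fun y => Re (g y))); trivial.
  - apply (is_derive_plus (K := R_AbsRing) (V := R_NormedModule) (fun y => Im (f y)) (fun y => Im (g y))); trivial.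
Qed.

Lemma is_Cderive_scal c f x l : is_Cderive f x l -> is_Cderive (fun y => (c * f y)%C) x (c * l)%C.
Proof.
  intros [H1 H2]; split.
  - apply (is_derive_minus (K := R_AbsRing) (V := R_NormedModule) (fun y => Re c * Re (f y)) (fun y => Im c * Im (f y)));
      now apply is_derive_scal.
  - apply (is_derive_plus (K := R_AbsRing) (V := R_NormedModule) (fun y => Re c * Im (f y)) (fun y => Im c * Re (f y)));
      now apply is_derive_scal.
Qed.

Lemma is_Cderive_Cexp k x : is_Cderive (fun y => Cexp (k * RtoC y)) x (k * Cexp (k * RtoC x))%C.
Proof.
  destruct k as [a b].
  unfold is_Cderive, Cexp, Cmult, RtoC, Re, Im; simpl. split; auto_derive; trivial; unfold Rminus; ring.
Qed.

Lemma is_Cderive_const c x : is_Cderive (fun _ => c) x 0%C.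
Proof. split; apply (is_derive_const (K := R_AbsRing) (V := R_NormedModule)). Qed.

Definition expn (nu : C) (s : R) : C := Cexp (- nu * RtoC s).

Lemma expn_derive nu s : is_Cderive (expn nu) s (- nu * expn nu s)%C.
Proof. apply is_Cderive_Cexp. Qed.

Lemma expn_0 nu : expn nu 0 = 1%C.
Proof. unfold expn. rewrite Cmult_0_r. apply Cexp_0. Qed.

Inductive expsum (P : C -> Prop) : (R -> C) -> Prop :=
| expsum_nil : expsum P (fun _ => RtoC 0)
| expsum_cons : forall nu c h, P nu -> expsum P h -> expsum P (fun s => c * expn nu s + h s)%C.

Lemma expsum_eq P h h' : (forall s, h s = h' s) -> expsum P h -> expsum P h'.
Proof. intros E. now rewrite (functional_extensionality h h' E). Qed.

Lemma expsum_mono (P P' : C -> Prop) h : (forall nu, P nu -> P' nu) -> expsum P h -> expsum P' h.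
Proof. intros H. induction 1; constructor; auto. Qed.

Lemma expsum_plus P h g : expsum P h -> expsum P g -> expsum P (fun s => h s + g s)%C.
Proof.
  intros H Hg. induction H as [|nu c h Hn Hh IH].
  - apply expsum_eq with g; trivial. intros; ring.
  - apply expsum_eq with (fun s => c * expn nu s + (h s + g s))%C; [intros; ring|]. now constructor.
Qed.

Lemma expsum_scal P c h : expsum P h -> expsum P (fun s => c * h s)%C.
Proof.
  intros H. induction H as [|nu c' h Hn Hh IH].
  - apply expsum_eq with (fun _ => RtoC 0); [intros; ring|constructor].
  - apply expsum_eq with (fun s => c * c' * expn nu s + (c * h s))%C; [intros; ring|]. now constructor.
Qed.

Lemma expsum_single (P : C -> Prop) nu : P nu -> expsum P (expn nu).
Proof.
  intros H. apply expsum_eq with (fun s => 1 * expn nu s + 0)%C; [intros; ring|].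
  now repeat constructor.
Qed.

Lemma expsum_derive P h : expsum P h -> forall s, exists l, is_Cderive h s l.
Proof.
  induction 1 as [|nu c h Hn Hh IH]; intros s.
  - exists (RtoC 0). apply is_Cderive_const.
  - destruct (IH s) as [l Hl]. exists (c * (- nu * expn nu s) + l)%C.
    apply is_Cderive_plus; trivial. apply is_Cderive_scal, expn_derive.
Qed.

(** Since mu is not among the exponents of R, the equation Y' = R - mu Y has no
   resonance and Y is again an exponential sum. *)
Lemma expsum_resolvent P mu R0 : (forall nu, P nu -> nu <> mu) -> expsum P R0 ->
  exists Y, expsum (fun nu => P nu \/ nu = mu) Y /\ Y 0 = RtoC 0 /\
    forall s, is_Cderive Y s (R0 s - mu * Y s)%C.
Proof.
  intros HP. induction 1 as [|nu c h Hn Hh [Y [HY [Y0 DY]]]].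
  - exists (fun _ => RtoC 0). split; [constructor|split; trivial].
    intros s. replace (0 - mu * 0)%C with (RtoC 0) by ring. apply is_Cderive_const.
  - assert (N : (mu - nu)%C <> 0).
    { intros E. apply (HP nu Hn). rewrite <- (Cplus_0_l nu), <- E. ring. }
    exists (fun s => c / (mu - nu) * expn nu s + (- (c / (mu - nu)) * expn mu s + Y s))%C.
    split; [|split].
    + constructor; [now left|]. constructor; [now right|trivial].
    + rewrite !expn_0, Y0. ring.
    + intros s. match goal with |- is_Cderive _ _ ?t => replace t with
       (c / (mu - nu) * (- nu * expn nu s) + (- (c / (mu - nu)) * (- mu * expn mu s) + (h s - mu * Y s)))%C
       by (field; trivial) end.
      apply is_Cderive_plus; [apply is_Cderive_scal, expn_derive|].
      apply is_Cderive_plus; [apply is_Cderive_scal, expn_derive|apply DY].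
Qed.

Definition sqnorm (z : C) : R := Re z * Re z + Im z * Im z.

Lemma sqnorm_Cmod z : sqnorm z = Cmod z * Cmod z.
Proof.
  unfold Cmod. rewrite sqrt_sqrt.
  - unfold sqnorm, Re, Im; simpl; ring.
  - assert (H := Rle_0_sqr (fst z)). assert (H' := Rle_0_sqr (snd z)). unfold Rsqr in *; simpl; lra.
Qed.

Definition energy (f : R -> C) (S : R) : R := RInt (fun s => sqnorm (f s)) 0 S.

Lemma sqnorm_continuous f s l : is_Cderive f s l -> continuous (fun s => sqnorm (f s)) s.
Proof.
  intros [H1 H2]. unfold sqnorm.
  assert (C1 : continuous (fun s => Re (f s)) s)
    by (apply (ex_derive_continuous (K := R_AbsRing) (V := R_NormedModule)); now exists (Re l)).
  assert (C2 : continuous (fun s => Im (f s)) s)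
    by (apply (ex_derive_continuous (K := R_AbsRing) (V := R_NormedModule)); now exists (Im l)).
  apply (continuous_plus (V := R_NormedModule)); apply (continuous_mult (K := R_AbsRing)); trivial.
Qed.

Lemma energy_ex f S : (forall s, exists l, is_Cderive f s l) -> ex_RInt (fun s => sqnorm (f s)) 0 S.
Proof.
  intros H. apply (ex_RInt_continuous (V := R_CompleteNormedModule)). intros s _.
  destruct (H s) as [l Hl]. now apply sqnorm_continuous with l.
Qed.

Lemma energy_pos f S : 0 <= S -> (forall s, exists l, is_Cderive f s l) -> 0 <= energy f S.
Proof.
  intros HS H. apply RInt_ge_0; trivial; [now apply energy_ex|].
  intros s _. rewrite sqnorm_Cmod. apply Rle_0_sqr.
Qed.

(** The map R |-> R - 2 Re(mu) Y with Y' = R - mu Y is, on the Laplace side, the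
   multiplication by the Blaschke factor (z - conj mu) / (z + mu); this is the
   corresponding energy identity. *)
Lemma blaschke_energy mu R0 Y S : 0 <= S -> Y 0 = RtoC 0 ->
  (forall s, exists l, is_Cderive R0 s l) ->
  (forall s, is_Cderive Y s (R0 s - mu * Y s)%C) ->
  energy (fun s => R0 s + - RtoC (2 * Re mu) * Y s)%C S + 2 * Re mu * sqnorm (Y S) = energy R0 S.
Proof.
  intros HS Y0 DR DY.
  assert (D1 : forall s, exists l, is_Cderive (fun s => R0 s + - RtoC (2 * Re mu) * Y s)%C s l).
  { intros s. destruct (DR s) as [l Hl]. eexists. apply is_Cderive_plus; [exact Hl|].
    apply is_Cderive_scal. apply DY. }
  assert (I : is_RInt (fun s => sqnorm (R0 s) - sqnorm (R0 s + - RtoC (2 * Re mu) * Y s)%C) 0 S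
     (minus ((fun s => 2 * Re mu * sqnorm (Y s)) S) ((fun s => 2 * Re mu * sqnorm (Y s)) 0))).
  { apply (is_RInt_derive (V := R_CompleteNormedModule) (fun s => 2 * Re mu * sqnorm (Y s))).
    - intros s _. destruct (DY s) as [E1 E2].
      apply is_derive_ext with (fun s => 2 * Re mu * (Re (Y s) * Re (Y s) + Im (Y s) * Im (Y s))); [reflexivity|].
      replace (sqnorm (R0 s) - _) with (2 * Re mu *
        ((Re (R0 s - mu * Y s) * Re (Y s) + Re (Y s) * Re (R0 s - mu * Y s)) +
         (Im (R0 s - mu * Y s) * Im (Y s) + Im (Y s) * Im (R0 s - mu * Y s)))).
      + apply is_derive_scal.
        apply (is_derive_plus (K := R_AbsRing) (V := R_NormedModule)
          (fun s => Re (Y s) * Re (Y s)) (fun s => Im (Y s) * Im (Y s))); now apply Derive.is_derive_mult.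
      + unfold sqnorm. destruct (R0 s) as [r1 r2], (Y s) as [y1 y2], mu as [m1 m2]. simpl. ring.
    - intros s _. destruct (DR s) as [l Hl]. destruct (D1 s) as [l1 Hl1].
      apply (continuous_minus (V := R_NormedModule)).
      + now apply sqnorm_continuous with l.
      + now apply sqnorm_continuous with l1. }
  apply (is_RInt_unique (V := R_CompleteNormedModule)) in I.
  rewrite (RInt_minus (V := R_CompleteNormedModule) (fun s => sqnorm (R0 s))
    (fun s => sqnorm (R0 s + - RtoC (2 * Re mu) * Y s)%C)) in I by now apply energy_ex.
  unfold minus, plus, opp in I; simpl in I. unfold energy. rewrite Y0 in I.
  unfold sqnorm at 4 in I. simpl in I. lra.
Qed.

(** The modulus at z = - q of the Blaschke factor (z - conj mu) / (z + mu): the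
   factor by which one step multiplies the coefficient of e^(-q s). *)
Definition bfactor (q : R) (mu : C) : R := Cmod (RtoC q + mu) / Cmod (mu - RtoC q).

Definition bprod (q : R) (l : list C) : R := fold_right (fun mu acc => bfactor q mu * acc) 1 l.

Lemma Cminus_neq (a b : C) : a <> b -> (a - b)%C <> 0.
Proof. intros N E. apply N. rewrite <- (Cplus_0_l b), <- E. ring. Qed.

Lemma blaschke_coefficient q mu : mu <> RtoC q ->
  Cmod (1 + - RtoC (2 * Re mu) * / (mu - RtoC q))%C = bfactor q mu.
Proof.
  intros N. apply Cminus_neq in N. unfold bfactor. rewrite <- Cmod_div by trivial.
  rewrite <- (Cmod_conj (_ / _)%C), Cmod_conj.
  assert (E : (1 + - RtoC (2 * Re mu) * / (mu - RtoC q))%C = (- Cconj (RtoC q + mu) / (mu - RtoC q))%C).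
  { field_simplify_eq; trivial. apply C_ext; destruct mu as [m1 m2]; simpl; ring. }
  rewrite E, !Cmod_div, Cmod_opp, Cmod_conj by trivial. reflexivity.
Qed.

(** One Blaschke step per element of l: the energy does not grow while the
   coefficient c of e^(-q s) grows to the product of the factors, so that
   division by c leaves a small distance from e^(-q s) to the other exponentials. *)
Lemma blaschke_iterate q l : 0 < q -> NoDup l ->
  (forall mu, In mu l -> 0 < Re mu /\ mu <> RtoC q) ->
  exists c h, expsum (fun nu => In nu l) h /\ Cmod c = bprod q l /\
    forall S, 0 <= S -> energy (fun s => c * expn (RtoC q) s + h s)%C S <= energy (expn (RtoC q)) S.
Proof.
  intros Hq Hl. induction Hl as [|mu l Nin Hl IH]; intros Hm.
  - exists (RtoC 1), (fun _ => RtoC 0). split; [constructor|split].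
    + simpl. apply Cmod_1.
    + intros S _. right. f_equal. apply functional_extensionality. intros s. ring.
  - destruct IH as [c [h [Hh [Ec HE]]]]. { intros nu Hn. apply Hm. now right. }
    destruct (Hm mu (or_introl eq_refl)) as [Rm Nq].
    set (P := fun nu => nu = RtoC q \/ In nu l).
    assert (HR : expsum P (fun s => c * expn (RtoC q) s + h s)%C).
    { constructor; [now left|]. apply expsum_mono with (2 := Hh). now right. }
    destruct (expsum_resolvent (fun nu => In nu l) mu h) as [Y [HY [Y0 DY]]]; trivial.
    { intros nu Hn E. now subst. }
    set (k := (c / (mu - RtoC q))%C).
    assert (Nq' := Cminus_neq _ _ Nq).
    set (Z := fun s => (k * expn (RtoC q) s + (- k * expn mu s + Y s))%C).
    assert (DZ : forall s, is_Cderive Z s ((c * expn (RtoC q) s + h s) - mu * Z s)%C).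
    { intros s. unfold Z. match goal with |- is_Cderive _ _ ?t => replace t with
       (k * (- RtoC q * expn (RtoC q) s) + (- k * (- mu * expn mu s) + (h s - mu * Y s)))%C
       by (unfold k; field; trivial) end.
      apply is_Cderive_plus; [apply is_Cderive_scal, expn_derive|].
      apply is_Cderive_plus; [apply is_Cderive_scal, expn_derive|apply DY]. }
    assert (Z0 : Z 0 = RtoC 0). { unfold Z. rewrite !expn_0, Y0. ring. }
    exists (c * (1 + - RtoC (2 * Re mu) * / (mu - RtoC q)))%C,
      (fun s => h s + - RtoC (2 * Re mu) * (- k * expn mu s + Y s))%C.
    split; [|split].
    + apply expsum_plus.
      * apply expsum_mono with (2 := Hh). now right.
      * apply expsum_scal. constructor; [now left|].
        apply expsum_mono with (2 := HY). intros nu [Hn|Hn]; [now right|left; now symmetry].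
    + rewrite Cmod_mult, Ec, blaschke_coefficient by trivial. simpl. ring.
    + intros S HS. assert (B := blaschke_energy mu (fun s => c * expn (RtoC q) s + h s)%C Z S HS Z0
        (expsum_derive _ _ HR) DZ).
      apply Rle_trans with (2 := HE S HS).
      replace (fun s => c * (1 + - RtoC (2 * Re mu) * / (mu - RtoC q)) * expn (RtoC q) s +
         (h s + - RtoC (2 * Re mu) * (- k * expn mu s + Y s)))%C
       with (fun s => (c * expn (RtoC q) s + h s) + - RtoC (2 * Re mu) * Z s)%C.
      * assert (0 <= 2 * Re mu * sqnorm (Z S)).
        { apply Rmult_le_pos; [lra|]. rewrite sqnorm_Cmod. apply Rle_0_sqr. }
        lra.
      * apply functional_extensionality. intros s. unfold Z, k. field. trivial.
Qed.

Lemma bfactor_pos q mu : 0 < q -> 0 < Re mu -> mu <> RtoC q -> 0 < bfactor q mu.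
Proof.
  intros Hq Hm N. apply Rdiv_lt_0_compat; apply Cmod_gt_0.
  - intros E. apply (f_equal Re) in E. simpl in E. unfold Re in *. lra.
  - now apply Cminus_neq.
Qed.

Lemma bprod_pos q l : 0 < q -> (forall mu, In mu l -> 0 < Re mu /\ mu <> RtoC q) -> 0 < bprod q l.
Proof.
  intros Hq. induction l as [|mu l IH]; intros H; simpl; [lra|].
  apply Rmult_lt_0_compat.
  - apply bfactor_pos; trivial; now apply H; left.
  - apply IH. intros nu Hn. apply H. now right.
Qed.

(** The last step gives a bound in the maximum norm, since
   2 Re(a) |Y(S)|^2 is at most the energy. *)
Lemma muntz_distance q a l S0 : 0 < q -> 0 < Re a -> a <> RtoC q -> ~ In a l -> 0 <= S0 -> NoDup l ->
  (forall mu, In mu l -> 0 < Re mu /\ mu <> RtoC q) ->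
  exists h, expsum (fun nu => nu = a \/ In nu l) h /\
    forall s, 0 <= s <= S0 ->
      Cmod (expn (RtoC q) s - h s)%C <= sqrt (S0 / (2 * Re a)) * Cmod (a - RtoC q)%C / bprod q l.
Proof.
  intros Hq Ha Nq Nin HS Hl Hm.
  destruct (blaschke_iterate q l Hq Hl Hm) as [c [h [Hh [Ec HE]]]].
  assert (Hb := bprod_pos q l Hq Hm).
  assert (Nq' := Cminus_neq _ _ Nq).
  assert (Nc : c <> 0). { intros E. rewrite E, Cmod_0 in Ec. lra. }
  set (P := fun nu => nu = RtoC q \/ In nu l).
  assert (HR : expsum P (fun s => c * expn (RtoC q) s + h s)%C).
  { constructor; [now left|]. apply expsum_mono with (2 := Hh). now right. }
  destruct (expsum_resolvent (fun nu => In nu l) a h) as [Y [HY [Y0 DY]]]; trivial.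
  { intros nu Hn E. now subst. }
  set (k := (c / (a - RtoC q))%C).
  set (Z := fun s => (k * expn (RtoC q) s + (- k * expn a s + Y s))%C).
  assert (DZ : forall s, is_Cderive Z s ((c * expn (RtoC q) s + h s) - a * Z s)%C).
  { intros s. unfold Z. match goal with |- is_Cderive _ _ ?t => replace t with
     (k * (- RtoC q * expn (RtoC q) s) + (- k * (- a * expn a s) + (h s - a * Y s)))%C
       by (unfold k; field; trivial) end.
    apply is_Cderive_plus; [apply is_Cderive_scal, expn_derive|].
    apply is_Cderive_plus; [apply is_Cderive_scal, expn_derive|apply DY]. }
  assert (Z0 : Z 0 = RtoC 0). { unfold Z. rewrite !expn_0, Y0. ring. }
  exists (fun s => - ((a - RtoC q) / c) * (- k * expn a s + Y s))%C. split.
  - apply expsum_scal. constructor; [now left|]. apply expsum_mono with (2 := HY). tauto.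
  - intros s Hs.
    replace (expn (RtoC q) s - _)%C with ((a - RtoC q) / c * Z s)%C
      by (unfold Z, k; field; split; trivial).
    assert (ZB : sqnorm (Z s) <= S0 / (2 * Re a)).
    { assert (B := blaschke_energy a (fun s => c * expn (RtoC q) s + h s)%C Z s (proj1 Hs) Z0
        (expsum_derive _ _ HR) DZ).
      assert (B1 : 0 <= energy (fun s => c * expn (RtoC q) s + h s + - RtoC (2 * Re a) * Z s)%C s).
      { apply energy_pos; [lra|]. intros r. destruct (expsum_derive _ _ HR r) as [m Hm'].
        eexists. apply is_Cderive_plus; [exact Hm'|]. apply is_Cderive_scal. apply DZ. }
      assert (B2 := HE s (proj1 Hs)).
      assert (B3 : energy (expn (RtoC q)) s <= s).
      { unfold energy. apply Rle_trans with (Rabs (RInt (fun s => sqnorm (expn (RtoC q) s)) 0 s)); [apply Rle_abs|].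
        replace s with ((s - 0) * 1) at 2 by ring. apply abs_RInt_le_const; [lra| |].
        - apply energy_ex. intros r. eexists. apply expn_derive.
        - intros t Ht. rewrite Rabs_pos_eq; rewrite sqnorm_Cmod; [|apply Rle_0_sqr].
          unfold expn. rewrite Cmod_Cexp. rewrite <- exp_plus. rewrite <- exp_0.
          assert (M : Re (- RtoC q * RtoC t) <= 0). { simpl. nra. }
          destruct (Req_dec (Re (- RtoC q * RtoC t)) 0) as [->|N0]; [right; f_equal; ring|].
          left. apply exp_increasing. lra. }
      apply Rle_div_r; [lra|]. lra. }
    rewrite Cmod_mult, Cmod_div, Ec by trivial.
    replace (_ / _ * _) with (Cmod (Z s) * Cmod (a - RtoC q)%C / bprod q l) by (field; lra).
    apply Rmult_le_compat_r; [left; now apply Rinv_0_lt_compat|].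
    apply Rmult_le_compat_r; [apply Cmod_ge_0|].
    rewrite <- (sqrt_square (Cmod (Z s))) by apply Cmod_ge_0.
    apply sqrt_le_1_alt. now rewrite <- sqnorm_Cmod.
Qed.

(** * A Muntz theorem *)

Lemma bfactor_square q mu : 0 < q -> mu <> RtoC q ->
  bfactor q mu * bfactor q mu = 1 + 4 * q * Re mu / sqnorm (mu - RtoC q)%C.
Proof.
  intros Hq N. apply Cminus_neq in N.
  assert (Hs : 0 < Cmod (mu - RtoC q)) by now apply Cmod_gt_0.
  unfold bfactor.
  replace (_ * _) with (sqnorm (RtoC q + mu)%C / sqnorm (mu - RtoC q)%C)
    by (rewrite !sqnorm_Cmod; field; lra).
  assert (Hs' : 0 < sqnorm (mu - RtoC q)%C) by (rewrite sqnorm_Cmod; now apply Rmult_lt_0_compat).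
  apply Rmult_eq_reg_r with (sqnorm (mu - RtoC q)%C); [|lra].
  field_simplify_eq; [|lra]. unfold sqnorm. destruct mu; simpl; ring.
Qed.

Lemma square_ge_1 x : 0 < x -> 1 <= x * x -> 1 <= x.
Proof. intros; nra. Qed.

(** A half plane that contains exactly one of omega and - omega if omega <> 0. *)
Definition upper (z : C) : bool :=
  if Rlt_dec 0 (Re z) then true else if Rlt_dec (Re z) 0 then false
  else if Rlt_dec 0 (Im z) then true else false.

Lemma upper_square_inj (z z' : C) : z <> RtoC 0 -> upper z = upper z' -> (z ^ 2 = z' ^ 2)%C -> z = z'.
Proof.
  intros Nz Hu Hs.
  destruct (classic (z = z')) as [e|n]; trivial. exfalso.
  assert (Hp : ((z - z') * (z + z'))%C = 0).
  { replace ((z - z') * (z + z'))%C with (z ^ 2 - z' ^ 2)%C by ring. rewrite Hs. ring. }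
  assert (E : (z + z')%C = 0).
  { destruct (classic ((z + z')%C = 0)) as [E|E]; trivial. exfalso.
    apply (Cmult_neq_0 _ _ (Cminus_neq _ _ n) E Hp). }
  assert (E1 := f_equal Re E). assert (E2 := f_equal Im E).
  destruct z as [x y], z' as [x' y']. unfold upper in Hu. simpl in *.
  assert (x = 0 -> y = 0 -> False). { intros -> ->. now apply Nz. }
  repeat destruct Rlt_dec; try discriminate; try lra; apply H; lra.
Qed.

Definition lprod (B : nat -> R) (l : list nat) : R := fold_right (fun j acc => B j * acc) 1 l.

Lemma lprod_ge_1 B l : (forall j, In j l -> 1 <= B j) -> 1 <= lprod B l.
Proof.
  induction l as [|j l IH]; intros H; simpl; [lra|].
  assert (1 <= B j) by (apply H; now left). assert (1 <= lprod B l) by (apply IH; intros; apply H; now right).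
  nra.
Qed.

Lemma lprod_filter B (P : nat -> bool) l :
  lprod B l = lprod B (filter P l) * lprod B (filter (fun j => negb (P j)) l).
Proof.
  induction l as [|j l IH]; simpl; [ring|]. rewrite IH. destruct (P j); simpl; ring.
Qed.

Lemma lprod_remove B a l : NoDup l -> 1 <= B a -> (forall j, In j l -> 1 <= B j) ->
  lprod B l <= B a * lprod B (remove Nat.eq_dec a l).
Proof.
  intros Hl Ha. induction Hl as [|j l Nj Hl IH]; intros H; cbn [remove]; [simpl; lra|].
  assert (1 <= B j) by (apply H; now left).
  assert (IH' := IH (fun i Hi => H i (or_intror Hi))).
  destruct (Nat.eq_dec a j) as [->|n]; simpl.
  - rewrite notin_remove by trivial. lra.
  - assert (0 <= B j) by lra. assert (X := Rmult_le_compat_l _ _ _ H1 IH'). lra.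
Qed.

Lemma bprod_map q (mu : nat -> C) l : bprod q (map mu l) = lprod (fun j => bfactor q (mu j)) l.
Proof. induction l as [|j l IH]; simpl; trivial. now rewrite IH. Qed.

Lemma NoDup_remove_list a (l : list nat) : NoDup l -> NoDup (remove Nat.eq_dec a l).
Proof.
  induction 1 as [|j l Nj Hl IH]; simpl; [constructor|].
  destruct (Nat.eq_dec a j); trivial. constructor; trivial.
  intros Hj. apply in_remove in Hj. tauto.
Qed.

(** The product diverges with the harmonic series: 1 / j >= ln (j+1) - ln j. *)
Lemma harmonic_product B k n0 m : (0 < n0)%nat -> 0 < k ->
  (forall j, (n0 <= j)%nat -> 0 < B j /\ 1 + k / INR j <= B j * B j) ->
  1 + k * (ln (INR (n0 + m)) - ln (INR n0)) <= lprod B (seq n0 m) * lprod B (seq n0 m).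
Proof.
  intros Hn Hk HB. 
  assert (G : forall m, 1 + k * (ln (INR (n0 + m)) - ln (INR n0)) <= lprod (fun j => B j * B j) (seq n0 m)).
  { clear m. intros m. induction m as [|m IH].
    - rewrite Nat.add_0_r. simpl. lra.
    - rewrite seq_S. unfold lprod in *. rewrite fold_right_app. simpl.
      assert (F : forall l c, fold_right (fun j acc => B j * B j * acc) c l =
         fold_right (fun j acc => B j * B j * acc) 1 l * c).
      { intros l c. induction l as [|j l IHl]; simpl; [ring|]. rewrite IHl. ring. }
      rewrite F.
      destruct (HB (n0 + m)%nat ltac:(lia)) as [_ H1].
      assert (I : 0 < INR (n0 + m)) by (apply lt_0_INR; lia).
      assert (I' : 0 < INR (n0 + S m)) by (apply lt_0_INR; lia).
      assert (E : ln (INR (n0 + S m)) - ln (INR (n0 + m)) <= / INR (n0 + m)).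
      { rewrite <- ln_div by trivial.
        replace (INR (n0 + S m) / INR (n0 + m)) with (1 + / INR (n0 + m))
          by (rewrite <- plus_n_Sm, S_INR; field; lra).
        assert (0 < / INR (n0 + m)) by now apply Rinv_0_lt_compat.
        apply Rnot_lt_le. intros A. apply exp_increasing in A. rewrite exp_ln in A by lra.
        assert (A' := exp_ineq1 (/ INR (n0 + m)) ltac:(lra)). lra. }
      assert (I2 : 0 < / INR (n0 + m)) by now apply Rinv_0_lt_compat.
      set (X := fold_right (fun j acc => B j * B j * acc) 1 (seq n0 m)) in *.
      assert (0 <= ln (INR (n0 + m)) - ln (INR n0)).
      { assert (I0 : 0 < INR n0) by (apply lt_0_INR; lia).
        destruct (Nat.eq_dec m 0) as [->|]; [rewrite Nat.add_0_r; lra|].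
        assert (ln (INR n0) < ln (INR (n0 + m))); [|lra]. apply ln_increasing; trivial. apply lt_INR. lia. }
      assert (X1 : 1 <= X) by nra.
      unfold Rdiv in H1.
      assert (k * (ln (INR (n0 + S m)) - ln (INR (n0 + m))) <= k * / INR (n0 + m)) by (apply Rmult_le_compat_l; lra).
      assert (0 < k * / INR (n0 + m)) by (apply Rmult_lt_0_compat; lra).
      rewrite Rmult_1_r.
      assert (X * (1 + k * / INR (n0 + m)) <= X * (B (n0 + m)%nat * B (n0 + m)%nat)) by (apply Rmult_le_compat_l; lra).
      nra. }
  replace (lprod B (seq n0 m) * lprod B (seq n0 m)) with (lprod (fun j => B j * B j) (seq n0 m)); [apply G|].
  generalize (seq n0 m). induction l as [|j l IH]; simpl; [ring|]. rewrite IH. ring.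
Qed.

Lemma expn_bound q s : 0 < q -> 0 <= s -> Cmod (expn (RtoC q) s) <= 1.
Proof.
  intros Hq Hs. unfold expn. rewrite Cmod_Cexp, <- exp_0.
  assert (M : Re (- RtoC q * RtoC s) <= 0) by (simpl; nra).
  destruct M as [M| ->]; [left; now apply exp_increasing|lra].
Qed.

Lemma exponents_asymptotic (omega : nat -> C) d : 0 < d ->
  filterlim (fun n => (RtoC (INR n) / omega n ^ 2)%C) eventually (locally (RtoC d)) ->
  exists n0, (0 < n0)%nat /\ forall n, (n0 <= n)%nat ->
    omega n <> RtoC 0 /\ INR n / (5 * d) <= Re (omega n ^ 2)%C /\ Cmod (omega n ^ 2)%C <= 2 * INR n / d.
Proof.
  intros Hd Hlim.
  destruct (Hlim (fun z : C => Rabs (Re z - d) < d / 2 /\ Rabs (Im z - 0) < d / 2)) as [n0 Hn].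
  { exists (mkposreal (d / 2) ltac:(lra)). intros z [H1 H2]. split; trivial. }
  exists (S n0). split; [lia|]. intros n Hn'. destruct (Hn n ltac:(lia)) as [H1 H2]. clear Hn.
  assert (In : 0 < INR n) by (apply lt_0_INR; lia).
  assert (N0 : (omega n ^ 2)%C <> 0).
  { intros E. rewrite E in H1. apply Rabs_def2 in H1.
    unfold Cdiv, Cinv in H1. simpl in H1. unfold Rdiv in H1. rewrite !Rmult_0_l in H1. 
    replace (INR n * 0 - 0 * (-0 * / (0 + 0))) with 0 in H1 by ring. lra. }
  assert (Nw : omega n <> 0). { intros E. apply N0. rewrite E. ring. }
  split; trivial.
  set (mu := (omega n ^ 2)%C) in *.
  set (z := (RtoC (INR n) / mu)%C) in *.
  apply Rabs_def2 in H1. apply Rabs_def2 in H2.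
  assert (Nz : z <> 0). { intros E. rewrite E in H1. simpl in H1. lra. }
  assert (E : mu = (RtoC (INR n) / z)%C).
  { unfold z. field. split; [exact N0|].
    intros E. apply (f_equal Re) in E. simpl in E. lra. }
  assert (S1 : 0 < Re z * Re z + Im z * Im z) by nra.
  split.
  - rewrite E. replace (Re (RtoC (INR n) / z)%C) with (INR n * (Re z / (Re z * Re z + Im z * Im z))).
    + unfold Rdiv at 1. apply Rmult_le_compat_l; [lra|].
      apply Rmult_le_reg_r with (5 * d * (Re z * Re z + Im z * Im z)); [apply Rmult_lt_0_compat; lra|].
      replace (/ (5 * d) * (5 * d * (Re z * Re z + Im z * Im z))) with (Re z * Re z + Im z * Im z) by (field; lra).
      replace (Re z / (Re z * Re z + Im z * Im z) * (5 * d * (Re z * Re z + Im z * Im z))) with (5 * d * Re z) by (field; lra).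
      nra.
    + destruct z as [a b]. unfold Re, Im in *; simpl in *. field. lra.
  - rewrite E, Cmod_div, Cmod_R, Rabs_pos_eq by (trivial; lra).
    assert (Zm : d / 2 <= Cmod z).
    { apply Rle_trans with (Rabs (Re z)); [|apply re_le_Cmod]. rewrite Rabs_pos_eq; lra. }
    apply Rle_trans with (INR n * / (d / 2)).
    + apply Rmult_le_compat_l; [lra|]. apply Rinv_le_contravar; lra.
    + right. field. lra.
Qed.

(** A theorem of Muntz type.  As omega_n^2 grows linearly within a
   sector around the positive axis, the Blaschke factors are at least 1 + const / n and their
   product diverges.  A value omega_n^2 may occur twice, for omega_n and
   - omega_n; splitting the indices by a half plane gives two families of
   distinct exponents, and one of the two partial products must be large. *)
Lemma muntz (omega : nat -> C) d :
  (forall m n, omega m = omega n -> m = n) -> 0 < d ->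
  filterlim (fun n => (RtoC (INR n) / omega n ^ 2)%C) eventually (locally (RtoC d)) ->
  forall q S0 eta, 0 < q -> 0 <= S0 -> 0 < eta ->
  exists h, expsum (fun nu => exists j, nu = (omega j ^ 2)%C /\ omega j <> RtoC 0) h /\
    forall s, 0 <= s <= S0 -> Cmod (expn (RtoC q) s - h s)%C <= eta.
Proof.
  intros Hinj Hd Hlim q S0 eta Hq HS Heta.
  destruct (exponents_asymptotic omega d Hd Hlim) as [n1 [Hn1 Has]].
  set (mu := fun j => (omega j ^ 2)%C).
  set (P := fun nu => exists j, nu = mu j /\ omega j <> RtoC 0).
  destruct (INR_archimed 1 (q * d) ltac:(lra)) as [n2 Hn2]. rewrite Rmult_1_r in Hn2.
  set (n0 := (n1 + n2)%nat).
  destruct (classic (exists j, (n0 <= j)%nat /\ mu j = RtoC q)) as [[j [Hj Ej]]|Nq].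
  { exists (expn (mu j)). split.
    - apply expsum_single. exists j. split; trivial. apply Has. unfold n0 in Hj; lia.
    - intros s _. rewrite Ej. replace (_ - _)%C with (RtoC 0) by ring. rewrite Cmod_0. lra. }
  assert (Hmu : forall j, (n0 <= j)%nat -> 0 < Re (mu j) /\ mu j <> RtoC q).
  { intros j Hj. split; [|intros E; apply Nq; now exists j].
    destruct (Has j ltac:(unfold n0 in Hj; lia)) as [_ [H1 _]].
    apply Rlt_le_trans with (2 := H1). apply Rdiv_lt_0_compat; [apply lt_0_INR; unfold n0 in Hj; lia|lra]. }
  set (B := fun j => bfactor q (mu j)).
  set (k := 4 * q * d / 45).
  assert (Hk : 0 < k). { unfold k. apply Rdiv_lt_0_compat; [repeat apply Rmult_lt_0_compat; lra|lra]. }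
  assert (HB : forall j, (n0 <= j)%nat -> 0 < B j /\ 1 + k / INR j <= B j * B j).
  { intros j Hj. destruct (Hmu j Hj) as [Rm Nm]. split; [now apply bfactor_pos|].
    unfold B. rewrite bfactor_square by trivial. apply Rplus_le_compat_l.
    destruct (Has j ltac:(unfold n0 in Hj; lia)) as [_ [H1 H2]]. fold (mu j) in H1, H2.
    assert (Ij : 0 < INR j) by (apply lt_0_INR; unfold n0 in Hj; lia).
    assert (Iq : q * d <= INR j). { apply Rle_trans with (INR n2); [lra|apply le_INR; unfold n0 in Hj; lia]. }
    assert (M : Cmod (mu j - RtoC q)%C <= 3 * INR j / d).
    { apply Rle_trans with (1 := Cmod_triangle _ _). rewrite Cmod_opp, Cmod_R, Rabs_pos_eq by lra.
      assert (q <= INR j / d) by (apply Rle_div_r; lra).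
      replace (3 * INR j / d) with (2 * INR j / d + INR j / d) by (field; lra). lra. }
    assert (M2 : sqnorm (mu j - RtoC q)%C <= (3 * INR j / d) * (3 * INR j / d)).
    { rewrite sqnorm_Cmod. apply Rmult_le_compat; trivial; apply Cmod_ge_0. }
    assert (M0 : 0 < sqnorm (mu j - RtoC q)%C).
    { rewrite sqnorm_Cmod. apply Cminus_neq in Nm. apply Cmod_gt_0 in Nm. now apply Rmult_lt_0_compat. }
    apply Rle_trans with (4 * q * (INR j / (5 * d)) / ((3 * INR j / d) * (3 * INR j / d))).
    - right. unfold k. field. lra.
    - unfold Rdiv at 1 4. apply Rmult_le_compat.
      + assert (0 < INR j / (5 * d)) by (apply Rdiv_lt_0_compat; lra). nra.
      + left. apply Rinv_0_lt_compat. assert (0 < 3 * INR j / d) by (apply Rdiv_lt_0_compat; lra). nra.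
      + apply Rmult_le_compat_l; [lra|trivial].
      + apply Rinv_le_contravar; trivial. }
  assert (HB1 : forall j, (n0 <= j)%nat -> 1 <= B j).
  { intros j Hj. destruct (HB j Hj) as [B0 B1]. apply square_ge_1; trivial.
    assert (0 < k / INR j) by (apply Rdiv_lt_0_compat; [lra|apply lt_0_INR; unfold n0 in Hj; lia]). lra. }
  (* one exponent of the half plane, mu a, is kept for the last step; if there is
     none, the product is 1 and the zero combination will do *)
  assert (Hcl : forall b : bool, exists Kb, 0 < Kb /\ forall m, exists h, expsum P h /\
     forall s, 0 <= s <= S0 -> Cmod (expn (RtoC q) s - h s)%C <=
       Kb / lprod B (filter (fun j => Bool.eqb (upper (omega j)) b) (seq n0 m))).
  { intros b.
    assert (InF : forall m j, In j (filter (fun j => Bool.eqb (upper (omega j)) b) (seq n0 m)) ->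
      (n0 <= j)%nat /\ upper (omega j) = b).
    { intros m j Hj. apply filter_In in Hj. destruct Hj as [Hj Hb]. apply in_seq in Hj.
      split; [lia|]. now apply Bool.eqb_prop. }
    destruct (classic (exists a, (n0 <= a)%nat /\ upper (omega a) = b)) as [[a [Ha Hab]]|Hno].
    - destruct (Hmu a Ha) as [Ra Na].
      exists (1 + sqrt (S0 / (2 * Re (mu a))) * Cmod (mu a - RtoC q)%C * B a).
      assert (K0 : 0 <= sqrt (S0 / (2 * Re (mu a))) * Cmod (mu a - RtoC q)%C).
      { apply Rmult_le_pos; [apply sqrt_pos|apply Cmod_ge_0]. }
      assert (Ba := HB1 a Ha). split; [nra|]. intros m.
      set (l := filter (fun j => Bool.eqb (upper (omega j)) b) (seq n0 m)).
      assert (Hl : NoDup l) by apply NoDup_filter, seq_NoDup.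
      set (l' := remove Nat.eq_dec a l).
      assert (Hl' : forall j, In j l' -> (n0 <= j)%nat /\ upper (omega j) = b /\ j <> a).
      { intros j Hj. apply in_remove in Hj. destruct Hj as [Hj Hja]. destruct (InF m j Hj). tauto. }
      assert (Inj : forall i j, (n0 <= i)%nat -> (n0 <= j)%nat -> upper (omega i) = b -> upper (omega j) = b ->
        mu i = mu j -> i = j).
      { intros i j Hi Hj Ui Uj E. apply Hinj. apply upper_square_inj; [|congruence|exact E].
        apply Has. unfold n0 in Hi; lia. }
      destruct (muntz_distance q (mu a) (map mu l') S0 Hq Ra Na) as [h [Hh Hbd]]; trivial.
      + intros Hin. apply in_map_iff in Hin. destruct Hin as [j [Ej Hj]].
        destruct (Hl' j Hj) as [Hj1 [Hj2 Hj3]]. apply Hj3. now apply Inj.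
      + apply NoDup_map_NoDup_ForallPairs; [|now apply NoDup_remove_list].
        intros i j Hi Hj E. destruct (Hl' i Hi) as [? [? _]]. destruct (Hl' j Hj) as [? [? _]]. now apply Inj.
      + intros nu Hnu. apply in_map_iff in Hnu. destruct Hnu as [j [<- Hj]].
        destruct (Hl' j Hj) as [? _]. now apply Hmu.
      + exists h. split.
        * apply expsum_mono with (2 := Hh). intros nu [->|Hnu].
          -- exists a. split; trivial. apply Has. unfold n0 in Ha; lia.
          -- apply in_map_iff in Hnu. destruct Hnu as [j [<- Hj]]. exists j. split; trivial.
             apply Has. destruct (Hl' j Hj) as [? _]. unfold n0 in *; lia.
        * intros s Hs. apply Rle_trans with (1 := Hbd s Hs). rewrite bprod_map. fold B.
          assert (G1 : 1 <= lprod B l'). { apply lprod_ge_1. intros j Hj. apply HB1. now apply Hl'. }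
          assert (G2 : 1 <= lprod B l). { apply lprod_ge_1. intros j Hj. apply HB1. now apply (InF m). }
          assert (G3 : lprod B l <= B a * lprod B l').
          { apply lprod_remove; trivial. intros j Hj. apply HB1. now apply (InF m). }
          apply Rmult_le_reg_r with (lprod B l * lprod B l'); [nra|].
          replace (_ / _ * _) with (sqrt (S0 / (2 * Re (mu a))) * Cmod (mu a - RtoC q) * lprod B l) by (field; lra).
          replace ((1 + _) / _ * _) with ((1 + sqrt (S0 / (2 * Re (mu a))) * Cmod (mu a - RtoC q) * B a) * lprod B l') by (field; lra).
          nra.
    - exists 1. split; [lra|]. intros m. exists (fun _ => RtoC 0). split; [constructor|].
      intros s Hs. replace (filter _ _) with (@nil nat).
      + simpl. replace (_ - 0)%C with (expn (RtoC q) s) by ring. rewrite Rdiv_1_r. apply expn_bound; tauto.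
      + destruct (filter (fun j => Bool.eqb (upper (omega j)) b) (seq n0 m)) as [|j l] eqn:El; trivial.
        exfalso. apply Hno. exists j. apply (InF m). rewrite El. now left. }
  destruct (Hcl true) as [K1 [K1p H1]]. destruct (Hcl false) as [K2 [K2p H2]].
  set (M := (K1 + K2) / eta). assert (Mp : 0 < M) by (apply Rdiv_lt_0_compat; lra).
  (* a full product of at least M^2 forces a factor of at least M on one half plane *)
  assert (exists m, M * M <= lprod B (seq n0 m)) as [m Hm].
  { destruct (INR_archimed 1 (exp ((M * M) * (M * M) / k + ln (INR n0))) ltac:(lra)) as [m Hm].
    rewrite Rmult_1_r in Hm. exists m.
    assert (Hh := harmonic_product B k n0 m ltac:(unfold n0; lia) Hk HB).
    assert (L1 : (M * M) * (M * M) / k + ln (INR n0) < ln (INR (n0 + m))).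
    { apply exp_lt_inv. rewrite exp_ln by (apply lt_0_INR; unfold n0; lia).
      apply Rlt_le_trans with (1 := Hm). apply le_INR. lia. }
    assert (L2 : (M * M) * (M * M) <= k * (ln (INR (n0 + m)) - ln (INR n0))).
    { replace ((M * M) * (M * M)) with (k * ((M * M) * (M * M) / k)) by (field; lra).
      apply Rmult_le_compat_l; lra. }
    assert (G : 1 <= lprod B (seq n0 m)). { apply lprod_ge_1. intros j Hj. apply HB1. apply in_seq in Hj. lia. }
    apply Rsqr_incr_0_var; [unfold Rsqr; lra|lra]. }
  rewrite (lprod_filter B (fun j => Bool.eqb (upper (omega j)) true)) in Hm.
  rewrite (filter_ext (fun j => negb (Bool.eqb (upper (omega j)) true)) (fun j => Bool.eqb (upper (omega j)) false)) in Hm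
    by (intros j; destruct (upper (omega j)); reflexivity).
  assert (Fin : forall Kb b, 0 < Kb -> Kb <= K1 + K2 ->
     M <= lprod B (filter (fun j => Bool.eqb (upper (omega j)) b) (seq n0 m)) ->
     Kb / lprod B (filter (fun j => Bool.eqb (upper (omega j)) b) (seq n0 m)) <= eta).
  { intros Kb b Kp Kl Hx. apply Rle_div_l; [lra|].
    assert (EM : eta * M = K1 + K2) by (unfold M; field; lra).
    assert (eta * M <= eta * lprod B (filter (fun j => Bool.eqb (upper (omega j)) b) (seq n0 m)))
      by (apply Rmult_le_compat_l; lra). lra. }
  assert (Pos : forall b, 0 < lprod B (filter (fun j => Bool.eqb (upper (omega j)) b) (seq n0 m))).
  { intros b. apply Rlt_le_trans with 1; [lra|]. apply lprod_ge_1. intros j Hj. apply filter_In in Hj.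
    destruct Hj as [Hj _]. apply in_seq in Hj. apply HB1. lia. }
  assert (P1 := Pos true). assert (P2 := Pos false).
  destruct (Rle_lt_dec M (lprod B (filter (fun j => Bool.eqb (upper (omega j)) true) (seq n0 m)))) as [C1|C1].
  - destruct (H1 m) as [h [Hh Hb]]. exists h. split; trivial. intros s Hs.
    apply Rle_trans with (1 := Hb s Hs). apply Fin; lra.
  - destruct (H2 m) as [h [Hh Hb]]. exists h. split; trivial. intros s Hs.
    apply Rle_trans with (1 := Hb s Hs). apply Fin; trivial; [lra|nra].
Qed.

(** * Density of exponential sums *)

(** The Bernstein polynomial of the values phi 0, ..., phi n, by de Casteljau's
   recursion: the expectation of phi at a binomial variable. *)
Fixpoint bern (n : nat) (phi : nat -> R) (x : R) : R :=
  match n with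
  | O => phi O
  | S m => x * bern m (fun k => phi (S k)) x + (1 - x) * bern m phi x
  end.

Lemma bern_le n phi psi x : 0 <= x <= 1 -> (forall k, (k <= n)%nat -> phi k <= psi k) ->
  bern n phi x <= bern n psi x.
Proof.
  intros Hx. revert phi psi. induction n as [|n IH]; intros phi psi H; simpl; [auto|].
  apply Rplus_le_compat; apply Rmult_le_compat_l; try lra; apply IH; intros; apply H; lia.
Qed.

Lemma bern_lin n a b phi psi x :
  bern n (fun k => a * phi k + b * psi k) x = a * bern n phi x + b * bern n psi x.
Proof. revert phi psi; induction n as [|n IH]; intros; simpl; trivial. rewrite !IH. ring. Qed.

Lemma bern_const n c x : bern n (fun _ => c) x = c.
Proof. induction n as [|n IH]; simpl; trivial. rewrite IH. ring. Qed.

Lemma bern_ext n phi psi x : (forall k, phi k = psi k) -> bern n phi x = bern n psi x.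
Proof. intros H. now rewrite (functional_extensionality phi psi H). Qed.

Lemma bern_variance n c x :
  bern n (fun k => (INR k - c) * (INR k - c)) x =
  (INR n * x - c) * (INR n * x - c) + INR n * (x * (1 - x)).
Proof.
  revert c. induction n as [|n IH]; intros c; cbn [bern]; [simpl; ring|].
  rewrite (bern_ext n (fun k => (INR (S k) - c) * (INR (S k) - c))
    (fun k => (INR k - (c - 1)) * (INR k - (c - 1)))) by (intros; rewrite S_INR; ring).
  rewrite !IH, S_INR. ring.
Qed.

(** |F(k/n) - F(x)| is at most eta/2 plus a multiple of the
   square (k/n - x)^2, whose expectation is x (1 - x) / n. *)
Lemma bernstein F : (forall x, continuity_pt F x) -> forall eta, 0 < eta ->
  exists n, forall x, 0 <= x <= 1 -> Rabs (bern n (fun k => F (INR k / INR n)) x - F x) <= eta.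
Proof.
  intros HF eta Heta.
  destruct (Heine_cor2 (f := F) (a := 0) (b := 1) (fun x _ => HF x) (mkposreal (eta / 2) ltac:(lra))) as [d Hd].
  simpl in Hd. assert (d0 := cond_pos d).
  destruct (continuity_ab_maj (fun x => Rabs (F x)) 0 1 ltac:(lra)) as [xM [HM _]].
  { intros c _. apply (continuity_pt_comp F Rabs); [apply HF|apply Rcontinuity_abs]. }
  simpl in HM. set (M := Rabs (F xM)) in *. assert (M0 : 0 <= M) by apply Rabs_pos. clearbody M.
  destruct (INR_archimed 1 (4 * M / (d * d) / eta) ltac:(lra)) as [n0 Hn0]. rewrite Rmult_1_r in Hn0.
  set (n := S n0). exists n. intros x Hx.
  assert (In : 0 < INR n) by (apply lt_0_INR; unfold n; lia).
  assert (Ine : 4 * M / (d * d) / eta < INR n).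
  { apply Rlt_trans with (1 := Hn0). apply lt_INR. unfold n; lia. }
  set (psi := fun k => eta / 2 + 2 * M / (d * d) * ((INR k / INR n - x) * (INR k / INR n - x))).
  assert (D2 : 0 < d * d) by (now apply Rmult_lt_0_compat).
  assert (Hk : forall k, (k <= n)%nat -> Rabs (F (INR k / INR n) - F x) <= psi k).
  { intros k Hk. assert (Kn : 0 <= INR k / INR n <= 1).
    { split; [apply Rle_div_r; trivial; assert (Z := pos_INR k); lra|].
      apply Rle_div_l; trivial. rewrite Rmult_1_l. now apply le_INR. }
    unfold psi. set (z := INR k / INR n) in *.
    assert (0 <= 2 * M / (d * d)) by (apply Rdiv_le_0_compat; lra).
    assert (0 <= (z - x) * (z - x)) by apply Rle_0_sqr.
    destruct (Rlt_le_dec (Rabs (z - x)) d) as [Hz|Hz].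
    - assert (Q := Hd z x Kn Hx Hz). nra.
    - assert (d * d <= (z - x) * (z - x)).
      { rewrite <- (Rabs_pos_eq ((z - x) * (z - x))) by trivial. rewrite Rabs_mult.
        apply Rmult_le_compat; lra. }
      assert (Q1 := HM z Kn). assert (Q2 := HM x Hx). simpl in Q1, Q2.
      assert (Q3 : Rabs (F z - F x) <= 2 * M).
      { apply Rle_trans with (1 := Rabs_triang _ _). rewrite Rabs_Ropp. lra. }
      assert (2 * M / (d * d) * (d * d) = 2 * M) by (field; lra).
      assert (2 * M / (d * d) * (d * d) <= 2 * M / (d * d) * ((z - x) * (z - x)))
        by (apply Rmult_le_compat_l; trivial).
      lra. }
  assert (Bpsi : bern n psi x <= eta).
  { unfold psi.
    rewrite (bern_ext n _ (fun k => 1 * (eta / 2) + (2 * M / (d * d) / (INR n * INR n)) *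
      ((INR k - INR n * x) * (INR k - INR n * x)))) by (intros; field; lra).
    rewrite (bern_lin n 1 _ (fun _ => eta / 2) (fun k => (INR k - INR n * x) * (INR k - INR n * x))).
    rewrite bern_const, bern_variance.
    replace (1 * (eta / 2) + _) with (eta / 2 + 2 * M / (d * d) / INR n * (x * (1 - x))) by (field; lra).
    assert (0 <= x * (1 - x) <= 1) by nra.
    assert (H1 : 2 * M / (d * d) / INR n <= eta / 2).
    { apply Rle_div_l; trivial. apply Rlt_div_l in Ine; trivial. lra. }
    assert (0 <= 2 * M / (d * d) / INR n).
    { repeat apply Rdiv_le_0_compat; lra. }
    nra. }
  assert (E : bern n (fun k => F (INR k / INR n)) x - F x = bern n (fun k => F (INR k / INR n) - F x) x).
  { rewrite (bern_ext n (fun k => F (INR k / INR n) - F x) (fun k => 1 * F (INR k / INR n) + (-1) * F x))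
      by (intros; ring).
    rewrite (bern_lin n 1 (-1) (fun k => F (INR k / INR n)) (fun _ => F x)), bern_const. ring. }
  rewrite E. apply Rabs_le. split.
  - apply Rle_trans with (- bern n psi x); [lra|].
    replace (- bern n psi x) with (bern n (fun k => (-1) * psi k + 0 * psi k) x) by (rewrite bern_lin; ring).
    apply bern_le; trivial. intros k Hkn. specialize (Hk k Hkn). apply Rabs_le_between in Hk. lra.
  - apply Rle_trans with (2 := Bpsi). apply bern_le; trivial.
    intros k Hkn. specialize (Hk k Hkn). apply Rabs_le_between in Hk. lra.
Qed.

Definition expclosure (P : C -> Prop) (S : R) (g : R -> C) : Prop :=
  forall eta, 0 < eta -> exists h, expsum P h /\ forall s, 0 <= s <= S -> Cmod (g s - h s)%C <= eta.

Lemma expclosure_eq P S g g' : (forall s, 0 <= s <= S -> g s = g' s) ->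
  expclosure P S g -> expclosure P S g'.
Proof.
  intros E H eta He. destruct (H eta He) as [h [Hh Hb]]. exists h. split; trivial.
  intros s Hs. rewrite <- E by trivial. auto.
Qed.

Lemma expclosure_lin P S g g' c : expclosure P S g -> expclosure P S g' ->
  expclosure P S (fun s => c * g s + g' s)%C.
Proof.
  intros H H' eta He.
  assert (Cc := Cmod_ge_0 c).
  destruct (H (eta / 2 / (1 + Cmod c))) as [h [Hh Hb]].
  { apply Rdiv_lt_0_compat; lra. }
  destruct (H' (eta / 2)) as [h' [Hh' Hb']]; [lra|].
  exists (fun s => c * h s + h' s)%C. split.
  - apply expsum_plus; trivial. now apply expsum_scal.
  - intros s Hs. replace (_ - _)%C with (c * (g s - h s) + (g' s - h' s))%C by ring.
    apply Rle_trans with (1 := Cmod_triangle _ _). rewrite Cmod_mult.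
    specialize (Hb s Hs). specialize (Hb' s Hs).
    assert (Cmod c * Cmod (g s - h s) <= Cmod c * (eta / 2 / (1 + Cmod c))) by (apply Rmult_le_compat_l; trivial).
    assert (Cmod c * (eta / 2 / (1 + Cmod c)) <= eta / 2).
    { replace (Cmod c * (eta / 2 / (1 + Cmod c))) with ((Cmod c * (eta / 2)) / (1 + Cmod c)) by (field; lra).
      apply Rle_div_l; [lra|]. nra. }
    lra.
Qed.

Lemma expclosure_closed P S g :
  (forall eta, 0 < eta -> exists g', expclosure P S g' /\ forall s, 0 <= s <= S -> Cmod (g s - g' s)%C <= eta) ->
  expclosure P S g.
Proof.
  intros H eta He. destruct (H (eta / 2)) as [g' [Hg' Hb]]; [lra|].
  destruct (Hg' (eta / 2)) as [h [Hh Hb']]; [lra|]. exists h. split; trivial.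
  intros s Hs. replace (_ - _)%C with ((g s - g' s) + (g' s - h s))%C by ring.
  apply Rle_trans with (1 := Cmod_triangle _ _). specialize (Hb s Hs). specialize (Hb' s Hs). lra.
Qed.

Lemma expn_real q s : expn (RtoC q) s = RtoC (exp (- q * s)).
Proof.
  unfold expn, Cexp. apply C_ext; simpl; unfold Rminus.
  - replace (- q * 0 + - 0 * s) with 0 by ring. rewrite cos_0, Rmult_1_r. f_equal. ring.
  - replace (- q * 0 + - 0 * s) with 0 by ring. rewrite sin_0. ring.
Qed.

Lemma bern_expclosure P S n : (forall q, 0 < q -> expclosure P S (expn (RtoC q))) ->
  forall m phi, expclosure P S (fun s => RtoC (exp (- INR (1 + m) * s) * bern n phi (exp (- s)))).
Proof.
  intros HP. 
  assert (Z : forall m phi0, expclosure P S (fun s => RtoC (exp (- INR (1 + m) * s) * phi0))).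
  { intros m phi0. apply expclosure_eq with
      (fun s => RtoC (phi0 - 1) * expn (RtoC (INR (1 + m))) s + expn (RtoC (INR (1 + m))) s)%C.
    - intros s _. rewrite expn_real, <- RtoC_mult, <- RtoC_plus. f_equal. ring.
    - assert (0 < INR (1 + m)) by (apply lt_0_INR; lia). apply expclosure_lin; now apply HP. }
  induction n as [|n IH]; intros m phi; [exact (Z m (phi O))|]. cbn [bern].
  apply expclosure_eq with (fun s =>
    RtoC (-1) * RtoC (exp (- INR (1 + (1 + m)) * s) * bern n phi (exp (- s))) +
    (1 * RtoC (exp (- INR (1 + (1 + m)) * s) * bern n (fun k => phi (Datatypes.S k)) (exp (- s))) +
     RtoC (exp (- INR (1 + m) * s) * bern n phi (exp (- s)))))%C.
  - intros s _. rewrite <- !RtoC_mult, <- !RtoC_plus. f_equal.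
    replace (exp (- INR (1 + (1 + m)) * s)) with (exp (- INR (1 + m) * s) * exp (- s)).
    + ring.
    + rewrite <- exp_plus. f_equal. change (1 + (1 + m))%nat with (Datatypes.S (1 + m)). rewrite (S_INR (1 + m)). ring.
  - apply expclosure_lin; [apply IH|]. apply expclosure_lin; apply IH.
Qed.

(** Bernstein polynomials in x = e^(-s) approximate e^s g(s), and multiplying
   them by e^(-s) leaves only exponents q >= 1. *)
Lemma expclosure_real P S (g : R -> R) : (forall q, 0 < q -> expclosure P S (expn (RtoC q))) ->
  (forall s, continuous g s) -> expclosure P S (fun s => RtoC (g s)).
Proof.
  intros HP Hg.
  set (cut := fun x => Rmax x (exp (- S))).
  assert (Hcut : forall x, 0 < cut x).
  { intros x. apply Rlt_le_trans with (2 := Rmax_r _ _). apply exp_pos. }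
  set (F := fun x => g (- ln (cut x)) * / cut x).
  assert (HF : forall x, continuity_pt F x).
  { intros x. apply continuity_pt_filterlim.
    assert (Ccut : continuous cut x).
    { intros Q [d Hd]. exists d. intros y Hy. apply Hd. unfold cut.
      apply Rle_lt_trans with (2 := Hy).
      unfold minus, plus, opp, abs; simpl. unfold Rmax; repeat destruct Rle_dec;
      unfold Rabs; repeat destruct Rcase_abs; lra. }
    apply (continuous_mult (K := R_AbsRing)).
    - apply (continuous_comp (fun x => - ln (cut x)) g); [|apply Hg].
      apply (continuous_opp (V := R_NormedModule)).
      apply (continuous_comp cut ln); trivial.
      apply continuity_pt_filterlim. apply derivable_continuous_pt.
      exists (/ cut x). apply derivable_pt_lim_ln. apply Hcut.
    - apply continuous_Rinv_comp; trivial. apply Rgt_not_eq, Hcut. }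
  apply expclosure_closed. intros eta He.
  destruct (bernstein F HF eta He) as [n Hn].
  exists (fun s => RtoC (exp (- INR (1 + 0) * s) * bern n (fun k => F (INR k / INR n)) (exp (- s)))).
  split; [now apply bern_expclosure|]. intros s Hs.
  rewrite <- RtoC_minus, Cmod_R.
  replace (- INR (1 + 0) * s) with (- s) by (simpl; ring).
  assert (E0 := exp_pos (- s)).
  assert (E1 : exp (- s) <= 1).
  { rewrite <- exp_0. destruct (Req_dec s 0) as [->|]; [right; f_equal; ring|left; apply exp_increasing; lra]. }
  assert (Ec : cut (exp (- s)) = exp (- s)).
  { unfold cut. apply Rmax_left. destruct (Req_dec s S) as [->|]; [lra|left; apply exp_increasing; lra]. }
  assert (EF : g s = exp (- s) * F (exp (- s))).
  { unfold F. rewrite Ec, ln_exp, Ropp_involutive. field. lra. }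
  rewrite EF, <- Rmult_minus_distr_l, Rabs_mult, (Rabs_pos_eq (exp (- s))) by lra.
  rewrite Rabs_minus_sym.
  assert (Q := Hn (exp (- s)) ltac:(lra)).
  assert (Q' := Rabs_pos (bern n (fun k => F (INR k / INR n)) (exp (- s)) - F (exp (- s)))). nra.
Qed.

Lemma expclosure_continuous P S g : (forall q, 0 < q -> expclosure P S (expn (RtoC q))) ->
  (forall s, continuous (fun s => Re (g s)) s) -> (forall s, continuous (fun s => Im (g s)) s) ->
  expclosure P S g.
Proof.
  intros HP H1 H2.
  apply expclosure_eq with (fun s => Ci * RtoC (Im (g s)) + RtoC (Re (g s)))%C.
  - intros s _. apply C_ext; simpl; ring.
  - apply expclosure_lin; now apply expclosure_real.
Qed.

(** * Complex solutions and modes *)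

Definition ccontinuous2 (v : R -> R -> C) : Prop :=
  continuous2 (fun y t => Re (v y t)) /\ continuous2 (fun y t => Im (v y t)).

Lemma ccontinuous2_plus u v : ccontinuous2 u -> ccontinuous2 v ->
  ccontinuous2 (fun y t => u y t + v y t)%C.
Proof.
  intros [H1 H2] [H3 H4]; split; intros y t; apply continuity_2d_pt_plus;
    [apply H1|apply H3|apply H2|apply H4].
Qed.

Lemma ccontinuous2_mult u v : ccontinuous2 u -> ccontinuous2 v ->
  ccontinuous2 (fun y t => u y t * v y t)%C.
Proof.
  intros [H1 H2] [H3 H4]; split; intros y t.
  - apply continuity_2d_pt_minus; apply continuity_2d_pt_mult; auto.
  - apply continuity_2d_pt_plus; apply continuity_2d_pt_mult; auto.
Qed.

Lemma ccontinuous2_const c : ccontinuous2 (fun _ _ => c).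
Proof. split; intros y t; apply continuity_2d_pt_const. Qed.

Lemma ccontinuous2_expn mu : ccontinuous2 (fun _ t => expn mu t).
Proof.
  assert (Z : forall g, (forall t, ex_derive g t) -> continuous2 (fun _ t => g t)).
  { intros g Hg y t. apply (continuity_1d_2d_pt_comp g (fun _ t => t)).
    - apply continuity_pt_filterlim.
      apply (ex_derive_continuous (K := R_AbsRing) (V := R_NormedModule)). apply Hg.
    - apply continuity_2d_pt_id2. }
  split; apply (Z (fun t => _ (expn mu t))); intros t; eexists; apply (expn_derive mu t).
Qed.

Lemma ccontinuous2_space L X X' : 0 <= L -> cdOn (Icc 0 L) X X' ->
  ccontinuous2 (fun y _ => X (clamp 0 L y)).
Proof.
  intros HL H. apply derivative_on_C in H. destruct H as [H1 H2].
  split; [apply (continuous2_of_derivative L (fun y => Re (X y)) (fun y => Re (X' y)) HL H1)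
         |apply (continuous2_of_derivative L (fun y => Im (X y)) (fun y => Im (X' y)) HL H2)].
Qed.

Lemma cderivative_on_ext (D : R -> Prop) (f g f' g' : R -> C) :
  (forall x, D x -> f x = g x) -> (forall x, D x -> f' x = g' x) ->
  cdOn D f f' -> cdOn D g g'.
Proof.
  intros E E' H. apply derivative_on_C in H. destruct H as [H1 H2]. apply derivative_on_C. split.
  - apply derivative_on_ext with (3 := H1); intros; now rewrite ?E, ?E'.
  - apply derivative_on_ext with (3 := H2); intros; now rewrite ?E, ?E'.
Qed.

Lemma cderivative_on_scal a b c f f' : cdOn (Icc a b) f f' ->
  cdOn (Icc a b) (fun y => c * f y)%C (fun y => c * f' y)%C.
Proof.
  intros H. apply derivative_on_C in H. destruct H as [H1 H2]. apply derivative_on_C. split.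
  - apply (derivative_on_minus a b (fun y => Re c * Re (f y)) (fun y => Re c * Re (f' y))
      (fun y => Im c * Im (f y)) (fun y => Im c * Im (f' y))); now apply derivative_on_scal.
  - apply (derivative_on_plus a b (fun y => Re c * Im (f y)) (fun y => Re c * Im (f' y))
      (fun y => Im c * Re (f y)) (fun y => Im c * Re (f' y))); now apply derivative_on_scal.
Qed.

Lemma cderivative_on_unique a b (f f' g' : R -> C) : a < b ->
  cdOn (Icc a b) f f' -> cdOn (Icc a b) f g' -> forall x, a <= x <= b -> f' x = g' x.
Proof.
  intros ab H H' x Hx. apply derivative_on_C in H. apply derivative_on_C in H'.
  destruct H as [H1 H2], H' as [H3 H4].
  apply C_ext.
  - exact (derivative_on_unique a b _ _ _ ab H1 H3 x Hx).
  - exact (derivative_on_unique a b _ _ _ ab H2 H4 x Hx).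
Qed.

Lemma is_Cderive_in D f x l : D x -> is_Cderive f x l -> is_derive_in (V := C_R_NormedModule) D f x l.
Proof.
  intros Dx [H1 H2]. apply is_derive_in_C; trivial. split; now apply is_derive_is_derive_in.
Qed.

(** Both parts of a complex solution are real ones, the coefficients being real. *)
Definition complex_solution L p q w tau T (v vy vt : R -> R -> C) : Prop :=
  real_solution L p q w tau T (fun y t => Re (v y t)) (fun y t => Re (vy y t)) (fun y t => Re (vt y t)) /\
  real_solution L p q w tau T (fun y t => Im (v y t)) (fun y t => Im (vy y t)) (fun y t => Im (vt y t)).

Lemma real_solution_lin L p q w tau T a v vy vt b u uy ut :
  real_solution L p q w tau T v vy vt -> real_solution L p q w tau T u uy ut ->
  real_solution L p q w tau T (fun y t => a * v y t + b * u y t)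
    (fun y t => a * vy y t + b * uy y t) (fun y t => a * vt y t + b * ut y t).
Proof.
  assert (CC : forall f g, continuous2 f -> continuous2 g -> continuous2 (fun y t => a * f y t + b * g y t)).
  { intros f g Hf Hg y t. apply continuity_2d_pt_plus; apply continuity_2d_pt_mult;
      try apply continuity_2d_pt_const; auto. }
  intros [A1 A2 A3 A4 A5 A6] [B1 B2 B3 B4 B5 B6]. constructor; auto.
  - intros t Ht. apply derivative_on_plus; apply derivative_on_scal; auto.
  - intros t Ht. apply derivative_on_ext with (3 := derivative_on_plus _ _ _ _ _ _
      (derivative_on_scal _ _ a _ _ (A2 t Ht)) (derivative_on_scal _ _ b _ _ (B2 t Ht))).
    + intros; unfold Re, Im; simpl; ring.
    + intros; unfold Re, Im; simpl; ring.
  - intros y s t Hy Hs Hst Ht.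
    replace (a * v y t + b * u y t - (a * v y s + b * u y s)) with
      (a * (v y t - v y s) + b * (u y t - u y s)) by ring.
    apply (is_RInt_plus (V := R_NormedModule) (fun t => a * vt y t) (fun t => b * ut y t)
      s t (a * (v y t - v y s)) (b * (u y t - u y s)));
      apply (is_RInt_scal (V := R_NormedModule)); auto.
Qed.

Lemma real_solution_eq L p q w tau T v vy vt v' vy' vt' :
  (forall y t, v y t = v' y t) -> (forall y t, vy y t = vy' y t) -> (forall y t, vt y t = vt' y t) ->
  real_solution L p q w tau T v vy vt -> real_solution L p q w tau T v' vy' vt'.
Proof.
  intros E1 E2 E3.
  replace v' with v by (do 2 (apply functional_extensionality; intro); auto).
  replace vy' with vy by (do 2 (apply functional_extensionality; intro); auto).
  replace vt' with vt by (do 2 (apply functional_extensionality; intro); auto). trivial.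
Qed.

Lemma complex_solution_lin L p q w tau T c v vy vt u uy ut :
  complex_solution L p q w tau T v vy vt -> complex_solution L p q w tau T u uy ut ->
  complex_solution L p q w tau T (fun y t => c * v y t + u y t)%C
    (fun y t => c * vy y t + uy y t)%C (fun y t => c * vt y t + ut y t)%C.
Proof.
  intros [A1 A2] [B1 B2]. split.
  - assert (Z := real_solution_lin _ _ _ _ _ _ 1 _ _ _ 1 _ _ _
     (real_solution_lin _ _ _ _ _ _ (Re c) _ _ _ (- Im c) _ _ _ A1 A2) B1).
    apply real_solution_eq with (4 := Z); intros; unfold Re, Im; simpl; ring.
  - assert (Z := real_solution_lin _ _ _ _ _ _ 1 _ _ _ 1 _ _ _
     (real_solution_lin _ _ _ _ _ _ (Re c) _ _ _ (Im c) _ _ _ A2 A1) B2).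
    apply real_solution_eq with (4 := Z); intros; unfold Re, Im; simpl; ring.
Qed.

(** C X = - mu X in divergence form. *)
Record mode (L : R) (p q w : R -> R) (mu : C) (X X' : R -> C) : Prop := {
  mode_deriv : cdOn (Icc 0 L) X X';
  mode_eq : cdOn (Icc 0 L) (fun y => RtoC (p y) * X' y)%C
    (fun y => RtoC (w y) * (- mu * X y) + RtoC (q y) * X y)%C
}.

Lemma cderivative_on_rmult a b r r' f f' : dOn (Icc a b) r r' -> cdOn (Icc a b) f f' ->
  cdOn (Icc a b) (fun y => RtoC (r y) * f y)%C (fun y => RtoC (r' y) * f y + RtoC (r y) * f' y)%C.
Proof.
  intros Hr H. apply derivative_on_C in H. destruct H as [H1 H2]. apply derivative_on_C. split.
  - apply derivative_on_ext with (3 := derivative_on_mult _ _ _ _ _ _ Hr H1); intros; unfold Re, Im; simpl; ring.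
  - apply derivative_on_ext with (3 := derivative_on_mult _ _ _ _ _ _ Hr H2); intros; unfold Re, Im; simpl; ring.
Qed.

(** X' is the quotient of p X' and p, which are both differentiable. *)
Lemma mode_second_derivative L p p' q w w' mu X X' : 
  admissible_coefficients L p p' q w w' -> mode L p q w mu X X' ->
  cdOn (Icc 0 L) X' (fun y => RtoC (/ p y) *
    ((RtoC (w y) * (- mu * X y) + RtoC (q y) * X y) - RtoC (p' y) * X' y))%C.
Proof.
  intros Hc [HX HX'].
  assert (P0 : forall y, 0 <= y <= L -> p y <> 0).
  { intros y Hy. apply Rgt_not_eq. now apply (coeff_p_pos _ _ _ _ _ _ Hc). }
  assert (Hp := derivative_on_inv 0 L p p' P0 (coeff_p_deriv _ _ _ _ _ _ Hc)).
  apply cderivative_on_ext with (3 := cderivative_on_rmult _ _ _ _ _ _ Hp HX').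
  - intros y Hy. simpl. rewrite Cmult_assoc, <- RtoC_mult, Rinv_l by auto. ring.
  - intros y Hy. simpl. apply C_ext; simpl; field; auto.
Qed.

Lemma mode_solution L p p' q w w' mu X X' tau T : 0 < L ->
  admissible_coefficients L p p' q w w' -> mode L p q w mu X X' ->
  complex_solution L p q w tau T (fun y t => expn mu t * X (clamp 0 L y))%C
    (fun y t => expn mu t * X' (clamp 0 L y))%C (fun y t => - mu * expn mu t * X (clamp 0 L y))%C.
Proof.
  intros HL Hc Hm. assert (HX'' := mode_second_derivative _ _ _ _ _ _ _ _ _ Hc Hm).
  destruct Hm as [HX HX'].
  assert (L0 : 0 <= L) by lra.
  assert (CX := ccontinuous2_space L X X' L0 HX).
  assert (CE := ccontinuous2_expn mu).
  assert (Cv := ccontinuous2_mult _ _ CE CX).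
  assert (Cvt := ccontinuous2_mult _ _ (ccontinuous2_const (- mu)) Cv).
  assert (Hy : forall t, cdOn (Icc 0 L) (fun y => expn mu t * X (clamp 0 L y))%C
      (fun y => expn mu t * X' (clamp 0 L y))%C).
  { intros t. apply cderivative_on_ext with (3 := cderivative_on_scal _ _ (expn mu t) _ _ HX);
      intros y Dy; now rewrite clamp_id. }
  assert (Hp : forall t, cdOn (Icc 0 L) (fun y => RtoC (p y) * (expn mu t * X' (clamp 0 L y)))%C
      (fun y => RtoC (w y) * (- mu * expn mu t * X (clamp 0 L y)) + RtoC (q y) * (expn mu t * X (clamp 0 L y)))%C).
  { intros t. apply cderivative_on_ext with (3 := cderivative_on_scal _ _ (expn mu t) _ _ HX');
      intros y Dy; simpl; rewrite clamp_id by trivial; ring. }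
  assert (Ht : forall y t, is_Cderive (fun t => expn mu t * X (clamp 0 L y))%C t
      (- mu * expn mu t * X (clamp 0 L y))%C).
  { intros y t. replace (- mu * expn mu t * X (clamp 0 L y))%C
      with (X (clamp 0 L y) * (- mu * expn mu t))%C by ring.
    replace (fun t => expn mu t * X (clamp 0 L y))%C with (fun t => X (clamp 0 L y) * expn mu t)%C
      by (apply functional_extensionality; intro; ring).
    apply is_Cderive_scal, expn_derive. }
  assert (Cvy := ccontinuous2_mult _ _ CE (ccontinuous2_space L _ _ L0 HX'')).
  assert (Cvt' : ccontinuous2 (fun y t => - mu * expn mu t * X (clamp 0 L y))%C).
  { replace (fun y t => - mu * expn mu t * X (clamp 0 L y))%C
      with (fun y t => - mu * (expn mu t * X (clamp 0 L y)))%C; trivial.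
    do 2 (apply functional_extensionality; intro). ring. }
  split; constructor; try apply Cv; try apply Cvy; try apply Cvt'.
  - intros t _. apply (proj1 (derivative_on_C _ _ _) (Hy t)).
  - intros t _. apply derivative_on_ext with (3 := proj1 (proj1 (derivative_on_C _ _ _) (Hp t)));
      intros; unfold Re, Im; simpl; ring.
  - intros y s t _ _ _ _.
    apply (is_RInt_derive (V := R_CompleteNormedModule) (fun t => Re (expn mu t * X (clamp 0 L y))%C)).
    + intros x _. apply (Ht y x).
    + intros x _. apply (continuous2_slice (fun y t => Re (- mu * expn mu t * X (clamp 0 L y))%C) y x). apply Cvt'.
  - intros t _. apply (proj1 (derivative_on_C _ _ _) (Hy t)).
  - intros t _. apply derivative_on_ext with (3 := proj2 (proj1 (derivative_on_C _ _ _) (Hp t)));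
      intros; unfold Re, Im; simpl; ring.
  - intros y s t _ _ _ _.
    apply (is_RInt_derive (V := R_CompleteNormedModule) (fun t => Im (expn mu t * X (clamp 0 L y))%C)).
    + intros x _. apply (Ht y x).
    + intros x _. apply (continuous2_slice (fun y t => Im (- mu * expn mu t * X (clamp 0 L y))%C) y x). apply Cvt'.
Qed.

Lemma ccontinuous2_continuous_on (D : R * R -> Prop) F (u : R * R -> C) : ccontinuous2 F ->
  (forall z, D z -> F (fst z) (snd z) = u z) -> continuous_on D u.
Proof.
  intros [F1 F2] E z Dz Q [eps HQ].
  destruct z as [y t].
  destruct (F1 y t eps) as [d1 H1]. destruct (F2 y t eps) as [d2 H2].
  exists (mkposreal _ (Rmin_pos _ _ (cond_pos d1) (cond_pos d2))).
  intros [y' t'] [By Bt] Dz'. simpl in By, Bt.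
  assert (A1 : Rabs (y' - y) < Rmin d1 d2) by exact By.
  assert (A2 : Rabs (t' - t) < Rmin d1 d2) by exact Bt.
  assert (M1 := Rmin_l d1 d2). assert (M2 := Rmin_r d1 d2).
  apply HQ. rewrite <- (E _ Dz), <- (E _ Dz'). simpl.
  split; [apply H1; lra|apply H2; lra].
Qed.

Lemma continuous_on_clamp a b c d (D : R * R -> Prop) (u : R -> R -> C) : a <= b -> c <= d ->
  (forall y t, a <= y <= b -> c <= t <= d -> D (y, t)) ->
  continuous_on D (fun z => u (fst z) (snd z)) ->
  ccontinuous2 (fun y t => u (clamp a b y) (clamp c d t)).
Proof.
  intros ab cd HD Hu.
  assert (K : forall y t (eps : posreal), exists de : posreal, forall y' t',
    Rabs (y' - y) < de -> Rabs (t' - t) < de ->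
    Rabs (Re (u (clamp a b y') (clamp c d t')) - Re (u (clamp a b y) (clamp c d t))) < eps /\
    Rabs (Im (u (clamp a b y') (clamp c d t')) - Im (u (clamp a b y) (clamp c d t))) < eps).
  { intros y t eps.
    destruct (Hu (clamp a b y, clamp c d t) (HD _ _ (clamp_in a b y ab) (clamp_in c d t cd))
      (fun z : C => Rabs (Re z - Re (u (clamp a b y) (clamp c d t))) < eps /\
         Rabs (Im z - Im (u (clamp a b y) (clamp c d t))) < eps)) as [de Hde].
    - exists eps. intros z [Hz1 Hz2]. split; trivial.
    - exists de. intros y' t' Hy Ht. apply (Hde (clamp a b y', clamp c d t')).
      + split; [apply Rle_lt_trans with (2 := Hy)|apply Rle_lt_trans with (2 := Ht)];
          apply clamp_lipschitz.
      + apply HD; now apply clamp_in. }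
  split; intros y t eps; destruct (K y t eps) as [de Hde]; exists de; intros y' t' Hy Ht; now apply Hde.
Qed.

(** * Combinations of modes *)

Inductive combination (mu : nat -> C) (Xp Xm : nat -> R -> C) : (R -> R -> C) -> Prop :=
| combination_nil : combination mu Xp Xm (fun _ _ => RtoC 0)
| combination_plus : forall n c v, combination mu Xp Xm v ->
    combination mu Xp Xm (fun y t => c * (expn (mu n) t * Xp n y) + v y t)%C
| combination_minus : forall n c v, combination mu Xp Xm v ->
    combination mu Xp Xm (fun y t => c * (expn (mu n) t * Xm n y) + v y t)%C.

Lemma avg_plus a v u y t : continuous2 v -> continuous2 u ->
  avg a (fun y t => v y t + u y t) y t = avg a v y t + avg a u y t.
Proof.
  intros Hv Hu. unfold avg.
  rewrite (RInt_plus (V := R_CompleteNormedModule) (fun r => v y (t - r)) (fun r => u y (t - r)))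
    by now apply ex_RInt_shift.
  unfold plus; simpl. ring.
Qed.

(** This is what keeps the averaged approximant in the span of the system. *)
Lemma avg_expn a mu : exists k, forall z y t,
  avg a (fun _ t => Re (z * expn mu t)%C) y t = Re (k * (z * expn mu t))%C /\
  avg a (fun _ t => Im (z * expn mu t)%C) y t = Im (k * (z * expn mu t))%C.
Proof.
  exists (/ a * RInt (fun r => Re (expn mu (- r))) 0 a, / a * RInt (fun r => Im (expn mu (- r))) 0 a).
  intros z y t.
  assert (E : forall r, expn mu (t - r) = (expn mu t * expn mu (- r))%C).
  { intros r. unfold expn. rewrite <- Cexp_plus. f_equal. unfold Rminus. rewrite RtoC_plus. ring. }
  destruct (ccontinuous2_expn mu) as [C1 C2].
  assert (I1 : ex_RInt (fun r => Re (expn mu (- r))) 0 a).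
  { apply ex_RInt_ext with (fun r => Re (expn mu (0 - r))); [intros; now rewrite Rminus_0_l|].
    apply (ex_RInt_shift (fun _ t => Re (expn mu t)) 0 0 0 a C1). }
  assert (I2 : ex_RInt (fun r => Im (expn mu (- r))) 0 a).
  { apply ex_RInt_ext with (fun r => Im (expn mu (0 - r))); [intros; now rewrite Rminus_0_l|].
    apply (ex_RInt_shift (fun _ t => Im (expn mu t)) 0 0 0 a C2). }
  set (w := (z * expn mu t)%C).
  assert (J : forall c d, RInt (fun r => c * Re (expn mu (- r)) + d * Im (expn mu (- r))) 0 a =
    c * RInt (fun r => Re (expn mu (- r))) 0 a + d * RInt (fun r => Im (expn mu (- r))) 0 a).
  { intros c d.
    rewrite (RInt_plus (V := R_CompleteNormedModule) (fun r => c * Re (expn mu (- r))) (fun r => d * Im (expn mu (- r))));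
      try (apply (ex_RInt_scal (V := R_NormedModule)); trivial).
    rewrite (RInt_scal (V := R_CompleteNormedModule) (fun r => Re (expn mu (- r)))) by trivial.
    rewrite (RInt_scal (V := R_CompleteNormedModule) (fun r => Im (expn mu (- r)))) by trivial.
    reflexivity. }
  unfold avg. split.
  - rewrite (RInt_ext _ (fun r => Re w * Re (expn mu (- r)) + - Im w * Im (expn mu (- r)))).
    + rewrite J. unfold Re, Im; simpl. ring.
    + intros r _. rewrite E, Cmult_assoc. fold w. unfold Re, Im; simpl. ring.
  - rewrite (RInt_ext _ (fun r => Im w * Re (expn mu (- r)) + Re w * Im (expn mu (- r)))).
    + rewrite J. unfold Re, Im; simpl. ring.
    + intros r _. rewrite E, Cmult_assoc. fold w. unfold Re, Im; simpl. ring.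
Qed.

Lemma ccontinuous2_term (mu : nat -> C) n c X : ccontinuous2 (fun y _ => X y) ->
  ccontinuous2 (fun y t => c * (expn (mu n) t * X y))%C.
Proof.
  intros H. apply (ccontinuous2_mult (fun _ _ => c)); [apply ccontinuous2_const|].
  apply (ccontinuous2_mult (fun _ t => expn (mu n) t) (fun y _ => X y)); trivial. apply ccontinuous2_expn.
Qed.

Lemma combination_continuous (mu : nat -> C) (Xp Xm : nat -> R -> C) v :
  (forall n, ccontinuous2 (fun y _ => Xp n y)) -> (forall n, ccontinuous2 (fun y _ => Xm n y)) ->
  combination mu Xp Xm v -> ccontinuous2 v.
Proof.
  intros Cp Cm. induction 1 as [|n c v H IH|n c v H IH]; [apply ccontinuous2_const| |];
    apply ccontinuous2_plus; trivial; now apply ccontinuous2_term.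
Qed.

Lemma combination_avg (mu : nat -> C) (Xp Xm : nat -> R -> C) a v :
  (forall n, ccontinuous2 (fun y _ => Xp n y)) -> (forall n, ccontinuous2 (fun y _ => Xm n y)) ->
  combination mu Xp Xm v -> exists v', combination mu Xp Xm v' /\
  forall y t, avg a (fun y t => Re (v y t)) y t = Re (v' y t) /\
              avg a (fun y t => Im (v y t)) y t = Im (v' y t).
Proof.
  intros Cp Cm.
  assert (K : forall n c X, ccontinuous2 (fun y _ => X y) -> forall v v', ccontinuous2 v ->
    (forall y t, avg a (fun y t => Re (v y t)) y t = Re (v' y t) /\
              avg a (fun y t => Im (v y t)) y t = Im (v' y t)) ->
    exists c', forall y t,
      avg a (fun y t => Re (c * (expn (mu n) t * X y) + v y t)%C) y t =
        Re (c' * (expn (mu n) t * X y) + v' y t)%C /\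
      avg a (fun y t => Im (c * (expn (mu n) t * X y) + v y t)%C) y t =
        Im (c' * (expn (mu n) t * X y) + v' y t)%C).
  { intros n c X CX v0 v' Cv E. destruct (avg_expn a (mu n)) as [k Hk].
    destruct (ccontinuous2_term mu n c X CX) as [T1 T2].
    exists (k * c)%C. intros y t. destruct (E y t) as [E1 E2].
    destruct (Hk (c * X y)%C y t) as [K1 K2].
    split.
    - change (avg a (fun y t => Re (c * (expn (mu n) t * X y))%C + Re (v0 y t)) y t =
        Re (k * c * (expn (mu n) t * X y))%C + Re (v' y t)).
      rewrite avg_plus by (trivial; apply Cv). rewrite E1. f_equal.
      replace (k * c * (expn (mu n) t * X y))%C with (k * (c * X y * expn (mu n) t))%C by ring.
      rewrite <- K1. unfold avg. f_equal. apply RInt_ext. intros r _. f_equal. ring.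
    - change (avg a (fun y t => Im (c * (expn (mu n) t * X y))%C + Im (v0 y t)) y t =
        Im (k * c * (expn (mu n) t * X y))%C + Im (v' y t)).
      rewrite avg_plus by (trivial; apply Cv). rewrite E2. f_equal.
      replace (k * c * (expn (mu n) t * X y))%C with (k * (c * X y * expn (mu n) t))%C by ring.
      rewrite <- K2. unfold avg. f_equal. apply RInt_ext. intros r _. f_equal. ring. }
  induction 1 as [|n c v H [v' [IH IE]]|n c v H [v' [IH IE]]].
  - exists (fun _ _ => RtoC 0). split; [constructor|]. intros y t. unfold avg. simpl.
    rewrite RInt_const. unfold scal; simpl; unfold mult; simpl. split; ring.
  - destruct (K n c (Xp n) (Cp n) v v' (combination_continuous mu Xp Xm v Cp Cm H) IE) as [c' Hc'].
    exists (fun y t => c' * (expn (mu n) t * Xp n y) + v' y t)%C. split; trivial. now constructor.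
  - destruct (K n c (Xm n) (Cm n) v v' (combination_continuous mu Xp Xm v Cp Cm H) IE) as [c' Hc'].
    exists (fun y t => c' * (expn (mu n) t * Xm n y) + v' y t)%C. split; trivial. now constructor.
Qed.

Lemma combination_avgs (mu : nat -> C) (Xp Xm : nat -> R -> C) l v :
  (forall n, ccontinuous2 (fun y _ => Xp n y)) -> (forall n, ccontinuous2 (fun y _ => Xm n y)) ->
  combination mu Xp Xm v -> exists v', combination mu Xp Xm v' /\
  forall y t, avgs l (fun y t => Re (v y t)) y t = Re (v' y t) /\
              avgs l (fun y t => Im (v y t)) y t = Im (v' y t).
Proof.
  intros Cp Cm Hv. induction l as [|a l [v1 [H1 E1]]]; [now exists v|].
  destruct (combination_avg mu Xp Xm a v1 Cp Cm H1) as [v2 [H2 E2]]. exists v2. split; trivial.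
  intros y t. destruct (E2 y t) as [<- <-].
  cbn [avgs]. unfold avg. split; f_equal; apply RInt_ext; intros r _; apply E1.
Qed.

Lemma combination_sum (mu : nat -> C) (Xp Xm : nat -> R -> C) v : combination mu Xp Xm v -> exists N (ap am : nat -> C),
  (forall n, (N < n)%nat -> ap n = RtoC 0 /\ am n = RtoC 0) /\
  forall y t, v y t = sum_n (fun n => ap n * (expn (mu n) t * Xp n y) + am n * (expn (mu n) t * Xm n y))%C N.
Proof.
  assert (Ext : forall (b : nat -> C) N M, (forall n, (N < n)%nat -> b n = RtoC 0) -> (N <= M)%nat ->
    sum_n b M = sum_n b N).
  { intros b N M Hb HM. induction HM as [|M HM IH]; trivial.
    rewrite sum_Sn, IH, Hb by lia. apply Cplus_0_r. }
  assert (Sing : forall (b : nat -> C) n M, (n <= M)%nat -> (forall k, k <> n -> b k = RtoC 0) ->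
    sum_n b M = b n).
  { intros b n M. induction M as [|M IH]; intros HM Hb.
    - rewrite sum_O. f_equal. lia.
    - rewrite sum_Sn. destruct (Nat.eq_dec n (S M)) as [->|ne].
      + assert (Z : forall j, (j <= M)%nat -> sum_n b j = RtoC 0).
        { induction j as [|j IHj]; intros Hj; [rewrite sum_O; apply Hb; lia|].
          rewrite sum_Sn, IHj, Hb by lia. apply Cplus_0_r. }
        rewrite Z by lia. apply Cplus_0_l.
      + rewrite IH, (Hb (S M)) by (trivial; lia). apply Cplus_0_r. }
  induction 1 as [|n c v H [N [ap [am [H0 E]]]]|n c v H [N [ap [am [H0 E]]]]].
  - exists O, (fun _ => RtoC 0), (fun _ => RtoC 0). split; [tauto|]. intros y t. rewrite sum_O. ring.
  - exists (max N n), (fun k => (if Nat.eq_dec k n then c else 0) + ap k)%C, am. split.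
    + intros k Hk. destruct (H0 k ltac:(lia)) as [-> ->]. destruct Nat.eq_dec; [lia|].
      split; [apply Cplus_0_l|trivial].
    + intros y t. rewrite E.
      rewrite <- (Ext _ N (max N n)) by
        (try (intros k Hk; destruct (H0 k Hk) as [-> ->]; ring); lia).
      set (b := fun k => ((if Nat.eq_dec k n then c else 0) * (expn (mu k) t * Xp k y))%C).
      replace (c * (expn (mu n) t * Xp n y))%C with (sum_n b (max N n)).
      * rewrite <- (sum_n_plus (G := C_AbelianMonoid)). apply sum_n_ext. intros k.
        unfold b. match goal with |- ?x = ?z => change (@eq C x z) end.
          change plus with Cplus. ring.
      * rewrite (Sing b n) by (try (intros k Hk; unfold b; destruct Nat.eq_dec; [tauto|ring]); lia).
        unfold b. destruct Nat.eq_dec; [trivial|tauto].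
  - exists (max N n), ap, (fun k => (if Nat.eq_dec k n then c else 0) + am k)%C. split.
    + intros k Hk. destruct (H0 k ltac:(lia)) as [-> ->]. destruct Nat.eq_dec; [lia|].
      split; [trivial|apply Cplus_0_l].
    + intros y t. rewrite E.
      rewrite <- (Ext _ N (max N n)) by
        (try (intros k Hk; destruct (H0 k Hk) as [-> ->]; ring); lia).
      set (b := fun k => ((if Nat.eq_dec k n then c else 0) * (expn (mu k) t * Xm k y))%C).
      replace (c * (expn (mu n) t * Xm n y))%C with (sum_n b (max N n)).
      * rewrite <- (sum_n_plus (G := C_AbelianMonoid)). apply sum_n_ext. intros k.
        unfold b. match goal with |- ?x = ?z => change (@eq C x z) end.
          change plus with Cplus. ring.
      * rewrite (Sing b n) by (try (intros k Hk; unfold b; destruct Nat.eq_dec; [tauto|ring]); lia).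
        unfold b. destruct Nat.eq_dec; [trivial|tauto].
Qed.

Lemma combination_add (mu : nat -> C) (Xp Xm : nat -> R -> C) u v :
  combination mu Xp Xm u -> combination mu Xp Xm v ->
  combination mu Xp Xm (fun y t => 1 * u y t + v y t)%C.
Proof.
  assert (E : forall f g, (forall y t, f y t = g y t) -> combination mu Xp Xm f -> combination mu Xp Xm g).
  { intros f g H. replace g with f; trivial. do 2 (apply functional_extensionality; intro); auto. }
  intros Hu Hv. induction Hu as [|n c u H IH|n c u H IH].
  - apply E with v; trivial. intros; ring.
  - apply E with (fun y t => c * (expn (mu n) t * Xp n y) + (1 * u y t + v y t))%C; [intros; ring|].
    now constructor.
  - apply E with (fun y t => c * (expn (mu n) t * Xm n y) + (1 * u y t + v y t))%C; [intros; ring|].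
    now constructor.
Qed.

(** * Parabolic solutions and transmuted exponentials *)

(** Since w > 0 and the derivative of u(., t) is unique, (p u_y)_y = w u_t + q u,
   which is jointly continuous; composing with the clamps extends everything. *)
Lemma parabolic_complex_solution L p p' q w w' tmax tau u : 0 < L -> 0 < tau -> tau <= tmax ->
  admissible_coefficients L p p' q w w' -> parabolic_solution L tmax p q w u ->
  exists vy vt, complex_solution L p q w tau tmax
    (fun y t => u (clamp 0 L y) (clamp tau tmax t)) vy vt.
Proof.
  intros HL Htau Htt Hc [ut [[uy [uyy [H1 [_ [H3 [C0 [C1 [_ C3]]]]]]]] HC]].
  exists (fun y t => uy (clamp 0 L y) (clamp tau tmax t)), (fun y t => ut (clamp 0 L y) (clamp tau tmax t)).
  assert (L0 : 0 <= L) by lra.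
  assert (Dt : forall t, tau <= t <= tmax -> Ioc 0 tmax t) by (unfold Ioc; intros; lra).
  assert (HD : forall y t, 0 <= y <= L -> tau <= t <= tmax -> strip L tmax (y, t)).
  { intros y t Hy Ht. split; [exact Hy|now apply Dt]. }
  assert (K0 := continuous_on_clamp 0 L tau tmax _ u L0 Htt HD C0).
  assert (K1 := continuous_on_clamp 0 L tau tmax _ uy L0 Htt HD C1).
  assert (K3 := continuous_on_clamp 0 L tau tmax _ ut L0 Htt HD C3).
  assert (Ey : forall t, tau <= t <= tmax ->
    cdOn (Icc 0 L) (fun y => u (clamp 0 L y) (clamp tau tmax t)) (fun y => uy (clamp 0 L y) (clamp tau tmax t))).
  { intros t Ht. rewrite (clamp_id tau tmax t Ht).
    apply cderivative_on_ext with (3 := H1 t (Dt t Ht)); intros y Hy; now rewrite clamp_id. }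
  assert (Ep : forall t, tau <= t <= tmax ->
    cdOn (Icc 0 L) (fun y => RtoC (p y) * uy (clamp 0 L y) (clamp tau tmax t))%C
      (fun y => RtoC (w y) * ut (clamp 0 L y) (clamp tau tmax t) +
                RtoC (q y) * u (clamp 0 L y) (clamp tau tmax t))%C).
  { intros t Ht. rewrite (clamp_id tau tmax t Ht).
    destruct (HC t (Dt t Ht)) as [v [[u1 [D1 D2]] Hv]].
    apply cderivative_on_ext with (3 := D2); intros y Hy; rewrite !clamp_id by trivial.
    - f_equal. exact (cderivative_on_unique 0 L _ _ _ HL D1 (H1 t (Dt t Ht)) y Hy).
    - rewrite (Hv y Hy), Cmult_assoc, <- RtoC_mult, Rinv_r.
      + ring.
      + apply Rgt_not_eq. now apply (coeff_w_pos _ _ _ _ _ _ Hc). }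
  assert (Et : forall y, Icc 0 L y ->
    dOn (Icc tau tmax) (fun t => Re (u y t)) (fun t => Re (ut y t)) /\
    dOn (Icc tau tmax) (fun t => Im (u y t)) (fun t => Im (ut y t))).
  { intros y Hy. destruct (proj1 (derivative_on_C _ _ _) (H3 y Hy)) as [A1 A2].
    split; intros t Ht; apply is_derive_in_subset with (Ioc 0 tmax); auto. }
  assert (FTC : forall (g g' : R -> R) s t, dOn (Icc tau tmax) g g' ->
    (forall r, continuous (fun r => g' (clamp tau tmax r)) r) -> tau <= s -> s <= t -> t <= tmax ->
    is_RInt (fun r => g' (clamp tau tmax r)) s t (g (clamp tau tmax t) - g (clamp tau tmax s))).
  { intros g g' s t Hg Cg Hs Hst Ht. rewrite !clamp_id by lra.
    rewrite <- (affine_ext_id tau tmax g g' t), <- (affine_ext_id tau tmax g g' s) by lra.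
    apply (is_RInt_derive (V := R_CompleteNormedModule) (affine_ext tau tmax g g')).
    - intros x Hx. rewrite Rmin_left, Rmax_right in Hx by lra.
      rewrite (clamp_id tau tmax x) by lra. apply affine_ext_derive; trivial. lra.
    - intros x _. apply Cg. }
  split; constructor; try apply K0; try apply K1; try apply K3.
  - intros t Ht. apply (proj1 (derivative_on_C _ _ _) (Ey t Ht)).
  - intros t Ht. apply derivative_on_ext with (3 := proj1 (proj1 (derivative_on_C _ _ _) (Ep t Ht)));
      intros; unfold Re, Im; simpl; ring.
  - intros y s t Hy Hs Hst Ht. rewrite (clamp_id 0 L y Hy).
    apply (FTC (fun t => Re (u y t)) (fun t => Re (ut y t))); trivial.
    + apply Et. exact Hy.
    + intros r. rewrite <- (clamp_id 0 L y Hy). exact (continuous2_slice _ y r (proj1 K3)).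
  - intros t Ht. apply (proj1 (derivative_on_C _ _ _) (Ey t Ht)).
  - intros t Ht. apply derivative_on_ext with (3 := proj2 (proj1 (derivative_on_C _ _ _) (Ep t Ht)));
      intros; unfold Re, Im; simpl; ring.
  - intros y s t Hy Hs Hst Ht. rewrite (clamp_id 0 L y Hy).
    apply (FTC (fun t => Im (u y t)) (fun t => Im (ut y t))); trivial.
    + apply Et. exact Hy.
    + intros r. rewrite <- (clamp_id 0 L y Hy). exact (continuous2_slice _ y r (proj2 K3)).
Qed.

Lemma ccontinuous2_real r : continuous2 r -> ccontinuous2 (fun y t => RtoC (r y t)).
Proof. intros H. split; [exact H|]. intros y t. exact (continuity_2d_pt_const y t 0). Qed.

(** The second derivative in y is continuous because it is an explicit
   expression in X, X' and the coefficients. *)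
Lemma mode_parabolic L p p' q w w' mu X X' tmax u : 0 < L ->
  admissible_coefficients L p p' q w w' -> mode L p q w mu X X' ->
  (forall y t, 0 <= y <= L -> u y t = (expn mu t * X y)%C) ->
  parabolic_solution L tmax p q w u.
Proof.
  intros HL Hc Hm Hu. assert (HX'' := mode_second_derivative _ _ _ _ _ _ _ _ _ Hc Hm).
  destruct Hm as [HX HX'].
  assert (L0 : 0 <= L) by lra.
  set (X'' := fun y => (RtoC (/ p y) * ((RtoC (w y) * (- mu * X y) + RtoC (q y) * X y) - RtoC (p' y) * X' y))%C) in *.
  assert (CX := ccontinuous2_space L X X' L0 HX).
  assert (CX' := ccontinuous2_space L X' X'' L0 HX'').
  assert (P0 : forall y, 0 <= y <= L -> p y <> 0).
  { intros y Hy. apply Rgt_not_eq. now apply (coeff_p_pos _ _ _ _ _ _ Hc). }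
  assert (CX'' : ccontinuous2 (fun y _ => X'' (clamp 0 L y))).
  { apply (ccontinuous2_mult (fun y _ => RtoC (/ p (clamp 0 L y)))).
    - apply ccontinuous2_real. apply (continuous2_of_derivative L (fun y => / p y) _ L0
        (derivative_on_inv 0 L p p' P0 (coeff_p_deriv _ _ _ _ _ _ Hc))).
    - assert (Z : ccontinuous2 (fun y t => (RtoC (w (clamp 0 L y)) * (- mu * X (clamp 0 L y)) +
        RtoC (q (clamp 0 L y)) * X (clamp 0 L y)) + (- (1)) * (RtoC (p' (clamp 0 L y)) * X' (clamp 0 L y)))%C).
      { apply (ccontinuous2_plus (fun y _ => (RtoC (w (clamp 0 L y)) * (- mu * X (clamp 0 L y)) +
            RtoC (q (clamp 0 L y)) * X (clamp 0 L y))%C)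
          (fun y _ => ((- (1)) * (RtoC (p' (clamp 0 L y)) * X' (clamp 0 L y)))%C)).
        - apply (ccontinuous2_plus (fun y _ => (RtoC (w (clamp 0 L y)) * (- mu * X (clamp 0 L y)))%C)
            (fun y _ => (RtoC (q (clamp 0 L y)) * X (clamp 0 L y))%C)).
          + apply (ccontinuous2_mult (fun y _ => RtoC (w (clamp 0 L y))) (fun y _ => (- mu * X (clamp 0 L y))%C)).
            * apply ccontinuous2_real. apply (continuous2_of_derivative L w w' L0 (coeff_w_deriv _ _ _ _ _ _ Hc)).
            * apply (ccontinuous2_mult (fun _ _ => (- mu)%C) _ (ccontinuous2_const _) CX).
          + apply (ccontinuous2_mult (fun y _ => RtoC (q (clamp 0 L y)))); [|exact CX].
            apply ccontinuous2_real. apply (continuous2_of_continuous_on L q L0 (coeff_q_cont _ _ _ _ _ _ Hc)).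
        - apply (ccontinuous2_mult (fun _ _ => (- (1))%C)); [apply ccontinuous2_const|].
          apply (ccontinuous2_mult (fun y _ => RtoC (p' (clamp 0 L y)))); [|exact CX'].
          apply ccontinuous2_real. apply (continuous2_of_continuous_on L p' L0 (coeff_p'_cont _ _ _ _ _ _ Hc)). }
      match goal with |- ccontinuous2 ?f => match type of Z with ccontinuous2 ?g => replace f with g end end; trivial.
      do 2 (apply functional_extensionality; intro). ring. }
  assert (CE := ccontinuous2_expn mu).
  assert (Sy : forall z, strip L tmax z -> 0 <= fst z <= L) by (intros z [Hz _]; exact Hz).
  assert (Dy : forall t, cdOn (Icc 0 L) (fun y => u y t) (fun y => expn mu t * X' y)%C).
  { intros t. apply cderivative_on_ext with (3 := cderivative_on_scal _ _ (expn mu t) _ _ HX);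
      intros y Hy; [now rewrite Hu|trivial]. }
  exists (fun y t => - mu * (expn mu t * X y))%C. split.
  - exists (fun y t => expn mu t * X' y)%C, (fun y t => expn mu t * X'' y)%C.
    split; [|split; [|split; [|split; [|split; [|split]]]]].
    + intros t _. apply Dy.
    + intros t _. now apply cderivative_on_scal.
    + intros y Hy t Ht.
      replace (u y) with (fun t => X y * expn mu t)%C
        by (apply functional_extensionality; intro; rewrite Hu by exact Hy; ring).
      apply is_Cderive_in; trivial.
      replace (- mu * (expn mu t * X y))%C with (X y * (- mu * expn mu t))%C by ring.
      apply is_Cderive_scal, expn_derive.
    + apply ccontinuous2_continuous_on with (1 := ccontinuous2_mult _ _ CE CX).
      intros z Hz. simpl. rewrite clamp_id, Hu by auto. trivial.
    + apply ccontinuous2_continuous_on with (1 := ccontinuous2_mult _ _ CE CX').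
      intros z Hz. simpl. rewrite clamp_id by auto. trivial.
    + apply ccontinuous2_continuous_on with (1 := ccontinuous2_mult _ _ CE CX'').
      intros z Hz. simpl. rewrite clamp_id by auto. trivial.
    + apply ccontinuous2_continuous_on with
        (1 := ccontinuous2_mult _ _ (ccontinuous2_const (- mu)) (ccontinuous2_mult _ _ CE CX)).
      intros z Hz. simpl. rewrite clamp_id by auto. trivial.
  - intros t Ht. exists (fun y => expn mu t * (RtoC (w y) * (- mu * X y) + RtoC (q y) * X y))%C. split.
    + exists (fun y => expn mu t * X' y)%C. split; [apply Dy|].
      apply cderivative_on_ext with (3 := cderivative_on_scal _ _ (expn mu t) _ _ HX');
        intros y Hy; simpl; ring.
    + intros y Hy. rewrite Hu by trivial.
      assert (W0 : w y <> 0) by (apply Rgt_not_eq; now apply (coeff_w_pos _ _ _ _ _ _ Hc)).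
      replace (expn mu t * (RtoC (w y) * (- mu * X y) + RtoC (q y) * X y) - RtoC (q y) * (expn mu t * X y))%C
       with (RtoC (w y) * (- mu * (expn mu t * X y)))%C by ring.
      rewrite (Cmult_assoc (RtoC (/ w y))), <- RtoC_mult, Rinv_l by trivial. ring.
Qed.

Lemma continuous_on_Cderive (D : R -> Prop) (h : R -> C) :
  (forall x, exists l, is_Cderive h x l) -> continuous_on D h.
Proof.
  intros H x Dx P [eps HP]. destruct (H x) as [l [H1 H2]].
  assert (C1 : continuous (fun s => Re (h s)) x)
    by (apply (ex_derive_continuous (K := R_AbsRing) (V := R_NormedModule)); now exists (Re l)).
  assert (C2 : continuous (fun s => Im (h s)) x)
    by (apply (ex_derive_continuous (K := R_AbsRing) (V := R_NormedModule)); now exists (Im l)).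
  destruct (C1 _ (locally_ball (Re (h x)) eps)) as [d1 K1].
  destruct (C2 _ (locally_ball (Im (h x)) eps)) as [d2 K2].
  exists (mkposreal _ (Rmin_pos _ _ (cond_pos d1) (cond_pos d2))). intros y Hy _.
  assert (Hy' : Rabs (y - x) < Rmin d1 d2) by exact Hy.
  assert (M1 := Rmin_l d1 d2). assert (M2 := Rmin_r d1 d2).
  apply HP. split; [apply K1|apply K2]; red; simpl; unfold AbsRing_ball; simpl;
   (apply Rlt_le_trans with (1 := Hy'); trivial).
Qed.

(** For h = e^(k x) with k^2 = - mu one has h'' = - mu h, so that the
   transmutation property turns into the eigenvalue equation. *)
Lemma transmuted_mode L p p' q w w' f0' T (k mu : C) : 0 < L ->
  admissible_coefficients L p p' q w w' -> transmutation_operator L p q w f0' T ->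
  (k * k)%C = (- mu)%C ->
  let X := T (fun x => Cexp (k * RtoC x)) in
  exists X', mode L p q w mu X X' /\ X 0 = (/ RtoC (rho p w 0))%C /\
    X' 0 = (f0' + k * RtoC (1 / rho p w 0 * sqrt (w 0 / p 0)))%C.
Proof.
  intros HL Hc HT Hk X.
  set (h := fun x => Cexp (k * RtoC x)).
  set (h' := fun x => (k * h x)%C). set (h'' := fun x => (k * h' x)%C).
  set (J := Icc (- lfun p w L) (lfun p w L)).
  assert (Dh : forall x, is_Cderive h x (h' x)) by (intros x; apply is_Cderive_Cexp).
  assert (Dh' : forall x, is_Cderive h' x (h'' x)) by (intros x; apply is_Cderive_scal, Dh).
  assert (Dh'' : forall x, is_Cderive h'' x (k * h'' x)%C) by (intros x; apply is_Cderive_scal, Dh').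
  assert (Ch : continuous_on J h) by (apply continuous_on_Cderive; intros x; eexists; apply Dh).
  destruct (trans_spec _ _ _ _ _ _ HT h h' h'') as [[v [[X' [D1 D2]] Hv]] [H0 H1]].
  - intros x Hx. now apply is_Cderive_in.
  - intros x Hx. now apply is_Cderive_in.
  - apply continuous_on_Cderive; intros x; eexists; apply Dh''.
  - fold h in X. fold X in D1, D2, H0, H1, Hv.
    assert (Hh0 : h 0 = 1%C) by (unfold h; rewrite Cmult_0_r; apply Cexp_0).
    assert (Eh : h'' = (fun x => - mu * h x)%C).
    { apply functional_extensionality; intros x. unfold h'', h'. rewrite Cmult_assoc, Hk. trivial. }
    exists X'. split; [constructor; trivial|split].
    + apply cderivative_on_ext with (3 := D2); [trivial|]. intros y Hy. simpl.
      assert (W0 : w y <> 0) by (apply Rgt_not_eq; now apply (coeff_w_pos _ _ _ _ _ _ Hc)).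
      assert (E := Hv y Hy). rewrite Eh in E.
      rewrite (clo_scal _ _ _ (trans_clo _ _ _ _ _ _ HT) (- mu)%C h Ch y Hy) in E. fold X in E.
      rewrite E, Cmult_assoc, <- RtoC_mult, Rinv_r by trivial. ring.
    + rewrite H0, Hh0. unfold Cdiv. ring.
    + assert (I0 : Icc 0 L 0) by (unfold Icc; lra).
      assert (D10 := D1 0 I0).
      apply is_derive_in_C in D10; trivial. apply is_derive_in_C in H1; trivial.
      replace (f0' + k * RtoC (1 / rho p w 0 * sqrt (w 0 / p 0)))%C with
        (h 0 * f0' + h' 0 * RtoC (1 / rho p w 0 * sqrt (w 0 / p 0)))%C
        by (unfold h'; rewrite Hh0; ring).
      apply C_ext.
      * exact (is_derive_in_unique 0 L _ 0 _ _ HL I0 (proj1 D10) (proj1 H1)).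
      * exact (is_derive_in_unique 0 L _ 0 _ _ HL I0 (proj2 D10) (proj2 H1)).
Qed.

(** * Completeness *)

Lemma complex_solution_zero L p q w tau T :
  complex_solution L p q w tau T (fun _ _ => RtoC 0) (fun _ _ => RtoC 0) (fun _ _ => RtoC 0).
Proof.
  assert (Z : real_solution L p q w tau T (fun _ _ => 0) (fun _ _ => 0) (fun _ _ => 0)).
  { constructor; try (intros y t; apply continuity_2d_pt_const).
    - intros t _. apply derivative_on_const.
    - intros t _. apply derivative_on_ext with (3 := derivative_on_const 0 L 0); intros; ring.
    - intros y s t _ _ _ _. rewrite Rminus_0_r.
      assert (I := is_RInt_const (V := R_NormedModule) s t 0).
      change (scal (t - s) 0) with ((t - s) * 0) in I. now rewrite Rmult_0_r in I. }
  split; exact Z.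
Qed.

(** Prescribing the Cauchy data at y = 0: with X_n^+(0) = X_n^-(0) = r and
   derivatives f0 +- i omega_n c, the value and the slope are adjusted
   independently as soon as omega_n <> 0. *)
Lemma match_cauchy_data L p p' q w w' (omega : nat -> C) (Xp Xm : nat -> R -> C) (r f0 c : C) :
  0 < L -> admissible_coefficients L p p' q w w' ->
  (forall n, exists X', mode L p q w (omega n ^ 2)%C (Xp n) X' /\ Xp n 0 = r /\ X' 0 = (f0 + Ci * omega n * c)%C) ->
  (forall n, exists X', mode L p q w (omega n ^ 2)%C (Xm n) X' /\ Xm n 0 = r /\ X' 0 = (f0 - Ci * omega n * c)%C) ->
  forall (A B : C) G, expsum (fun nu => exists j, nu = (omega j ^ 2)%C /\ omega j <> RtoC 0) G ->
  exists v vy vt, (forall tau T, complex_solution L p q w tau T v vy vt) /\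
    combination (fun n => omega n ^ 2)%C (fun n y => Xp n (clamp 0 L y)) (fun n y => Xm n (clamp 0 L y)) v /\
    forall t, v 0 t = (A * r * G t)%C /\ vy 0 t = ((A * f0 + B * c) * G t)%C.
Proof.
  intros HL Hc Hp Hm A B G HG.
  induction HG as [|nu cc h [j [-> Nj]] Hh [v [vy [vt [Hs [Hv Hd]]]]]].
  - exists (fun _ _ => RtoC 0), (fun _ _ => RtoC 0), (fun _ _ => RtoC 0).
    split; [intros; apply complex_solution_zero|split; [constructor|]]. intros t. split; ring.
  - destruct (Hp j) as [X1 [M1 [V1 S1]]]. destruct (Hm j) as [X2 [M2 [V2 S2]]].
    set (a := (cc * (A / 2 + B / (2 * Ci * omega j)))%C).
    set (b := (cc * (A / 2 - B / (2 * Ci * omega j)))%C).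
    set (mu := (omega j ^ 2)%C) in *.
    exists (fun y t => a * (expn mu t * Xp j (clamp 0 L y)) + (b * (expn mu t * Xm j (clamp 0 L y)) + v y t))%C,
      (fun y t => a * (expn mu t * X1 (clamp 0 L y)) + (b * (expn mu t * X2 (clamp 0 L y)) + vy y t))%C,
      (fun y t => a * (- mu * expn mu t * Xp j (clamp 0 L y)) + (b * (- mu * expn mu t * Xm j (clamp 0 L y)) + vt y t))%C.
    split; [|split].
    + intros tau T. 
      apply (complex_solution_lin _ _ _ _ _ _ a _ _ _ _ _ _ (mode_solution _ _ _ _ _ _ _ _ _ tau T HL Hc M1)).
      apply (complex_solution_lin _ _ _ _ _ _ b _ _ _ _ _ _ (mode_solution _ _ _ _ _ _ _ _ _ tau T HL Hc M2)).
      apply Hs.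
    + apply (combination_plus (fun n => omega n ^ 2)%C (fun n y => Xp n (clamp 0 L y)) (fun n y => Xm n (clamp 0 L y)) j a).
      apply (combination_minus (fun n => omega n ^ 2)%C (fun n y => Xp n (clamp 0 L y)) (fun n y => Xm n (clamp 0 L y)) j b).
      exact Hv.
    + intros t. destruct (Hd t) as [E1 E2]. rewrite (clamp_id 0 L 0) by lra.
      assert (Two : RtoC 2 <> RtoC 0) by (intros E; apply RtoC_inj in E; lra).
      assert (Ni : Ci <> RtoC 0) by (intros E; apply (f_equal Im) in E; simpl in E; lra).
      rewrite E1, E2, V1, V2, S1, S2. unfold a, b. split; field; repeat split; trivial.
Qed.

(** The sets t > 1/(i+1) cover the compact set. *)
Lemma compact_strip_time L tmax Q : compact_set Q -> (forall z, Q z -> strip L tmax z) ->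
  exists delta, 0 < delta /\ forall y t, Q (y, t) -> delta <= t.
Proof.
  intros HQ HS.
  destruct (HQ nat (fun i z => / (INR i + 1) < snd z)) as [s Hs].
  - intros i [y t] Ht. simpl in Ht. exists (mkposreal (t - / (INR i + 1)) ltac:(lra)).
    intros [y' t'] [_ H]. simpl in *. assert (H' : Rabs (t' - t) < t - / (INR i + 1)) by exact H.
    apply Rabs_def2 in H'. lra.
  - intros [y t] Hz. destruct (HS _ Hz) as [_ [Ht _]]. simpl in *.
    destruct (INR_archimed t 1 Ht) as [n Hn]. exists n.
    assert (Z := pos_INR n). apply Rmult_lt_reg_l with (INR n + 1); [lra|]. rewrite Rinv_r by lra. nra.
  - exists (/ (INR (list_max s) + 1)). split.
    + apply Rinv_0_lt_compat. assert (Z := pos_INR (list_max s)). lra.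
    + intros y t Hz. destruct (Hs _ Hz) as [i [Hi Ht]]. simpl in Ht.
      left. apply Rle_lt_trans with (2 := Ht).
      assert (Z := pos_INR i). apply Rinv_le_contravar; [lra|].
      apply Rplus_le_compat_r, le_INR.
      assert (Hl := proj1 (list_max_le s (list_max s)) (le_n _)).
      rewrite List.Forall_forall in Hl. now apply Hl.
Qed.

Lemma Cmod_le_parts z : Cmod z <= Rabs (Re z) + Rabs (Im z).
Proof.
  destruct z as [x y]. replace (x, y) with (RtoC x + Ci * RtoC y)%C by (apply C_ext; simpl; ring).
  apply Rle_trans with (1 := Cmod_triangle _ _).
  rewrite Cmod_mult, !Cmod_R. replace (Cmod Ci) with 1.
  - simpl. replace (x + (0 * y - 1 * 0)) with x by ring. replace (0 + (0 * 0 + 1 * y)) with y by ring. lra.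
  - unfold Cmod, Ci; simpl. replace (0 * (0 * 1) + 1 * (1 * 1)) with 1 by ring. now rewrite sqrt_1.
Qed.

Lemma im_le_Cmod z : Rabs (Im z) <= Cmod z.
Proof. apply Rle_trans with (2 := Rmax_Cmod z). apply Rmax_r. Qed.

(** The combination V of modes whose Cauchy data at y = 0 approximate those of u
   need not be close to u, but by stability its average is close to the average
   of u, hence to u; and the average of V is again a combination of modes. *)
Lemma modes_complete L p p' q w w' f f' (omega : nat -> C) d (Xp Xm : nat -> R -> C) (r f0 c : C) tmax :
  0 < L -> admissible_coefficients L p p' q w w' -> particular_solution L p q w f f' ->
  (forall m n, omega m = omega n -> m = n) ->
  filterlim (fun n => (RtoC (INR n) / omega n ^ 2)%C) eventually (locally (RtoC d)) -> 0 < d ->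
  r <> RtoC 0 -> c <> RtoC 0 ->
  (forall n, exists X', mode L p q w (omega n ^ 2)%C (Xp n) X' /\ Xp n 0 = r /\ X' 0 = (f0 + Ci * omega n * c)%C) ->
  (forall n, exists X', mode L p q w (omega n ^ 2)%C (Xm n) X' /\ Xm n 0 = r /\ X' 0 = (f0 - Ci * omega n * c)%C) ->
  complete_system L tmax p q w (fun n y t => expn (omega n ^ 2)%C t * Xp n y)%C
    (fun n y t => expn (omega n ^ 2)%C t * Xm n y)%C.
Proof.
  intros HL Hc Hf Hinj Hlim Hd Nr Nc Hp Hm u Hu Q HQ HS eps Heps.
  destruct (compact_strip_time L tmax Q HQ HS) as [del [Hdel HQt]].
  set (Yp := fun n y => Xp n (clamp 0 L y)). set (Ym := fun n y => Xm n (clamp 0 L y)).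
  set (mu := fun n => (omega n ^ 2)%C).
  destruct (classic (exists z, Q z)) as [[[y0 t0] Hz]|Hno].
  2:{ exists O, (fun _ => RtoC 0), (fun _ => RtoC 0). intros y t H. exfalso. apply Hno. now exists (y, t). }
  assert (Hdt : del <= tmax).
  { apply Rle_trans with (1 := HQt _ _ Hz). destruct (HS _ Hz) as [_ [_ H]]. exact H. }
  set (tau := del / 2). assert (Htau : 0 < tau) by (unfold tau; lra).
  assert (Htt : tau <= tmax) by (unfold tau; lra).
  assert (L0 : 0 <= L) by lra.
  destruct (parabolic_complex_solution L p p' q w w' tmax tau u HL Htau Htt Hc Hu) as [Uy [Ut HU]].
  set (U := fun y t => u (clamp 0 L y) (clamp tau tmax t)) in *.
  destruct HU as [HU1 HU2].
  assert (CU1 := rs_cv _ _ _ _ _ _ _ _ _ HU1). assert (CU2 := rs_cv _ _ _ _ _ _ _ _ _ HU2).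
  assert (CUy1 := rs_cvy _ _ _ _ _ _ _ _ _ HU1). assert (CUy2 := rs_cvy _ _ _ _ _ _ _ _ _ HU2).
  (* averages of total length s change U by at most eps / 8 *)
  destruct (uniform_continuity_2d _ 0 L 0 tmax (fun x y _ _ => CU1 x y) (mkposreal (eps / 8) ltac:(lra))) as [s1 Hs1].
  destruct (uniform_continuity_2d _ 0 L 0 tmax (fun x y _ _ => CU2 x y) (mkposreal (eps / 8) ltac:(lra))) as [s2 Hs2].
  simpl in Hs1, Hs2.
  set (s := Rmin tau (Rmin (s1 / 2) (s2 / 2))).
  assert (Hs : 0 < s /\ s <= tau /\ s < s1 /\ s < s2).
  { assert (P1 := cond_pos s1). assert (P2 := cond_pos s2).
    assert (Q1 := Rmin_l tau (Rmin (s1 / 2) (s2 / 2))). assert (Q2 := Rmin_r tau (Rmin (s1 / 2) (s2 / 2))).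
    assert (Q3 := Rmin_l (s1 / 2) (s2 / 2)). assert (Q4 := Rmin_r (s1 / 2) (s2 / 2)).
    fold s in Q1, Q2. split; [|lra]. unfold s. repeat apply Rmin_pos; lra. }
  destruct Hs as [Hs0 [Hst [Hs1' Hs2']]].
  destruct (avgs_stability L tmax s p p' q w w' f f' HL Hs0 Hc Hf) as [K [HK Hstab]].
  set (e := eps / (8 * K)). assert (He : 0 < e) by (apply Rdiv_lt_0_compat; lra).
  set (g0 := fun t => (U 0 t / r)%C).
  set (g1 := fun t => ((Uy 0 t - f0 * g0 t) / c)%C).
  assert (CC : forall F : R -> R -> C, ccontinuous2 F -> (forall t, continuous (fun t => Re (F 0 t)) t) /\
     (forall t, continuous (fun t => Im (F 0 t)) t)).
  { intros F [F1 F2]. split; intros t; [apply (continuous2_slice _ 0 t F1)|apply (continuous2_slice _ 0 t F2)]. }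
  assert (CG0 : ccontinuous2 (fun y t => U y t * / r)%C).
  { apply ccontinuous2_mult; [split; trivial|apply ccontinuous2_const]. }
  assert (CG1 : ccontinuous2 (fun y t => (Uy y t + - f0 * (U y t * / r)) * / c)%C).
  { apply (ccontinuous2_mult (fun y t => Uy y t + - f0 * (U y t * / r))%C); [|apply ccontinuous2_const].
    apply ccontinuous2_plus; [split; trivial|].
    apply (ccontinuous2_mult (fun _ _ => (- f0)%C)); [apply ccontinuous2_const|exact CG0]. }
  set (P := fun nu => exists j, nu = (omega j ^ 2)%C /\ omega j <> RtoC 0).
  assert (HP : forall q0, 0 < q0 -> expclosure P tmax (expn (RtoC q0))).
  { intros q0 Hq0 eta Heta. apply (muntz omega d Hinj Hd Hlim); lra. }
  set (e0 := e / (1 + Cmod r + Cmod f0 + Cmod c)).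
  assert (Pr := Cmod_ge_0 r). assert (Pf := Cmod_ge_0 f0). assert (Pc := Cmod_ge_0 c).
  assert (He0 : 0 < e0) by (apply Rdiv_lt_0_compat; lra).
  assert (He0' : e0 * (1 + Cmod r + Cmod f0 + Cmod c) = e) by (unfold e0; field; lra).
  destruct (expclosure_continuous P tmax g0 HP (proj1 (CC _ CG0)) (proj2 (CC _ CG0)) e0 He0) as [G0 [HG0 B0]].
  assert (X1 : expclosure P tmax g1).
  { apply expclosure_eq with (fun t => (Uy 0 t + - f0 * (U 0 t * / r)) * / c)%C.
    - intros t _. unfold g1, g0, Cdiv. ring.
    - apply (expclosure_continuous P tmax _ HP (proj1 (CC _ CG1)) (proj2 (CC _ CG1))). }
  destruct (X1 e0 He0) as [G1 [HG1 B1]]. clear X1.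
  destruct (match_cauchy_data L p p' q w w' omega Xp Xm r f0 c HL Hc Hp Hm 1 0 G0 HG0)
    as [v0 [vy0 [vt0 [S0 [Cb0 D0]]]]].
  destruct (match_cauchy_data L p p' q w w' omega Xp Xm r f0 c HL Hc Hp Hm 0 1 G1 HG1)
    as [v1 [vy1 [vt1 [S1 [Cb1 D1]]]]].
  set (V := fun y t => (1 * v0 y t + v1 y t)%C). set (Vy := fun y t => (1 * vy0 y t + vy1 y t)%C).
  set (Vt := fun y t => (1 * vt0 y t + vt1 y t)%C).
  assert (SV : complex_solution L p q w tau tmax V Vy Vt) by (apply complex_solution_lin; auto).
  assert (CbV : combination mu Yp Ym V) by (apply combination_add; trivial).
  assert (DV : forall t, V 0 t = (r * G0 t)%C /\ Vy 0 t = (f0 * G0 t + c * G1 t)%C).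
  { intros t. unfold V, Vy. destruct (D0 t) as [-> ->]. destruct (D1 t) as [-> ->]. split; ring. }
  clear D0 D1.
  set (E := fun y t => (U y t - V y t)%C).
  assert (DE : forall t, tau <= t <= tmax -> Cmod (E 0 t) <= e /\ Cmod (Uy 0 t - Vy 0 t)%C <= e).
  { intros t Ht. destruct (DV t) as [V0 V1]. unfold E. rewrite V0, V1.
    specialize (B0 t ltac:(lra)). specialize (B1 t ltac:(lra)).
    replace (U 0 t - r * G0 t)%C with (r * (g0 t - G0 t))%C by (unfold g0; field; trivial).
    replace (Uy 0 t - (f0 * G0 t + c * G1 t))%C with (f0 * (g0 t - G0 t) + c * (g1 t - G1 t))%C
      by (unfold g1; field; trivial).
    assert (T1 : Cmod (f0 * (g0 t - G0 t) + c * (g1 t - G1 t)) <= Cmod f0 * e0 + Cmod c * e0).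
    { apply Rle_trans with (1 := Cmod_triangle _ _). rewrite !Cmod_mult.
      apply Rplus_le_compat; apply Rmult_le_compat_l; trivial. }
    assert (T0 : Cmod (r * (g0 t - G0 t)) <= Cmod r * e0).
    { rewrite Cmod_mult. now apply Rmult_le_compat_l. }
    assert (0 <= Cmod r * e0) by (apply Rmult_le_pos; lra).
    assert (0 <= Cmod f0 * e0) by (apply Rmult_le_pos; lra).
    assert (0 <= Cmod c * e0) by (apply Rmult_le_pos; lra).
    split; lra. }
  destruct SV as [SV1 SV2].
  assert (CV1 := rs_cv _ _ _ _ _ _ _ _ _ SV1). assert (CV2 := rs_cv _ _ _ _ _ _ _ _ _ SV2).
  assert (SE1 : real_solution L p q w tau tmax (fun y t => Re (U y t) - Re (V y t))
    (fun y t => Re (Uy y t) - Re (Vy y t)) (fun y t => Re (Ut y t) - Re (Vt y t))).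
  { apply real_solution_eq with (4 := real_solution_lin _ _ _ _ _ _ 1 _ _ _ (-1) _ _ _ HU1 SV1); intros; ring. }
  assert (SE2 : real_solution L p q w tau tmax (fun y t => Im (U y t) - Im (V y t))
    (fun y t => Im (Uy y t) - Im (Vy y t)) (fun y t => Im (Ut y t) - Im (Vt y t))).
  { apply real_solution_eq with (4 := real_solution_lin _ _ _ _ _ _ 1 _ _ _ (-1) _ _ _ HU2 SV2); intros; ring. }
  destruct (Hstab _ _ _ tau e SE1 He) as [N1 HN1].
  { intros t Ht. destruct (DE t Ht) as [E0 E1]. split.
    - apply Rle_trans with (2 := E0). exact (re_le_Cmod (E 0 t)).
    - apply Rle_trans with (2 := E1). exact (re_le_Cmod (Uy 0 t - Vy 0 t)%C). }
  destruct (Hstab _ _ _ tau e SE2 He) as [N2 HN2].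
  { intros t Ht. destruct (DE t Ht) as [E0 E1]. split.
    - apply Rle_trans with (2 := E0). exact (im_le_Cmod (E 0 t)).
    - apply Rle_trans with (2 := E1). exact (im_le_Cmod (Uy 0 t - Vy 0 t)%C). }
  set (n := max N1 N2). specialize (HN1 n ltac:(lia)). specialize (HN2 n ltac:(lia)).
  set (l := steps s 0 n) in *.
  assert (Hl : List.Forall (fun a => 0 < a) l) by now apply steps_pos.
  assert (Hls : lsum l <= s) by now apply steps_sum_le.
  assert (CYp : forall n, ccontinuous2 (fun y _ => Yp n y)).
  { intros i. destruct (Hp i) as [X' [[M _] _]]. exact (ccontinuous2_space L _ _ L0 M). }
  assert (CYm : forall n, ccontinuous2 (fun y _ => Ym n y)).
  { intros i. destruct (Hm i) as [X' [[M _] _]]. exact (ccontinuous2_space L _ _ L0 M). }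
  destruct (combination_avgs mu Yp Ym l V CYp CYm CbV) as [V' [CbV' EV']].
  destruct (combination_sum mu Yp Ym V' CbV') as [N [ap [am [_ Hsum]]]].
  exists N, ap, am. intros y t Hyt.
  destruct (HS _ Hyt) as [Hy [_ Ht2]]. simpl in Hy, Ht2. assert (Ht1 := HQt _ _ Hyt).
  replace (sum_n (fun n => ap n * (expn (omega n ^ 2) t * Xp n y) + am n * (expn (omega n ^ 2) t * Xm n y))%C N)
    with (V' y t).
  2:{ rewrite Hsum. apply sum_n_ext. intros i. unfold Yp, Ym. rewrite clamp_id by exact Hy. reflexivity. }
  replace (u y t) with (U y t) by (unfold U; rewrite !clamp_id; trivial; unfold tau; lra).
  assert (Ke : K * e = eps / 8) by (unfold e; field; lra).
  destruct (EV' y t) as [EV1 EV2].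
  assert (R1 : Rabs (Re (U y t) - Re (V' y t)) <= eps / 8 + eps / 8).
  { rewrite <- EV1.
    assert (A1 := avgs_close l (fun y t => Re (U y t)) y t (Re (U y t)) (eps / 8) Hl CU1).
    assert (A2 := HN1 y t Hy ltac:(unfold tau in *; lra)).
    rewrite (avgs_minus l (fun y t => Re (U y t)) (fun y t => Re (V y t)) y t Hl CU1 CV1), Ke in A2.
    rewrite Rabs_minus_sym.
    replace (avgs l (fun y t => Re (V y t)) y t - Re (U y t)) with
     (- (avgs l (fun y t => Re (U y t)) y t - avgs l (fun y t => Re (V y t)) y t) +
      (avgs l (fun y t => Re (U y t)) y t - Re (U y t))) by ring.
    apply Rle_trans with (1 := Rabs_triang _ _). rewrite Rabs_Ropp. apply Rplus_le_compat; trivial.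
    apply A1. intros z Hzt. left. apply (Hs1 y t y z); trivial; try (unfold tau in *; lra).
    - rewrite Rminus_diag, Rabs_R0. apply cond_pos.
    - rewrite Rabs_minus_sym, Rabs_pos_eq; lra. }
  assert (R2 : Rabs (Im (U y t) - Im (V' y t)) <= eps / 8 + eps / 8).
  { rewrite <- EV2.
    assert (A1 := avgs_close l (fun y t => Im (U y t)) y t (Im (U y t)) (eps / 8) Hl CU2).
    assert (A2 := HN2 y t Hy ltac:(unfold tau in *; lra)).
    rewrite (avgs_minus l (fun y t => Im (U y t)) (fun y t => Im (V y t)) y t Hl CU2 CV2), Ke in A2.
    rewrite Rabs_minus_sym.
    replace (avgs l (fun y t => Im (V y t)) y t - Im (U y t)) with
     (- (avgs l (fun y t => Im (U y t)) y t - avgs l (fun y t => Im (V y t)) y t) +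
      (avgs l (fun y t => Im (U y t)) y t - Im (U y t))) by ring.
    apply Rle_trans with (1 := Rabs_triang _ _). rewrite Rabs_Ropp. apply Rplus_le_compat; trivial.
    apply A1. intros z Hzt. left. apply (Hs2 y t y z); trivial; try (unfold tau in *; lra).
    - rewrite Rminus_diag, Rabs_R0. apply cond_pos.
    - rewrite Rabs_minus_sym, Rabs_pos_eq; lra. }
  apply Rle_lt_trans with (1 := Cmod_le_parts _).
  change (Rabs (Re (U y t) - Re (V' y t)) + Rabs (Im (U y t) - Im (V' y t)) < eps). lra.
Qed.

Theorem mainTheorem2 :
  forall (L tmax : R) (p p' q w w' : R -> R) (f f' : R -> C)
         (T : (R -> C) -> R -> C) (omega : nat -> C) (d : R),
    0 < L -> 0 < tmax ->
    admissible_coefficients L p p' q w w' ->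
    particular_solution L p q w f f' ->
    transmutation_operator L p q w (f' 0) T ->
    (forall m n, omega m = omega n -> m = n) ->
    filterlim (fun n => (RtoC (INR n) / omega n ^ 2)%C) eventually (locally (RtoC d)) ->
    0 < d ->
    let Ep := fun n => transmuted_exp T 1 (omega n) in
    let Em := fun n => transmuted_exp T (-1) (omega n) in
    (forall n y t, 0 <= y <= L ->
       Ep n y t = (Cexp (- (omega n ^ 2 * RtoC t))
                   * T (fun x => Cexp (Ci * omega n * RtoC x)) y)%C /\
       Em n y t = (Cexp (- (omega n ^ 2 * RtoC t))
                   * T (fun x => Cexp (- (Ci * omega n * RtoC x))) y)%C) /\
    (forall n, parabolic_solution L tmax p q w (Ep n) /\
               parabolic_solution L tmax p q w (Em n)) /\
    complete_system L tmax p q w Ep Em.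
Proof.
  intros L tmax p p' q w w' f f' T omega d HL Htm Hc Hf HT Hinj Hlim Hd Ep Em.
  set (Xp := fun n => T (fun x => Cexp (Ci * omega n * RtoC x))).
  set (Xm := fun n => T (fun x => Cexp (- (Ci * omega n) * RtoC x))).
  set (J := Icc (- lfun p w L) (lfun p w L)).
  assert (HE : forall s k z y t, 0 <= y <= L -> k = (RtoC s * Ci * z)%C ->
    transmuted_exp T s z y t = (expn (z ^ 2)%C t * T (fun x => Cexp (k * RtoC x)) y)%C).
  { intros s k z y t Hy ->. unfold transmuted_exp.
    rewrite <- (clo_scal _ _ _ (trans_clo _ _ _ _ _ _ HT) (expn (z ^ 2)%C t)
      (fun x => Cexp (RtoC s * Ci * z * RtoC x))); trivial.
    - f_equal. apply functional_extensionality. intros x. unfold exp_solution, expn.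
      rewrite <- Cexp_plus. f_equal. ring.
    - apply continuous_on_Cderive. intros x. eexists. apply is_Cderive_Cexp. }
  assert (HEp : forall n y t, 0 <= y <= L -> Ep n y t = (expn (omega n ^ 2)%C t * Xp n y)%C).
  { intros n y t Hy. apply HE; trivial. ring. }
  assert (HEm : forall n y t, 0 <= y <= L -> Em n y t = (expn (omega n ^ 2)%C t * Xm n y)%C).
  { intros n y t Hy. apply HE; trivial. replace (RtoC (-1)) with (- (1))%C by (apply C_ext; simpl; ring). ring. }
  assert (Ci2 : (Ci * Ci)%C = (- (1))%C) by (apply C_ext; simpl; ring).
  assert (Hp : forall n, exists X', mode L p q w (omega n ^ 2)%C (Xp n) X' /\
    Xp n 0 = (/ RtoC (rho p w 0))%C /\
    X' 0 = (f' 0 + Ci * omega n * RtoC (1 / rho p w 0 * sqrt (w 0 / p 0)))%C).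
  { intros n. apply (transmuted_mode L p p' q w w' (f' 0) T (Ci * omega n)%C (omega n ^ 2)%C HL Hc HT).
    replace (Ci * omega n * (Ci * omega n))%C with (Ci * Ci * omega n ^ 2)%C by ring. rewrite Ci2. ring. }
  assert (Hm : forall n, exists X', mode L p q w (omega n ^ 2)%C (Xm n) X' /\
    Xm n 0 = (/ RtoC (rho p w 0))%C /\
    X' 0 = (f' 0 - Ci * omega n * RtoC (1 / rho p w 0 * sqrt (w 0 / p 0)))%C).
  { intros n.
    destruct (transmuted_mode L p p' q w w' (f' 0) T (- (Ci * omega n))%C (omega n ^ 2)%C HL Hc HT) as [X' [M [A B]]].
    - replace (- (Ci * omega n) * - (Ci * omega n))%C with (Ci * Ci * omega n ^ 2)%C by ring. rewrite Ci2. ring.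
    - exists X'. split; [exact M|split; [exact A|]]. rewrite B. ring. }
  split; [|split].
  - intros n y t Hy. rewrite HEp, HEm by trivial. unfold expn, Xp, Xm. split; f_equal.
    + f_equal. ring.
    + f_equal. ring.
    + f_equal. apply functional_extensionality. intros x. f_equal. ring.
  - intros n. split.
    + destruct (Hp n) as [X' [M _]].
      apply (mode_parabolic L p p' q w w' _ _ X' tmax (Ep n) HL Hc M). intros; now apply HEp.
    + destruct (Hm n) as [X' [M _]].
      apply (mode_parabolic L p p' q w w' _ _ X' tmax (Em n) HL Hc M). intros; now apply HEm.
  - assert (rho0 : 0 < rho p w 0) by apply exp_pos.
    assert (p0 : 0 < p 0) by (apply (coeff_p_pos _ _ _ _ _ _ Hc); lra).
    assert (w0 : 0 < w 0) by (apply (coeff_w_pos _ _ _ _ _ _ Hc); lra).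
    intros u Hu Q HQ HS eps Heps.
    destruct (modes_complete L p p' q w w' f f' omega d Xp Xm (/ RtoC (rho p w 0))%C (f' 0)
      (RtoC (1 / rho p w 0 * sqrt (w 0 / p 0))) tmax HL Hc Hf Hinj Hlim Hd) with (u := u) (Q := Q) (eps := eps)
      as [N [ap [am H]]]; trivial.
    + rewrite <- RtoC_inv by lra. intros E. apply RtoC_inj in E.
      assert (Z := Rinv_0_lt_compat _ rho0). lra.
    + intros E. apply RtoC_inj in E.
      assert (0 < 1 / rho p w 0 * sqrt (w 0 / p 0)); [|lra].
      apply Rmult_lt_0_compat; [apply Rdiv_lt_0_compat; lra|].
      apply sqrt_lt_R0. now apply Rdiv_lt_0_compat.
    + exists N, ap, am. intros y t Hyt. destruct (HS _ Hyt) as [Hy _]. simpl in Hy.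
      specialize (H y t Hyt).
      rewrite (sum_n_ext _ (fun n => ap n * (expn (omega n ^ 2) t * Xp n y) + am n * (expn (omega n ^ 2) t * Xm n y))%C);
        trivial.
      intros n. now rewrite HEp, HEm.
Qed.
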